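(* There exist a closed smooth manifold $M$, a Riemannian metric $g$ of positive scalar curvature on $M$, and a non-trivial concordance $H$ on $M$ such that $g$ and $e(H)^*g$ are isotopic as metrics of positive scalar curvature. In other words, the following assertion (Botvinnik's ''Topological Conjecture'') is false: for every closed manifold $M$ equipped with a metric $g$ of positive scalar curvature and every non-trivial concordance $H$ on $M$, the metrics $g$ and $e(H)^*g$ are non-isotopic as metrics of positive scalar curvature.
   Context: Let $I=[0,1]$. A (smooth) concordance on a closed smooth manifold $M$ is a diffeomorphism of $M\times I$ which is the identity in a neighborhood of $M\times\{0\}$. For a concordance $H$ of $M$, $e(H)$ denotes the diffeomorphism of $M\times\{1\}$ (identified with $M$) induced by $H$, and $e(H)^*g$ is the pullback of the metric $g$ along it. A concordance $H$ is called trivial if it is isotopic to the identity of $M\times I$ via an isotopy (through diffeomorphisms of $M\times I$) that fixes a neighborhood of $M\times\{0\}$; otherwise it is non-trivial. Two metrics of positive scalar curvature on $M$ are isotopic as metrics of positive scalar curvature if they can be joined by a path of Riemannian metrics of positive scalar curvature on $M$, i.e. they lie in the same path component of the space of positive scalar curvature metrics on $M$. *)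

(* Defs.v *)
From mathcomp Require Import all_boot all_order all_algebra.
From mathcomp Require Import all_classical all_reals all_analysis.

Set Implicit Arguments.
Unset Strict Implicit.
Unset Printing Implicit Defensive.

Import Order.TTheory GRing.Theory Num.Theory.
Import numFieldNormedType.Exports.

Local Open Scope classical_set_scope.
Local Open Scope ring_scope.

Definition unit_itv (R : realType) : set R := [set t : R | 0 <= t <= 1].
Arguments unit_itv : clear implicits.

(** * Smooth functions on subsets of R^n *)

Definition partial (R : realType) (n : nat) (i : 'I_n)
    (f : 'rV[R]_n -> R) : 'rV[R]_n -> R :=
  fun v => 'D_(delta_mx 0 i) f v.

(* [partials [:: i_1; ...; i_k] f] is d_{i_1} ... d_{i_k} f. *)
Definition partials (R : realType) (n : nat) (s : seq 'I_n)
    (f : 'rV[R]_n -> R) : 'rV[R]_n -> R :=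
  foldr (fun i h => partial i h) f s.

(* Meant for open [U]. *)
Definition smooth_open (R : realType) (n : nat) (U : set 'rV[R]_n)
    (f : 'rV[R]_n -> R) : Prop :=
  forall s v, U v ->
    {for v, continuous (partials s f)} /\
    forall i, derivable (partials s f) v (delta_mx 0 i).

(* On an arbitrary subset (used for half spaces and corners), smoothness means
   existence of local smooth extensions to open sets of R^n. *)
Definition smooth_on (R : realType) (n : nat) (A : set 'rV[R]_n)
    (f : 'rV[R]_n -> R) : Prop :=
  forall v, A v -> exists (U : set 'rV[R]_n) (h : 'rV[R]_n -> R),
    [/\ open U, U v, smooth_open U h & forall w, A w -> U w -> f w = h w].

(** * Charts, atlases, smooth maps *)

(* The values of [chart_map] outside [chart_dom], and those of [chart_inv]
   outside [chart_img], are irrelevant. *)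
Record chart (R : realType) (X : topologicalType) (n : nat) := Chart {
  chart_dom : set X ;
  chart_map : X -> 'rV[R]_n ;
  chart_inv : 'rV[R]_n -> X
}.

Definition chart_img (R : realType) (X : topologicalType) (n : nat)
    (c : chart R X n) : set 'rV[R]_n :=
  chart_map c @` chart_dom c.

Definition is_chart (R : realType) (X : topologicalType) (n : nat)
    (c : chart R X n) : Prop :=
  [/\ open (chart_dom c),
      open (chart_img c),
      {within chart_dom c, continuous (chart_map c)},
      {within chart_img c, continuous (chart_inv c)} &
      forall p, chart_dom c p -> chart_inv c (chart_map c p) = p].

Definition local_rep (R : realType) (X Y : topologicalType) (n m : nat)
    (c : chart R X n) (d : chart R Y m) (f : X -> Y) :
    'rV[R]_n -> 'rV[R]_m :=
  fun v => chart_map d (f (chart_inv c v)).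

(* [f] is smooth on the subset [S] of [X]; its values outside [S] are
   irrelevant. *)
Definition smooth_map (R : realType) (X Y : topologicalType) (n m : nat)
    (A : set (chart R X n)) (B : set (chart R Y m))
    (S : set X) (f : X -> Y) : Prop :=
  {within S, continuous f} /\
  forall c d, A c -> B d -> forall j : 'I_m,
    smooth_on
      (chart_map c @` [set p | [/\ S p, chart_dom c p & chart_dom d (f p)]])
      (fun v => local_rep c d f v 0 j).

(* [carrier] may be disconnected; second countability is automatic for a compact
   space covered by charts. *)
Record closed_manifold (R : realType) := ClosedManifold {
  carrier :> topologicalType ;
  dim : nat ;
  atlas : set (chart R carrier dim) ;
  carrier_hausdorff : hausdorff_space carrier ;
  carrier_compact : compact [set: carrier] ;
  atlas_chart : forall c, atlas c -> is_chart c ;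
  atlas_cover : forall p : carrier, exists c, atlas c /\ chart_dom c p ;
  (* smoothness of the transition maps *)
  atlas_smooth : smooth_map atlas atlas [set: carrier] id
}.

Definition chart_at (R : realType) (M : closed_manifold R) (p : M) :
    chart R M (dim M) :=
  sval (cid (atlas_cover p)).

Definition chart_timesR (R : realType) (X : topologicalType) (n : nat)
    (c : chart R X n) : chart R (X * R)%type (n + 1) :=
  @Chart R (X * R)%type (n + 1)
    (chart_dom c `*` [set: R])
    (fun x => row_mx (chart_map c x.1) (const_mx x.2))
    (fun v => (chart_inv c (lsubmx v), rsubmx v 0 0)).

Definition atlas_timesR (R : realType) (X : topologicalType) (n : nat)
    (A : set (chart R X n)) : set (chart R (X * R)%type (n + 1)) :=
  [set chart_timesR c | c in A].

(** * Concordances *)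

(* M x I is handled as a subset of M x R; self-maps of M x I are represented by
   maps defined on M x R whose values outside M x I are irrelevant. *)
Definition cylinder (R : realType) (M : closed_manifold R) :
    set (M * R)%type :=
  [set: M] `*` unit_itv R.
Arguments cylinder {R} M.

Definition cylinder_diffeo (R : realType) (M : closed_manifold R)
    (H : M * R -> M * R) : Prop :=
  let A := atlas_timesR (@atlas R M) in
  let C := cylinder M in
  exists K : M * R -> M * R,
    [/\ smooth_map A A C H, smooth_map A A C K,
        (forall x, C x -> C (H x)), (forall x, C x -> C (K x)) &
        forall x, C x -> K (H x) = x /\ H (K x) = x].

Definition nbhd_of_bottom (R : realType) (M : closed_manifold R)
    (U : set (M * R)%type) : Prop :=
  open U /\ forall p : M, U (p, 0).

Definition concordance (R : realType) (M : closed_manifold R)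
    (H : M * R -> M * R) : Prop :=
  cylinder_diffeo H /\
  exists U, nbhd_of_bottom U /\ forall x, cylinder M x -> U x -> H x = x.

Definition trivial_concordance (R : realType) (M : closed_manifold R)
    (H : M * R -> M * R) : Prop :=
  let A := atlas_timesR (@atlas R M) in
  exists Phi : M * R * R -> M * R,
    [/\ smooth_map (atlas_timesR A) A (cylinder M `*` unit_itv R) Phi,
        (forall t, unit_itv R t -> cylinder_diffeo (fun x => Phi (x, t))),
        (forall x, cylinder M x -> Phi (x, 0) = H x),
        (forall x, cylinder M x -> Phi (x, 1) = x) &
        exists U, nbhd_of_bottom U /\
          forall x t, cylinder M x -> U x -> unit_itv R t -> Phi (x, t) = x].

(* A diffeomorphism of M x I that is the identity near M x {0} preserves
   M x {1}, so nothing is lost by projecting to M. *)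
Definition concordance_end (R : realType) (M : closed_manifold R)
    (H : M * R -> M * R) : M -> M :=
  fun p => (H (p, 1)).1.

(** * Riemannian metrics and scalar curvature *)

(* A (0,2)-tensor field is given by its components
   [g c v i j] = g(d_i, d_j) in each chart [c], at the point with coordinates
   [v]; only [c] in the atlas and [v] in [chart_img c] matter. *)
Definition tensor_field (R : realType) (M : closed_manifold R) : Type :=
  chart R M (dim M) -> 'rV[R]_(dim M) -> 'M[R]_(dim M).

Definition tensor_eq (R : realType) (M : closed_manifold R)
    (g h : tensor_field M) : Prop :=
  forall c v, atlas c -> chart_img c v -> g c v = h c v.

(* Components in [c], at coordinates [v], of the pullback of [g] by [f],
   computed using the chart [d] near the image point; ['J F v] has (i, k) entry
   d_i F_k. *)
Definition pullback_in (R : realType) (M : closed_manifold R)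
    (c d : chart R M (dim M)) (f : M -> M) (g : tensor_field M)
    (v : 'rV[R]_(dim M)) : 'M[R]_(dim M) :=
  let J := jacobian (local_rep c d f) v in
  J *m g d (local_rep c d f v) *m J^T.

Definition pullback (R : realType) (M : closed_manifold R)
    (f : M -> M) (g : tensor_field M) : tensor_field M :=
  fun c v => pullback_in c (chart_at (f (chart_inv c v))) f g v.

Definition riemannian_metric (R : realType) (M : closed_manifold R)
    (g : tensor_field M) : Prop :=
  [/\ (* change of coordinates *)
      (forall c d p, atlas c -> atlas d -> chart_dom c p -> chart_dom d p ->
        g c (chart_map c p) = pullback_in c d id g (chart_map c p)),
      (forall c i j, atlas c -> smooth_open (chart_img c) (fun v => g c v i j)),
      (forall c v, atlas c -> chart_img c v -> (g c v)^T = g c v) &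
      forall c v, atlas c -> chart_img c v ->
        forall u : 'rV[R]_(dim M), u != 0 -> 0 < (u *m g c v *m u^T) 0 0].

Definition christoffel (R : realType) (n : nat) (G : 'rV[R]_n -> 'M[R]_n)
    (k i j : 'I_n) : 'rV[R]_n -> R :=
  fun v => 2^-1 * \sum_(l < n) invmx (G v) k l *
    (partial i (fun w => G w j l) v + partial j (fun w => G w i l) v
     - partial l (fun w => G w i j) v).

(* Sign convention: the round spheres have positive Ricci curvature. *)
Definition ricci (R : realType) (n : nat) (G : 'rV[R]_n -> 'M[R]_n)
    (i j : 'I_n) : 'rV[R]_n -> R :=
  fun v =>
    \sum_(k < n) (partial k (christoffel G k i j) v
                  - partial j (christoffel G k i k) v)
    + \sum_(k < n) \sum_(l < n)
        (christoffel G k k l v * christoffel G l i j v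
         - christoffel G k j l v * christoffel G l i k v).

Definition scalar_curvature (R : realType) (n : nat)
    (G : 'rV[R]_n -> 'M[R]_n) : 'rV[R]_n -> R :=
  fun v => \sum_(i < n) \sum_(j < n) invmx (G v) i j * ricci G i j v.

Definition psc_metric (R : realType) (M : closed_manifold R)
    (g : tensor_field M) : Prop :=
  riemannian_metric g /\
  forall c v, atlas c -> chart_img c v -> 0 < scalar_curvature (g c) v.

(* Continuity on I of a path of metrics for the C^infty topology: uniform
   convergence, on compact subsets of charts, of all partial derivatives of all
   components. *)
Definition smooth_topology_path (R : realType) (M : closed_manifold R)
    (G : R -> tensor_field M) : Prop :=
  forall c (K : set 'rV[R]_(dim M)) (s : seq 'I_(dim M)) (i j : 'I_(dim M)),
    atlas c -> compact K -> K `<=` chart_img c ->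
  forall t e, unit_itv R t -> 0 < e ->
    \forall u \near t, unit_itv R u -> forall v, K v ->
      `|partials s (fun w => G u c w i j) v
        - partials s (fun w => G t c w i j) v| < e.

Definition psc_isotopic (R : realType) (M : closed_manifold R)
    (g h : tensor_field M) : Prop :=
  exists G : R -> tensor_field M,
    [/\ smooth_topology_path G,
        (forall t, unit_itv R t -> psc_metric (G t)),
        tensor_eq (G 0) g & tensor_eq (G 1) h].

Definition topological_conjecture (R : realType) : Prop :=
  forall (M : closed_manifold R) (g : tensor_field M) (H : M * R -> M * R),
    psc_metric g -> concordance H -> ~ trivial_concordance H ->
    ~ psc_isotopic g (pullback (concordance_end H) g).

(* Main.v *)
(** Let [M] be the quotient of R^3 minus the origin by the dilation [x |-> 100 x]
    (that is, S^1 x S^2) with the metric [|x|^-2 dx^2], of scalar curvature 2.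
    The concordance is a barbell diffeomorphism supported in the interior of
    M x I: a spinning of a spherical shell, undone inside a small hole of the
    shell, and sheared so that the shell is threaded by its own image under the
    dilation. Its end is the identity, so that the constant path of metrics
    will do.

    Non-triviality is a count of double points of arcs, in the manner of Dax.
    An isotopy to the identity moves the arcs [p x I], [p] in the circle covered
    by the ray [- r e3]; lift them to arcs [t |-> (Y t, h t)] of R^3 x I, using
    that diffeomorphisms which are the identity on the bottom preserve the top.
    The map [(100 Y t1 - Y t2, h t1 - h t2)], for [t1 <= t2], does not vanish,
    since the maps of the isotopy are injective, and its last coordinate is
    nonpositive at the end of the isotopy and for [t1] or [t2] in {0, 1}. So the
    number of points of the initial slice where the first three coordinates
    vanish and the last one is positive is zero when counted with signs. But
    for the barbell there is exactly one such point, of local degree +-1. *)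

(* The spin rests on the fact that a turn by 4 pi is a null-homotopic loop in SO(3): across the
   shell the loop grows from the constant one to the 4 pi turn about [e3] and shrinks back, so it
   dies out on both sides, while on the plateau in between it is a turn about [e3] that a ball
   centred at [e3] can undo. Along either ramp the antipode [- e3] sweeps the sphere once, in
   opposite senses for the two ramps. The double point comes from the inner ramp alone: once lowered
   by 99/100 and dilated by 100, the pole of a sphere of radius [u] sits at height [100 u - 99],
   which is inside the sphere on the inner ramp and outside it on the outer one. Half angles are
   encoded by rational functions, so that identities and estimates reduce to polynomial ones. The
   signed count is made without homology groups: the signs of the four functions on a fine grid are
   0-cochains with values 0 and 1, and the degree on the starting slice is the sum of the cochain
   [df1 df2 df3 f4], whose coboundary vanishes as soon as some sign is constant on each cell. *)
From HB Require Import structures.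
From mathcomp Require Import all_boot all_order all_algebra.
From mathcomp Require Import all_classical all_reals all_analysis.
From mathcomp Require Import ring lra zify.
Require Import Defs.

Set Implicit Arguments.
Unset Strict Implicit.
Unset Printing Implicit Defensive.

Import Order.TTheory GRing.Theory Num.Theory.
Import numFieldNormedType.Exports.

Local Open Scope classical_set_scope.
Local Open Scope ring_scope.

(** * Calculus of smooth functions *)

Section Smooth.
Context {R : realType}.

(** Being of class C^k near [v], localised at the point so that sums, products, inverses and
    compositions can be treated by induction on [k]. Continuity is recorded at every level because
    partial derivability does not imply it. *)
Fixpoint Cn n (k : nat) (f : 'rV[R]_n -> R) (v : 'rV[R]_n) : Prop :=
  (\forall w \near v, {for w, continuous f}) /\
  if k is k'.+1 then
    (\forall w \near v, forall i, derivable f w (delta_mx 0 i)) /\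
    forall i, Cn k' (partial i f) v
  else True.

Definition sm n (f : 'rV[R]_n -> R) (v : 'rV[R]_n) := forall k, Cn k f v.

Lemma near_near (T : topologicalType) (v : T) (P : T -> Prop) :
  (\forall w \near v, P w) -> \forall w \near v, \forall u \near w, P u.
Proof. by move=> h; apply: (nbhs_interior (A := [set w | P w])). Qed.

Lemma near_eq_continuous n (f g : 'rV[R]_n -> R) (w : 'rV[R]_n) :
  (\forall u \near w, f u = g u) -> {for w, continuous f} ->
  {for w, continuous g}.
Proof.
move=> fg fc; rewrite /prop_for /continuous_at -(nbhs_singleton fg).
exact: cvg_trans (near_eq_cvg fg) fc.
Qed.

Lemma Cn_near n k (f g : 'rV[R]_n -> R) (v : 'rV[R]_n) :
  (\forall w \near v, f w = g w) -> Cn k f v -> Cn k g v.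
Proof.
elim: k f g => [|k IH] f g fg /= [fc fd].
  split=> //; near=> w; apply: (@near_eq_continuous _ f); last by near: w.
  by near: w; apply: near_near fg.
split.
  near=> w; apply: (@near_eq_continuous _ f); last by near: w.
  by near: w; apply: near_near fg.
split.
  near=> w => i; apply: (@near_eq_derivable _ _ _ f).
    by near: w; apply: near_near fg.
  by have := near fd.1 w; apply.
move=> i; apply: IH (fd.2 i); near=> w; apply: near_eq_derive.
by near: w; apply: near_near fg.
Unshelve. all: by end_near. Qed.

Lemma near_all n (v : 'rV[R]_n) (P : 'rV[R]_n -> Prop) :
  (forall w, P w) -> \forall w \near v, P w.
Proof. by move=> h; near=> w; apply: h. Unshelve. all: by end_near. Qed.

Lemma Cn_ext n k (f g : 'rV[R]_n -> R) (v : 'rV[R]_n) :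
  (forall w, f w = g w) -> Cn k f v -> Cn k g v.
Proof. by move=> fg; apply: Cn_near; apply: near_all. Qed.

Lemma CnW n k (f : 'rV[R]_n -> R) (v : 'rV[R]_n) : Cn k.+1 f v -> Cn k f v.
Proof.
elim: k f => [|k IH] f [fc [fd fp]] /=; split=> //.
by split=> // i; apply: IH.
Qed.

Lemma sm_continuous n (f : 'rV[R]_n -> R) (v : 'rV[R]_n) : sm f v -> {for v, continuous f}.
Proof. by move=> /(_ 0%N) [/nbhs_singleton]. Qed.

Lemma sm_near n (f g : 'rV[R]_n -> R) (v : 'rV[R]_n) :
  (\forall w \near v, f w = g w) -> sm f v -> sm g v.
Proof. by move=> fg fs k; apply: Cn_near fg (fs k). Qed.

Lemma sm_ext n (f g : 'rV[R]_n -> R) (v : 'rV[R]_n) :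
  (forall w, f w = g w) -> sm f v -> sm g v.
Proof. by move=> fg; apply: sm_near; apply: near_all. Qed.

Lemma sm_partial n (f : 'rV[R]_n -> R) (v : 'rV[R]_n) i : sm f v -> sm (partial i f) v.
Proof. by move=> fs k; case: (fs k.+1) => _ [_ h]; apply: h. Qed.

Lemma sm_smooth_open n (f : 'rV[R]_n -> R) (U : set 'rV[R]_n) :
  (forall v, U v -> sm f v) -> smooth_open U f.
Proof.
move=> fs s v Uv; have : sm (partials s f) v.
  by elim: s => [|i s IH] /=; [apply: fs|apply: sm_partial].
move=> h; split; first exact: sm_continuous.
by move=> i; case: (h 1%N) => _ [/nbhs_singleton].
Qed.

Lemma Cn_cst n k c (v : 'rV[R]_n) : Cn k (fun _ => c) v.
Proof.
elim: k c => [|k IH] c /=; (split; first by apply: near_all => w; apply: cst_continuous).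
  by [].
split; first by apply: near_all => w i; apply: derivable_cst.
move=> i; apply: Cn_ext (IH 0) => w.
by rewrite /partial derive_cst.
Qed.

Lemma sm_cst n c (v : 'rV[R]_n) : sm (fun _ => c) v.
Proof. by move=> k; apply: Cn_cst. Qed.

Lemma coord_derive n (i j : 'I_n) (v : 'rV[R]_n) :
  is_derive v (delta_mx 0 j) (fun w : 'rV[R]_n => w 0 i) (i == j)%:R.
Proof.
have H : derivable (fun w : 'rV[R]_n => w 0 i) v (delta_mx 0 j) /\
   'D_(delta_mx 0 j) (fun w : 'rV[R]_n => w 0 i) v = (i == j)%:R.
  have : (fun h : R => h^-1 *: ((fun w : 'rV[R]_n => w 0 i)
     (h *: (delta_mx 0 j) + v) - v 0 i)) @ 0^' --> ((i == j)%:R : R).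
    apply: cvg_near_cst; near=> h.
    rewrite !mxE eqxx /= addrK scalerA mulVf ?scale1r //; last first.
      by near: h; apply: nbhs_dnbhs_neq.
  move=> h; split; first by apply/cvg_ex; exists (i == j)%:R.
  exact/cvg_lim.
by case: H => h1 h2; apply: DeriveDef.
Unshelve. all: by end_near. Qed.

Lemma sm_coord n (i : 'I_n) (v : 'rV[R]_n) : sm (fun w => w 0 i) v.
Proof.
have C : \forall w \near v, {for w, continuous (fun w : 'rV[R]_n => w 0 i)}.
  by apply: near_all => w; apply: coord_continuous.
case=> [|k] /=; split=> //.
split; first by apply: near_all => w j; case: (coord_derive i j w).
move=> j; apply: Cn_ext (Cn_cst k (i == j)%:R v) => w.
by rewrite /partial; case: (coord_derive i j w) => _ ->.
Qed.

Lemma CnD n k (f g : 'rV[R]_n -> R) (v : 'rV[R]_n) :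
  Cn k f v -> Cn k g v -> Cn k (fun w => f w + g w) v.
Proof.
elim: k f g => [|k IH] f g /= [fc fd] [gc gd].
  split=> //; near=> w; apply: (@continuousD _ _ _ f g); by near: w.
split; first by near=> w; apply: (@continuousD _ _ _ f g); near: w.
split.
  near=> w => i; apply: (@derivableD _ _ _ f g).
    by have := near fd.1 w; apply.
  by have := near gd.1 w; apply.
move=> i; apply: Cn_near (IH _ _ (fd.2 i) (gd.2 i)); near=> w.
rewrite /partial [RHS](@deriveD _ _ _ f g) //.
  by have := near fd.1 w; apply.
by have := near gd.1 w; apply.
Unshelve. all: by end_near. Qed.

Lemma CnM n k (f g : 'rV[R]_n -> R) (v : 'rV[R]_n) :
  Cn k f v -> Cn k g v -> Cn k (fun w => f w * g w) v.
Proof.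
elim: k f g => [|k IH] f g /= [fc fd] [gc gd].
  split=> //; near=> w; apply: (@continuousM _ _ f g); by near: w.
split; first by near=> w; apply: (@continuousM _ _ f g); near: w.
have fC : Cn k f v by apply: CnW; split.
have gC : Cn k g v by apply: CnW; split.
split.
  near=> w => i; apply: (@derivableM _ _ f g).
    by have := near fd.1 w; apply.
  by have := near gd.1 w; apply.
move=> i; apply: Cn_near (CnD (IH _ _ fC (gd.2 i)) (IH _ _ (fd.2 i) gC)).
near=> w; rewrite /partial [RHS](@deriveM _ _ f g) /=.
- by rewrite [in RHS]/GRing.scale /= (mulrC (g w)).
- by have := near fd.1 w; apply.
by have := near gd.1 w; apply.
Unshelve. all: by end_near. Qed.

Lemma smD n (f g : 'rV[R]_n -> R) (v : 'rV[R]_n) :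
  sm f v -> sm g v -> sm (fun w => f w + g w) v.
Proof. by move=> fs gs k; apply: CnD. Qed.

Lemma smM n (f g : 'rV[R]_n -> R) (v : 'rV[R]_n) :
  sm f v -> sm g v -> sm (fun w => f w * g w) v.
Proof. by move=> fs gs k; apply: CnM. Qed.

Lemma smN n (f : 'rV[R]_n -> R) (v : 'rV[R]_n) : sm f v -> sm (fun w => - f w) v.
Proof.
move=> fs; by apply: sm_ext (smM (sm_cst (-1) v) fs) => w; rewrite mulN1r.
Qed.

Lemma smB n (f g : 'rV[R]_n -> R) (v : 'rV[R]_n) :
  sm f v -> sm g v -> sm (fun w => f w - g w) v.
Proof. by move=> fs gs; apply: smD => //; apply: smN. Qed.

Lemma smX n (f : 'rV[R]_n -> R) (v : 'rV[R]_n) m : sm f v -> sm (fun w => f w ^+ m) v.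
Proof.
move=> fs; elim: m => [|m IH]; first by apply: sm_ext (sm_cst 1 v) => w; rewrite expr0.
by apply: sm_ext (smM fs IH) => w; rewrite exprS.
Qed.

Lemma is_derive_comp_1 (f h : R -> R) (x df dh : R) :
  is_derive x 1 f df -> is_derive (f x) 1 h dh ->
  is_derive x 1 (fun y => h (f y)) (dh * df).
Proof.
move=> [fd <-] [hd <-]; have E := @derive1_comp R f h x fd hd.
rewrite !derive1E in E; apply: DeriveDef; last exact: E.
apply/derivable1_diffP; apply: (@differentiable_comp _ _ _ _ f h x).
  exact/derivable1_diffP.
exact/derivable1_diffP.
Qed.

(** Restricting [f] to the line through [x] in the direction [v] reduces this to the chain rule in
    one variable. *)
Lemma is_derive_comp1 n (f : 'rV[R]_n -> R) (h : R -> R) x v dh :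
  derivable f x v -> is_derive (f x) 1 h dh ->
  is_derive x v (fun w => h (f w)) (dh * 'D_v f x).
Proof.
move=> fd hd; pose g (t : R) := f (t *: v + x).
have g0 : g 0 = f x by rewrite /g scale0r add0r.
have gE (k : 'rV[R]_n -> R) : (fun t => t^-1 *: ((k \o shift x) (t *: v) - k x))
   = (fun t => t^-1 *: (((fun t => k (t *: v + x)) \o shift 0) (t *: (1 : R))
       - (fun t => k (t *: v + x)) 0)).
  by apply/funext => t; rewrite /= scale0r add0r addr0 /GRing.scale /= mulr1.
have gd : is_derive (0 : R) 1 g ('D_v f x).
  apply: DeriveDef; first by move: fd; rewrite /derivable gE.
  by rewrite /derive gE.
have hd' : is_derive (g 0) 1 h dh by rewrite g0.
have hg : is_derive (0 : R) 1 (fun t => h (g t)) (dh * 'D_v f x).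
  exact: is_derive_comp_1 gd hd'.
case: hg => h1 h2; apply: DeriveDef; first by rewrite /derivable (gE (h \o f)).
by rewrite /derive (gE (h \o f)).
Qed.

Lemma smV n (f : 'rV[R]_n -> R) (v : 'rV[R]_n) : f v != 0 -> sm f v ->
  sm (fun w => (f w)^-1) v.
Proof.
move=> fv fs k.
have fn : \forall w \near v, f w != 0.
  have /(_ [set x | x != 0]) := sm_continuous fs; apply.
  by apply: open_nbhs_nbhs; split=> //; apply: open_neq.
have cf : \forall w \near v, {for w, continuous f} by case: (fs 0%N).
have cV : \forall w \near v, {for w, continuous (fun w => (f w)^-1)}.
  by near=> w; apply: (@continuousV _ _ f); near: w.
elim: k => [|k IH] /=; split=> //.
case: (fs k.+1) => /= _ [fd fp].
split.
  near=> w => i; apply: (@derivableV _ _ f); first by near: w.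
  by have := near fd w; apply.
(* The derivative [- f^-2 * f'] involves only [f'] and the inverse itself, to which the induction
   hypothesis applies. *)
move=> i; have := CnM (CnM (Cn_cst k (-1) v) (CnM IH IH)) (fp i).
apply: Cn_near; near=> w; rewrite /partial [RHS](@deriveV _ _ f) /=.
- by rewrite /GRing.scale /= -exprVn expr2 mulN1r.
- by near: w.
by have := near fd w; apply.
Unshelve. all: by end_near. Qed.

(** * A smooth step *)

(** The whole family in [m] is introduced because its span is closed under differentiation, so that
    smoothness is a single induction for all [m]. *)
Definition flat m (x : R) := if 0 < x then x^-1 ^+ m * expR (- x^-1) else 0.

Lemma flat_ge0 m x : 0 <= flat m x.
Proof.
rewrite /flat; case: ifP => // x0; apply: mulr_ge0; last exact: expR_ge0.
by apply: exprn_ge0; rewrite invr_ge0 ltW.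
Qed.

(** This is [exp y >= y^(m+2) / (m+2)!] at [y = 1/x]. A quadratic bound is what makes the derivative
    at 0 vanish. *)
Lemma flat_bound m x : `|flat m x| <= (m.+2)`!%:R * x ^+ 2.
Proof.
rewrite ger0_norm ?flat_ge0 // /flat; case: ifP => x0; last first.
  by rewrite mulr_ge0 ?ler0n ?sqr_ge0.
have i0 : 0 < x^-1 by rewrite invr_gt0.
have F0 : 0 < (m.+2)`!%:R :> R by rewrite ltr0n fact_gt0.
have := expR_ge1Dxn m.+1 (ltW i0); set e := expR _ => he.
have e0 : 0 < e by apply: expR_gt0.
rewrite expRN -/e ler_pdivrMr //.
have -> : x^-1 ^+ m = (m.+2)`!%:R * x ^+ 2 * (x^-1 ^+ m.+2 / (m.+2)`!%:R).
  by rewrite -[m.+2]addn2 exprD addn2; field; rewrite !lt0r_neq0.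
rewrite ler_wpM2l //; first by apply: mulr_ge0; [apply: ler0n|apply: sqr_ge0].
by apply: le_trans he; rewrite lerDr.
Qed.

Lemma inv_derive (x : R) : x != 0 -> is_derive x 1 (fun y : R => y^-1) (- x ^- 2).
Proof.
move=> xn; have d : derivable (id : R -> R) x 1 by apply: derivable_id.
apply: DeriveDef; first exact: (@derivableV _ _ (id : R -> R)).
by rewrite [LHS](@deriveV _ _ (id : R -> R)) // derive_id /GRing.scale /= mulr1.
Qed.

Lemma flat_pos_derive m (x : R) : 0 < x ->
  is_derive x 1 (fun x : R => x^-1 ^+ m * expR (- x^-1))
   (1 *- m * (x^-1 ^+ m.+1 * expR (- x^-1)) + x^-1 ^+ m.+2 * expR (- x^-1)).
Proof.
move=> x0; have dV := inv_derive (lt0r_neq0 x0).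
have d1 : is_derive x 1 (fun y : R => y^-1 ^+ m) (m%:R * x^-1 ^+ m.-1 * - x ^- 2).
  have H := @is_deriveX _ _ (fun y : R => y^-1) m x 1 _ dV.
  have -> : (fun y : R => y^-1 ^+ m) = (fun y : R => y^-1) ^+ m.
    by apply/funext => y; rewrite exprfctE.
  exact: H.
have dE : is_derive x 1 (fun y : R => expR (- y^-1)) (expR (- x^-1) * - - x ^- 2).
  apply: (@is_derive_comp_1 (fun y : R => - y^-1)).
apply: is_derive_eq (@is_deriveM _ _ (fun y : R => y^-1 ^+ m) (fun y : R => expR (- y^-1)) x 1 _ _ d1 dE) _.
rewrite /GRing.scale /=.
case: m d1 => [|m] _ /=; last by rewrite -!exprVn !exprS; ring.
by rewrite expr0 -!exprVn; ring.
Qed.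

Lemma quadratic_derive0 (f : R -> R) (C : R) : f 0 = 0 ->
  (forall h, `|f h| <= C * h ^+ 2) -> is_derive (0 : R) 1 f 0.
Proof.
move=> f0 b.
have H : (fun h : R => h^-1 *: ((f \o shift 0) (h *: 1) - f 0)) @ 0^' --> (0:R).
  have B : \forall h \near (0:R)^', - (C * `|h|) <=
     h^-1 *: ((f \o shift 0) (h *: 1) - f 0) <= C * `|h|.
    near=> h; have h0 : h != 0 by near: h; apply: nbhs_dnbhs_neq.
    rewrite -ler_norml /= addr0 /GRing.scale /= mulr1 f0 subr0.
    rewrite normrM normfV ler_pdivrMl ?normr_gt0 //.
    have -> : `|h| * (C * `|h|) = C * h ^+ 2 by rewrite mulrCA -expr2 real_normK ?num_real.
    exact: b.
  have D : (fun h : R => C * `|h|) @ (0:R)^' --> (0:R).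
    have E : (fun h : R => C * `|h|) @ (0:R) --> (C * `|0:R|).
      by apply: cvgM; [apply: cvg_cst|apply: cvg_norm].
    rewrite normr0 mulr0 in E.
    by apply: cvg_trans E; apply: cvg_app; apply: cvg_within.
  apply: (squeeze_cvgr B) => //.
  by rewrite -[X in _ --> X]oppr0; apply: cvgN; exact: D.
apply: DeriveDef; first by apply/cvg_ex; exists 0.
exact/cvg_lim.
Unshelve. all: by end_near. Qed.

Lemma flat_derive m (x : R) :
  is_derive x 1 (flat m) (- m%:R * flat m.+1 x + flat m.+2 x).
Proof.
have [x0|x0|->] := ltgtP x 0.
- have -> : - m%:R * flat m.+1 x + flat m.+2 x = 0.
    by rewrite /flat ltNge (ltW x0) /= mulr0 addr0.
  apply: (@near_eq_is_derive _ _ _ (fun _ : R => 0 : R)).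
  near=> y; rewrite /flat; have : y < 0 by near: y; apply: lt_nbhsl.
  by move=> y0; rewrite ltNge (ltW y0).
- rewrite /flat x0.
  apply: (@near_eq_is_derive _ _ _ (fun x : R => x^-1 ^+ m * expR (- x^-1))).
    near=> y; have -> // : 0 < y; near: y; exact: lt_nbhsr.
  exact: flat_pos_derive.
have -> : - m%:R * flat m.+1 0 + flat m.+2 0 = 0 :> R.
  by rewrite /flat ltxx mulr0 addr0.
apply: (@quadratic_derive0 _ (m.+2)`!%:R); first by rewrite /flat ltxx.
exact: flat_bound.
Unshelve. all: by end_near. Qed.
Lemma flat_continuous m (x : R) : {for x, continuous (flat m)}.
Proof.
apply: differentiable_continuous; apply/derivable1_diffP.
by case: (flat_derive m x).
Qed.

Lemma sm_flat n m (f : 'rV[R]_n -> R) (v : 'rV[R]_n) : sm f v -> sm (fun w => flat m (f w)) v.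
Proof.
move=> fs k; elim: k m => [|k IH] m /=.
all: have cf : \forall w \near v, {for w, continuous f} by case: (fs 0%N).
all: have cc : \forall w \near v, {for w, continuous (fun w => flat m (f w))}.
1,3: by near=> w; apply: continuous_comp; [near: w|apply: flat_continuous].
  by split.
split=> //; case: (fs k.+1) => /= _ [fd fp].
have D w i : derivable f w (delta_mx 0 i) -> is_derive w (delta_mx 0 i) (fun w => flat m (f w))
    ((- m%:R * flat m.+1 (f w) + flat m.+2 (f w)) * 'D_(delta_mx 0 i) f w).
  by move=> h; apply: is_derive_comp1 => //; apply: flat_derive.
split.
  near=> w => i; have h : forall i, derivable f w (delta_mx 0 i) by near: w.
  by have [] := D w i (h i).
move=> i; have := CnM (CnD (CnM (Cn_cst k (- m%:R) v) (IH m.+1)) (IH m.+2)) (fp i).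
apply: Cn_near; near=> w; have h : forall i, derivable f w (delta_mx 0 i) by near: w.
by have [_ <-] := D w i (h i).
Unshelve. all: by end_near. Qed.

(** The standard smooth step: 0 up to 0, 1 from 1 on, strictly increasing in between. All cut-offs
    below are built from it. *)
Definition st (x : R) := flat 0 x / (flat 0 x + flat 0 (1 - x)).

Lemma flat0_gt0 x : 0 < x -> 0 < flat 0 x.
Proof. by move=> x0; rewrite /flat x0 expr0 mul1r expR_gt0. Qed.

Lemma st_den x : 0 < flat 0 x + flat 0 (1 - x).
Proof.
have [x0|x0] := ltP 0 x; first by rewrite ltr_pwDl ?flat0_gt0 ?flat_ge0.
by rewrite ltr_wpDl ?flat0_gt0 ?flat_ge0 //; lra.
Qed.

Lemma st_le0 x : x <= 0 -> st x = 0.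
Proof. by move=> x0; rewrite /st [X in X / _]/flat ltNge x0 mul0r. Qed.

Lemma st_ge1 x : 1 <= x -> st x = 1.
Proof.
move=> x1; have d := st_den x; rewrite /st.
have E : flat 0 (1 - x) = 0 by rewrite {1}/flat ltNge; have -> : 1 - x <= 0 by lra.
by move: d; rewrite E addr0 => d; rewrite mulfV // lt0r_neq0.
Qed.

Lemma st01 x : 0 <= st x <= 1.
Proof.
have d := st_den x; have := flat_ge0 0 x; have := flat_ge0 0 (1 - x) => a b.
by apply/andP; split; rewrite /st; [apply: divr_ge0; lra|rewrite ler_pdivrMr //; lra].
Qed.

Lemma flat0_lt x y : 0 < y -> x < y -> flat 0 x < flat 0 y.
Proof.
move=> y0 xy; rewrite /flat y0; case: ifP => x0; last by rewrite expr0 mul1r expR_gt0.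
by rewrite !expr0 !mul1r ltr_expR ltrN2 ltf_pV2.
Qed.

Lemma st_lt x y : x < y -> 0 < y -> x < 1 -> st x < st y.
Proof.
move=> xy y0 x1; have dx := st_den x; have dy := st_den y.
rewrite /st ltr_pdivrMr // mulrAC ltr_pdivlMr //.
have a := flat0_lt y0 xy; have b : flat 0 (1 - y) < flat 0 (1 - x).
  by apply: flat0_lt; lra.
have := flat_ge0 0 x; have := flat_ge0 0 (1 - y); have := flat0_gt0 y0.
nra.
Qed.

Lemma sm_st n (f : 'rV[R]_n -> R) (v : 'rV[R]_n) : sm f v -> sm (fun w => st (f w)) v.
Proof.
move=> fs; apply: smM; first exact: sm_flat.
apply: smV; first by rewrite lt0r_neq0 // st_den.
apply: smD; apply: sm_flat => //; apply: smB => //; exact: sm_cst.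
Qed.

Lemma st_continuous : continuous st.
Proof.
move=> x; apply: (@continuousM _ _ (flat 0) (fun x => (flat 0 x + flat 0 (1 - x))^-1)).
  exact: flat_continuous.
apply: (@continuousV _ _ (fun x => flat 0 x + flat 0 (1 - x))).
  by rewrite lt0r_neq0 // st_den.
apply: (@continuousD _ _ _ (flat 0) (fun x => flat 0 (1 - x))).
  exact: flat_continuous.
have c1 : continuous (fun x : R => 1 - x).
  by move=> y; apply: cvgB; [apply: cvg_cst|apply: cvg_id].
by apply: (continuous_comp (c1 x)); apply: flat_continuous.
Qed.

End Smooth.

(** * The quotient of punctured space by a dilation *)

(** Locked, so that powers [lam ^ k] are not treated as powers of a numeral; [lamE] gives the value
    where it matters. *)
Definition lam {R : realType} : R := locked 100.

(** The quotient is modelled on a fundamental domain: every orbit of the dilation has exactly one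
    point with norm in [[1, lam[]. The norm is the maximum norm of the coordinates. The topology is
    not that of the subspace; the two boundary spheres are glued by [hopf_nbhs]. *)
Record hopf_pt (R : realType) :=
  HopfPt { rep : 'rV[R]_3 ; _ : (1 <= `|rep|) && (`|rep| < lam) }.

HB.instance Definition _ (R : realType) := [isSub for @rep R].
HB.instance Definition _ (R : realType) := [Choice of hopf_pt R by <:].

Section HopfPoints.
Context {R : realType}.
Implicit Types (x y : 'rV[R]_3) (p q : hopf_pt R) (k : int).
Local Notation lam := (@lam R).

Lemma lamE : lam = 100 :> R. Proof. by rewrite /lam -lock. Qed.
Lemma lam_gt1 : 1 < lam :> R. Proof. by rewrite lamE; lra. Qed.
Lemma lam_gt0 : 0 < lam :> R. Proof. by rewrite lamE; lra. Qed.
Lemma lam_neq0 : lam != 0 :> R. Proof. by rewrite lt0r_neq0 ?lam_gt0. Qed.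
Lemma lamX_gt0 k : 0 < lam ^ k :> R. Proof. by rewrite exprz_gt0 ?lam_gt0. Qed.
Lemma lamX_neq0 k : lam ^ k != 0 :> R. Proof. by rewrite lt0r_neq0 ?lamX_gt0. Qed.

Lemma lamX_small k : lam ^ (-1) < lam ^ k -> lam ^ k < lam ^ 1 :> R -> k = 0.
Proof. by rewrite !ltr_eXz2l ?lam_gt1 // => h1 h2; lia. Qed.

Lemma lamXE k : lam ^ k = expR (k%:~R * ln lam) :> R.
Proof. by rewrite -powR_intmul ?ltW ?lam_gt0 // /powR (negbTE lam_neq0). Qed.

Lemma dilation_exists (r : R) : 0 < r -> exists k, 1 <= lam ^ k * r < lam.
Proof.
move=> r0; pose y := ln r / ln lam.
have l0 : 0 < ln lam :> R by rewrite ln_gt0 ?lam_gt1.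
have rE : r = expR (y * ln lam) by rewrite divfK ?lt0r_neq0 // lnK // posrE.
exists (- Num.floor y); have /andP[h1 h2] := floor_itv y.
have E : lam ^ (- Num.floor y) * r = expR ((y - (Num.floor y)%:~R) * ln lam).
  rewrite lamXE [X in _ * X]rE -expRD; congr expR; rewrite mulrNz; ring.
have L : lam = expR (1 * ln lam) :> R by rewrite mul1r lnK // posrE lam_gt0.
rewrite E [X in _ < X]L ltr_expR ltr_pM2r // -{1}expR0 ler_expR.
apply/andP; split; first by apply: mulr_ge0; [rewrite subr_ge0|apply: ltW].
by rewrite ltrBlDr addrC -intrD1.
Qed.

Definition hopf_base : hopf_pt R.
Proof.
apply: (@HopfPt R (const_mx 1)).
have -> : `|const_mx 1 : 'rV[R]_3| = 1.
  rewrite [`|_|]mx_normrE; apply: le_anti; apply/andP; split.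
    by apply/bigmax_leP; split=> // -[i j] _ /=; rewrite mxE normr1.
  by apply/bigmax_geP; right; exists (0, 0) => //=; rewrite mxE normr1.
by rewrite lexx lam_gt1.
Qed.

Lemma repP p : 1 <= `|rep p| < lam. Proof. by case: p. Qed.

Lemma repP1 p : 1 <= `|rep p| < 1 * lam.
Proof. by rewrite mul1r repP. Qed.

Lemma rep_neq0 p : rep p != 0.
Proof. by rewrite -normr_gt0; have /andP[h _] := repP p; lra. Qed.

(* The value at the origin is irrelevant. *)
Definition pr x : hopf_pt R :=
  insubd hopf_base (lam ^ xget 0 [set k | 1 <= lam ^ k * `|x| < lam] *: x).

Lemma normZlam k x : `|lam ^ k *: x| = lam ^ k * `|x|.
Proof. by rewrite normrZ gtr0_norm ?lamX_gt0. Qed.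

Lemma scale_neq0 k x : x != 0 -> lam ^ k *: x != 0.
Proof. by move=> x0; rewrite scaler_eq0 negb_or x0 lamX_neq0. Qed.

Lemma scaleK k x : lam ^ (- k) *: (lam ^ k *: x) = x.
Proof. by rewrite scalerA -expfzDr ?lam_neq0 // addNr scale1r. Qed.

Lemma rep_pr x : x != 0 -> exists k, rep (pr x) = lam ^ k *: x.
Proof.
move=> x0; rewrite /pr.
case: (xgetP 0 [set k | 1 <= lam ^ k * `|x| < lam]) => [k _ kP|H]; last first.
  have [k kP] := dilation_exists (r := `|x|) ltac:(by rewrite normr_gt0).
  by case: (H k).
by exists k; rewrite insubdK // unfold_in /= normZlam.
Qed.

(** The quotient of two norms in a half-open annulus of ratio [lam] lies strictly between [lam^-1]
    and [lam]. *)
Lemma dilation_inj k x (c : R) : c <= `|x| < c * lam -> c <= `|lam ^ k *: x| < c * lam ->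
  0 < c -> k = 0.
Proof.
rewrite normZlam => /andP[a1 a2] /andP[b1 b2] c0; have p := lamX_gt0 k.
have l0 := lam_gt0; apply: lamX_small; last first.
  rewrite expr1z ltNge; apply/negP => h.
  have : c * lam <= `|x| * lam ^ k by apply: ler_pM => //; rewrite ltW.
  by rewrite (mulrC `|x|) leNgt b2.
rewrite exprN1 ltNge; apply/negP => h.
have : lam ^ k * `|x| < lam^-1 * (c * lam).
  by apply: le_lt_trans (ler_wpM2r (normr_ge0 _) h) _; rewrite ltr_pM2l // invr_gt0.
by rewrite mulrCA mulVf ?lam_neq0 // mulr1 ltNge b1.
Qed.

Lemma pr_scale k x : x != 0 -> pr (lam ^ k *: x) = pr x.
Proof.
move=> x0; apply: val_inj => /=.
have [i E1] := rep_pr (scale_neq0 k x0); have [j E2] := rep_pr x0.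
have := repP1 (pr (lam ^ k *: x)); have := repP1 (pr x).
rewrite E1 E2 => h2 h1.
have E : lam ^ i *: (lam ^ k *: x) = lam ^ (i + k - j) *: (lam ^ j *: x).
  by rewrite !scalerA -!expfzDr ?lam_neq0 // subrK.
rewrite E in h1 *; have := dilation_inj h2 h1 ltr01 => ->.
by rewrite expr0z scale1r.
Qed.

Lemma pr_rep p : pr (rep p) = p.
Proof.
apply: val_inj => /=; have [k E] := rep_pr (rep_neq0 p).
have := repP1 (pr (rep p)); have := repP1 p; rewrite E => h1 h2.
by rewrite (dilation_inj h1 h2 ltr01) expr0z scale1r.
Qed.

Lemma pr_eqP x y : x != 0 -> y != 0 -> pr x = pr y -> exists k, y = lam ^ k *: x.
Proof.
move=> x0 y0 E; have [i E1] := rep_pr x0; have [j E2] := rep_pr y0.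
exists (- j + i); rewrite expfzDr ?lam_neq0 // -scalerA -E1 E E2.
by rewrite scaleK.
Qed.

(** The projection is injective on such an open annulus, which therefore carries a chart. Varying
    [c] moves the seam away from any given point. *)
Definition window (c : R) : set 'rV[R]_3 := [set x | c < `|x| < c * lam].

Lemma window_neq0 c x : 0 < c -> window c x -> x != 0.
Proof. by move=> c0 /andP[h _]; rewrite -normr_gt0; lra. Qed.

Lemma pr_window c x y : 0 < c -> window c x -> window c y -> pr x = pr y -> x = y.
Proof.
move=> c0 wx wy /(pr_eqP (window_neq0 c0 wx) (window_neq0 c0 wy)) [k E].
move: wx wy; rewrite E /window /= => /andP[a1 a2] /andP[b1 b2].
rewrite (@dilation_inj k x c) ?expr0z ?scale1r //; first by rewrite ltW.
by rewrite ltW.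
Qed.

Lemma window_open c : open (window c).
Proof.
have cn : continuous (fun x : 'rV[R]_3 => `|x|) by exact: norm_continuous.
rewrite (_ : window c = (fun x => `|x|) @^-1` [set r | c < r] `&`
  (fun x => `|x|) @^-1` [set r | r < c * lam]); last first.
  by apply/seteqP; split=> x /=; [move=> /andP|move=> [h1 h2]; rewrite /window /= h1].
apply: openI; apply: open_comp => //; try by move=> *; apply: cn.
Qed.

(** * The quotient topology *)

Definition hopf_nbhs p : set_system (hopf_pt R) := fun A => nbhs (rep p) (pr @^-1` A).
HB.instance Definition _ := hasNbhs.Build (hopf_pt R) hopf_nbhs.

Lemma nbhs_prE p A : nbhs p A = nbhs (rep p) (pr @^-1` A). Proof. by []. Qed.

Lemma scale_near k x (A : set 'rV[R]_3) :
  nbhs (lam ^ k *: x) A -> \forall y \near x, A (lam ^ k *: y).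
Proof.
have c : {for x, continuous (fun y : 'rV[R]_3 => lam ^ k *: y)}.
  exact: scaler_continuous.
by move=> /c.
Qed.

Lemma near_neq0 x : x != 0 -> \forall y \near x, y != 0.
Proof.
rewrite -normr_gt0 => x0; have /(_ [set r | 0 < r]) h := @norm_continuous R 'rV[R]_3 x.
have : \forall y \near x, 0 < `|y|.
  by apply: h; apply: open_nbhs_nbhs; split=> //; apply: open_gt.
by apply: filterS => y; rewrite normr_gt0.
Qed.

Lemma nbhs_pr_scale k x A : x != 0 ->
  nbhs (lam ^ k *: x) (pr @^-1` A) -> nbhs x (pr @^-1` A).
Proof.
move=> x0 /scale_near h; near=> y.
have y0 : y != 0 by near: y; apply: near_neq0.
by rewrite /preimage /= -(pr_scale k y0); near: y.
Unshelve. all: by end_near. Qed.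

(** Neighbourhoods in the quotient are read at the representative in the fundamental domain; as
    dilations are homeomorphisms, any other point of the orbit gives the same ones. *)
Lemma nbhs_pr x A : x != 0 -> nbhs (pr x) A <-> nbhs x (pr @^-1` A).
Proof.
move=> x0; have [k E] := rep_pr x0; rewrite nbhs_prE E; split.
  exact: nbhs_pr_scale.
move=> h; apply: (@nbhs_pr_scale (- k)); first exact: scale_neq0.
by rewrite scaleK.
Qed.

Lemma hopf_nbhs_filter p : ProperFilter (nbhs p).
Proof.
split; first by move=> h; have := nbhs_singleton (h : nbhs (rep p) _).
split; first exact: filterT.
  by move=> A B; apply: filterI.
by move=> A B AB; apply: filterS => x; apply: AB.
Qed.

Lemma hopf_nbhs_singleton p A : nbhs p A -> A p.
Proof. by rewrite nbhs_prE => /nbhs_singleton /=; rewrite pr_rep. Qed.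

Lemma hopf_nbhs_nbhs p A : nbhs p A -> nbhs p (nbhs^~ A).
Proof.
rewrite nbhs_prE => /near_near h; rewrite nbhs_prE; near=> x.
have x0 : x != 0 by near: x; apply/near_neq0/rep_neq0.
by apply/(nbhs_pr _ x0); near: x.
Unshelve. all: by end_near. Qed.

HB.instance Definition _ := Nbhs_isNbhsTopological.Build (hopf_pt R)
  hopf_nbhs_filter hopf_nbhs_singleton hopf_nbhs_nbhs.

Lemma pr_continuous x : x != 0 -> {for x, continuous pr}.
Proof. by move=> x0 A /(nbhs_pr _ x0). Qed.

(** Over the complement of the orbits of points of norm [c], every point lifts to the window. Among
    the candidates 2, 3, 4 for [c], at least one differs from both given norms. With both points in
    one window, they can be separated in R^3. *)
Lemma common_window p q : exists (c : R) (x y : 'rV[R]_3),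
  [/\ 0 < c, window c x, window c y & pr x = p /\ pr y = q].
Proof.
have H (c : R) (r : hopf_pt R) : 1 < c < lam -> c != `|rep r| ->
   exists x, window c x /\ pr x = r.
  move=> /andP[c1 c2] cr; have /andP[r1 r2] := repP r; have l := lam_gt1.
  have [h|h|h] := ltgtP c `|rep r|; last by rewrite h eqxx in cr.
    exists (rep r); rewrite pr_rep; split=> //; rewrite /window /= h /=.
    by apply: lt_trans r2 _; rewrite ltr_pMl ?lam_gt0.
  exists (lam ^ 1 *: rep r); rewrite pr_scale ?rep_neq0 // pr_rep; split=> //.
  rewrite /window /= normZlam expr1z mulrC ltr_pM2r ?lam_gt0 // h andbT.
  by apply: lt_le_trans c2 _; rewrite ler_peMl // ltW // lam_gt0.
have [c [c1 cp cq]] : exists c : R, [/\ 1 < c < lam, c != `|rep p| & c != `|rep q|].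
  have E (c : R) : c = 2 \/ c = 3 \/ c = 4 -> 1 < c < lam.
    by rewrite lamE => h; apply/andP; split; lra.
  have [h2|h2] := boolP ((2 != `|rep p|) && (2 != `|rep q|)).
    by exists 2; case/andP: h2; split=> //; apply: E; left.
  have [h3|h3] := boolP ((3 != `|rep p|) && (3 != `|rep q|)).
    by exists 3; case/andP: h3; split=> //; apply: E; right; left.
  exists 4; split; first by apply: E; right; right.
    by apply/eqP => e4; move: h2 h3; rewrite -e4 !negb_and !negbK => /orP[]/eqP ? /orP[]/eqP ?; lra.
  by apply/eqP => e4; move: h2 h3; rewrite -e4 !negb_and !negbK => /orP[]/eqP ? /orP[]/eqP ?; lra.
have [x [wx xp]] := H c p c1 cp; have [y [wy yq]] := H c q c1 cq.
by exists c, x, y; split=> //; case/andP: c1; lra.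
Qed.

Lemma hopf_hausdorff : hausdorff_space (hopf_pt R).
Proof.
move=> p q cl; have [c [x [y [c0 wx wy [xp yq]]]]] := common_window p q.
have [xy|xy] := eqVneq x y; first by rewrite -xp -yq xy.
have := @norm_hausdorff _ 'rV[R]_3; rewrite open_hausdorff => /(_ _ _ xy) [[U V] /=].
rewrite !inE => -[Ux Vy] [Uo Vo UV].
have E pp qq : pr x = pp -> pr y = qq -> cluster (nbhs pp) qq -> pp = qq.
  move=> <- <- /(_ (pr @` (U `&` window c)) (pr @` (V `&` window c))) [].
  - apply/(nbhs_pr _ (window_neq0 c0 wx)).
    have : nbhs x (U `&` window c).
      by apply: open_nbhs_nbhs; split=> //; apply: openI => //; apply: window_open.
    by apply: filterS => z ?; exists z.
  - apply/(nbhs_pr _ (window_neq0 c0 wy)).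
    have : nbhs y (V `&` window c).
      by apply: open_nbhs_nbhs; split=> //; apply: openI => //; apply: window_open.
    by apply: filterS => z ?; exists z.
  move=> m [[u [Uu wu] <-] [v [Vv wv] vu]].
  have e := pr_window c0 wv wu vu; move: Vv; rewrite e => Vu.
  by have := conj Uu Vu : (U `&` V) u; rewrite UV.
exact: E xp yq cl.
Qed.

Lemma hopf_compact : compact [set: hopf_pt R].
Proof.
pose K := [set x : 'rV[R]_3 | 1 <= `|x| <= lam].
have -> : [set: hopf_pt R] = pr @` K.
  apply/seteqP; split=> // p _; exists (rep p); last exact: pr_rep.
  by have /andP[h1 h2] := repP p; rewrite /K /= h1 ltW.
apply: continuous_compact.
  apply: continuous_in_subspaceT => x; rewrite inE => /andP[x1 _].
  by apply: pr_continuous; rewrite -normr_gt0; lra.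
have cn : continuous (fun x : 'rV[R]_3 => `|x|) by exact: norm_continuous.
apply: bounded_closed_compact.
  exists lam; split; first by rewrite num_real.
  by move=> M lM x /andP[_ xl]; apply: le_trans xl (ltW lM).
rewrite (_ : K = (fun x => `|x|) @^-1` [set r | 1 <= r] `&`
  (fun x => `|x|) @^-1` [set r | r <= lam]); last first.
  by apply/seteqP; split=> x /=; [move=> /andP|move=> [h1 h2]; rewrite /K /= h1].
apply: closedI; apply: closed_comp => //; try by move=> *; apply: cn.
Qed.

(** * Charts and the smooth structure *)

Definition wrep c p := xget 0 [set x | window c x /\ pr x = p].

Lemma wrep_pr c x : 0 < c -> window c x -> wrep c (pr x) = x.
Proof.
move=> c0 wx; rewrite /wrep; case: xgetP => [y _ [wy E]|/(_ x) []] //.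
exact: pr_window c0 wy wx E.
Qed.

Definition hchart c : chart R (hopf_pt R) 3 := Chart (pr @` window c) (wrep c) pr.
Definition hatlas : set (chart R (hopf_pt R) 3) := [set hchart c | c in [set c : R | 0 < c]].

Lemma hchart_img c : 0 < c -> chart_img (hchart c) = window c.
Proof.
move=> c0; apply/seteqP; split=> x.
  by move=> [_ [y wy <-] <-] /=; rewrite wrep_pr.
by move=> wx; exists (pr x); [exists x|rewrite /= wrep_pr].
Qed.

Lemma hchart_dom_open c : 0 < c -> open (pr @` window c).
Proof.
move=> c0; rewrite openE => _ [x wx <-].
apply/(nbhs_pr _ (window_neq0 c0 wx)).
have : nbhs x (window c) by apply: open_nbhs_nbhs; split=> //; apply: window_open.
by apply: filterS => z wz; exists z.
Qed.

Lemma wrep_continuous c x : 0 < c -> window c x -> {for pr x, continuous (wrep c)}.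
Proof.
move=> c0 wx A; rewrite wrep_pr // => nA; apply/(nbhs_pr _ (window_neq0 c0 wx)).
have : nbhs x (window c) by apply: open_nbhs_nbhs; split=> //; apply: window_open.
move=> wn; near=> y; rewrite /preimage /= wrep_pr //; last by near: y.
by near: y.
Unshelve. all: by end_near. Qed.

Lemma hatlas_chart c : hatlas c -> is_chart c.
Proof.
move=> [r r0 <-]; split.
- exact: hchart_dom_open.
- by rewrite hchart_img //; apply: window_open.
- apply: continuous_in_subspaceT => p; rewrite inE => -[x wx <-].
  exact: wrep_continuous.
- rewrite hchart_img //; apply: continuous_in_subspaceT => x; rewrite inE => wx.
  by apply: pr_continuous; apply: window_neq0 wx.
by move=> _ [x wx <-] /=; rewrite wrep_pr.
Qed.

Lemma hatlas_cover p : exists c, hatlas c /\ chart_dom c p.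
Proof.
have [c [x [_ [c0 wx _ [<- _]]]]] := common_window p p.
by exists (hchart c); split; [exists c|exists x].
Qed.

Lemma smooth_on_near n (A : set 'rV[R]_n) (f : 'rV[R]_n -> R) :
  (forall v, A v -> exists h : 'rV[R]_n -> R, (forall w, sm h w) /\
     \forall w \near v, A w -> f w = h w) -> smooth_on A f.
Proof.
move=> H v Av; have [h [hs hf]] := H v Av.
exists [set w | A w -> f w = h w]^°, h; split.
- exact: open_interior.
- exact: hf.
- by apply: sm_smooth_open => w _; apply: hs.
by move=> w Aw Uw; apply: (interior_subset Uw).
Qed.

(** The dilation that brings [v] into the window also brings nearby points into it, so the exponent
    is locally constant. *)
Lemma transition d v : 0 < d -> v != 0 -> (pr @` window d) (pr v) ->
  exists k, \forall w \near v, wrep d (pr w) = lam ^ k *: w.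
Proof.
move=> d0 v0 [x wx E]; have x0 := window_neq0 d0 wx.
have [k xE] := pr_eqP v0 x0 (esym E).
have h : \forall w \near v, window d (lam ^ k *: w).
  by apply: scale_near; rewrite -xE; apply: open_nbhs_nbhs; split=> //; apply: window_open.
exists k; near=> w; have w0 : w != 0 by near: w; apply: near_neq0.
by rewrite -(pr_scale k w0) wrep_pr //; near: w.
Unshelve. all: by end_near. Qed.

Lemma hatlas_smooth : smooth_map hatlas hatlas [set: hopf_pt R] id.
Proof.
split; first by apply: continuous_subspaceT => p; apply: cvg_id.
move=> _ _ [c c0 <-] [d d0 <-] j.
apply: smooth_on_near => _ [_ [_ [v wv <-] dv] <-].
have -> : chart_map (hchart c) (pr v) = v by exact: wrep_pr.
have v0 := window_neq0 c0 wv.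
have [k kP] := transition d0 v0 dv.
exists (fun w => lam ^ k * w 0 j); split.
  by move=> w; apply: smM; [apply: sm_cst|apply: sm_coord].
near=> w => _; rewrite /local_rep /= (_ : wrep d (pr w) = lam ^ k *: w) ?mxE //.
by near: w.
Unshelve. all: by end_near. Qed.

Definition hopf : closed_manifold R := ClosedManifold hopf_hausdorff hopf_compact
  hatlas_chart hatlas_cover hatlas_smooth.

End HopfPoints.

Arguments hopf : clear implicits.

(** * A barbell diffeomorphism of four-space *)

Section Barbell.
Context {R : realType}.
Implicit Types (a s x y z t n : R).

Notation R3 := (R * R * R)%type.
Notation R4 := (R * R * R * R)%type.

Definition qsq (q : R4) := q.1.1.1 ^+ 2 + q.1.1.2 ^+ 2 + q.1.2 ^+ 2 + q.2 ^+ 2.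

(* Rotation of 3-space by the quaternion [q0 + q1 i + q2 j + q3 k]. *)
Definition rot (q : R4) (v : R3) : R3 :=
  let q0 := q.1.1.1 in let q1 := q.1.1.2 in let q2 := q.1.2 in let q3 := q.2 in
  let x := v.1.1 in let y := v.1.2 in let z := v.2 in
  let p := q0 ^+ 2 - q1 ^+ 2 - q2 ^+ 2 - q3 ^+ 2 in
  let d := 2 * (q1 * x + q2 * y + q3 * z) in
  ((p * x + d * q1 + 2 * q0 * (q2 * z - q3 * y)) / qsq q,
   (p * y + d * q2 + 2 * q0 * (q3 * x - q1 * z)) / qsq q,
   (p * z + d * q3 + 2 * q0 * (q1 * y - q2 * x)) / qsq q).

Definition qconj (q : R4) : R4 := (q.1.1.1, - q.1.1.2, - q.1.2, - q.2).

Definition sq3 (v : R3) := v.1.1 ^+ 2 + v.1.2 ^+ 2 + v.2 ^+ 2.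

Lemma qconjK q : qconj (qconj q) = q.
Proof. by case: q => [[[a b] c] d]; rewrite /qconj /= !opprK. Qed.

Lemma qsq_conj q : qsq (qconj q) = qsq q.
Proof. by rewrite /qsq /= !sqrrN. Qed.

Lemma rotK q v : qsq q != 0 -> rot (qconj q) (rot q v) = v.
Proof.
move=> q0; rewrite /rot qsq_conj; case: v => [[x y] z]; case: q q0 => [[[p i] j] k] /=.
by rewrite /qsq /= => q0; congr ((_, _), _); field.
Qed.

Lemma sq3_rot q v : qsq q != 0 -> sq3 (rot q v) = sq3 v.
Proof.
move=> q0; rewrite /rot /sq3; case: v => [[x y] z]; case: q q0 => [[[p i] j] k] /=.
by rewrite /qsq /= => q0; field.
Qed.

(* With [a], [1 - a^2] proportional to the cosine and sine of a half angle
   [theta / 2], and [1 - 2s], [2s(1-s)] to those of [psi]: rotation by [theta]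
   about [e3], followed by rotation by [theta] about [(sin psi, 0, - cos psi)]. *)
Definition quat s a : R4 :=
  let b := 1 - a ^+ 2 in let C := 1 - 2 * s in let S := 2 * s * (1 - s) in
  let D := 1 - 2 * s + 2 * s ^+ 2 in
  (D * a ^+ 2 + b ^+ 2 * C, a * b * S, - (b ^+ 2 * S), a * b * (D - C)).

(** The quaternion is the product of [D a + b (S i - C k)] and [a + b k], and [C^2 + S^2 = D^2]. *)
Lemma qsq_quat s a : qsq (quat s a) =
  ((1 - 2 * s + 2 * s ^+ 2) * (a ^+ 2 + (1 - a ^+ 2) ^+ 2)) ^+ 2.
Proof. by rewrite /qsq /quat /=; ring. Qed.

Lemma qsq_quat_gt0 s a : 0 < qsq (quat s a).
Proof.
rewrite qsq_quat; apply: exprn_gt0; apply: mulr_gt0; first by nra.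
by have := sqr_ge0 (a ^+ 2 - 1/2); nra.
Qed.

Lemma qsq_quat_neq0 s a : qsq (quat s a) != 0.
Proof. exact/lt0r_neq0/qsq_quat_gt0. Qed.

Lemma rot_scalar q v : qsq q != 0 -> q.1.1.2 = 0 -> q.1.2 = 0 -> q.2 = 0 ->
  rot q v = v.
Proof.
case: q => [[[p i] j] k]; case: v => [[x y] z]; rewrite /rot /qsq /= => + i0 j0 k0.
rewrite i0 j0 k0 !(expr0n, addr0) /= => h.
have p0 : p != 0 by move: h; apply: contra => /eqP ->; rewrite expr0n.
by congr ((_, _), _); field.
Qed.

(** At [s = 0] the two axes are opposite and the turns cancel; at [a = 1] or [a = -1] both turns
    have angle 0 or 2 pi. At [s = 1] the axes agree, and while [a] goes from 1 to -1 the composite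
    turns by 4 pi about [e3]. So [quat] is a null-homotopy of that loop. *)
Lemma rot_quat0 a v : rot (quat 0 a) v = v.
Proof. by apply: rot_scalar; rewrite ?qsq_quat_neq0 // /quat /=; ring. Qed.

Lemma rot_quat1 s a v : a ^+ 2 = 1 -> rot (quat s a) v = v.
Proof.
by move=> a1; apply: rot_scalar; rewrite ?qsq_quat_neq0 // /quat /= a1; ring.
Qed.

(** * Cut-off profiles and the composite of the two spins *)

Definition tm t := 1 - 2 * st (10 * t - 1).

(** As a function of the squared radius: 0 outside [[991/1000, 1008/1000]], 1 on the plateau
    [[993/1000, 1006/1000]], with a ramp on either side. *)
Definition sg1 n := st (500 * n - 991 / 2) * (1 - st (500 * n - 503)).
Definition sg2 n := 1 - st (n - 1).

Definition shift3 c (v : R3) : R3 := (v.1.1, v.1.2, v.2 + c).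

(** The squared distance to the pole [e3] in units of 1/500, a scale at which the ball where [spin2]
    acts fits into the plateau of the shell. *)
Definition hole (v : R3) := 500 ^+ 2 * sq3 (shift3 (-1) v).

Definition spin1 (q : R4) : R4 := (rot (quat (sg1 (sq3 q.1)) (tm q.2)) q.1, q.2).
Definition spin1' (q : R4) : R4 := (rot (qconj (quat (sg1 (sq3 q.1)) (tm q.2))) q.1, q.2).
Definition spin2 (q : R4) : R4 :=
  (shift3 1 (rot (quat (sg2 (hole q.1)) (tm q.2)) (shift3 (-1) q.1)), q.2).
Definition spin2' (q : R4) : R4 :=
  (shift3 1 (rot (qconj (quat (sg2 (hole q.1)) (tm q.2))) (shift3 (-1) q.1)), q.2).

Definition bar (q : R4) := spin1 (spin2' q).
Definition bar' (q : R4) := spin2 (spin1' q).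

Lemma shift3K c v : shift3 (- c) (shift3 c v) = v.
Proof. by case: v => [[x y] z]; rewrite /shift3 /= addrK. Qed.

Lemma shift3NK c v : shift3 c (shift3 (- c) v) = v.
Proof. by case: v => [[x y] z]; rewrite /shift3 /= subrK. Qed.

Lemma spin1K q : spin1' (spin1 q) = q.
Proof.
by case: q => v t; rewrite /spin1' /spin1 /= sq3_rot ?rotK ?qsq_quat_neq0.
Qed.

Lemma spin1'K q : spin1 (spin1' q) = q.
Proof.
case: q => v t; rewrite /spin1' /spin1 /= sq3_rot ?qsq_conj ?qsq_quat_neq0 //.
by rewrite -{1}[quat _ _]qconjK rotK ?qsq_conj ?qsq_quat_neq0.
Qed.

Lemma hole_spin2 q : hole (spin2 q).1 = hole q.1.
Proof. by rewrite /hole /spin2 /= shift3K sq3_rot ?qsq_quat_neq0. Qed.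

Lemma hole_spin2' q : hole (spin2' q).1 = hole q.1.
Proof. by rewrite /hole /spin2' /= shift3K sq3_rot ?qsq_conj ?qsq_quat_neq0. Qed.

Lemma spin2K q : spin2' (spin2 q) = q.
Proof.
rewrite /spin2' hole_spin2; case: q => v t; rewrite /= shift3K rotK ?qsq_quat_neq0 //.
by rewrite shift3NK.
Qed.

Lemma spin2'K q : spin2 (spin2' q) = q.
Proof.
rewrite /spin2 hole_spin2'; case: q => v t; rewrite /= shift3K.
by rewrite -{1}[quat _ _]qconjK rotK ?qsq_conj ?qsq_quat_neq0 // shift3NK.
Qed.

Lemma barK q : bar' (bar q) = q. Proof. by rewrite /bar' /bar spin1K spin2'K. Qed.
Lemma bar'K q : bar (bar' q) = q. Proof. by rewrite /bar' /bar spin2K spin1'K. Qed.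

(** A closed set containing all points that [bar] moves: the shell during the spin, less the hole in
    which the two spins cancel. *)
Definition core : set R4 := [set q |
  [/\ 1/10 <= q.2 <= 1/5, 991/1000 <= sq3 q.1 <= 1008/1000 & 1 <= hole q.1]].

Lemma tm_out t : ~~ (1/10 <= t <= 1/5) -> tm t ^+ 2 = 1.
Proof.
rewrite negb_and -!ltNge => /orP[h|h]; rewrite /tm.
  by rewrite st_le0; [ring|lra].
by rewrite st_ge1; [ring|lra].
Qed.

Lemma hole_shell v : hole v < 2 -> 993/1000 <= sq3 v <= 1006/1000.
Proof.
case: v => [[x y] z]; rewrite /hole /sq3 /shift3 /= => h.
have h1 : (500 * (z - 1)) ^+ 2 < 2 by nra.
have h2 : 997/2 <= 500 * z <= 1003/2 by apply/andP; split; nra.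
by case/andP: h2 => h2 h3; apply/andP; split; nra.
Qed.

Lemma sg2_out v : 2 <= hole v -> sg2 (hole v) = 0.
Proof. by move=> h; rewrite /sg2 st_ge1; [ring|lra]. Qed.

Lemma sg2_in v : hole v <= 1 -> sg2 (hole v) = 1.
Proof. by move=> h; rewrite /sg2 st_le0; [ring|lra]. Qed.

Lemma sg1_mid n : 993/1000 <= n <= 1006/1000 -> sg1 n = 1.
Proof.
move=> /andP[h1 h2]; rewrite /sg1 st_ge1; last by lra.
by rewrite st_le0; [ring|lra].
Qed.

Lemma sg1_out n : ~~ (991/1000 <= n <= 1008/1000) -> sg1 n = 0.
Proof.
rewrite negb_and -!ltNge => /orP[h|h]; rewrite /sg1.
  by rewrite st_le0; [ring|lra].
by rewrite [X in 1 - X]st_ge1; [ring|lra].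
Qed.

Lemma spins_hole v t : hole v <= 1 ->
  spin2' (v, t) = (shift3 1 (rot (qconj (quat 1 (tm t))) (shift3 (-1) v)), t) /\
  spin1 (v, t) = (rot (quat 1 (tm t)) v, t).
Proof.
move=> h; rewrite /spin2' /= sg2_in //; split=> //.
by rewrite /spin1 /= sg1_mid //; apply: hole_shell; lra.
Qed.

(** A turn about [e3] commutes with translations along [e3]. Hence the turn centred at the pole is
    the turn centred at the origin, and the two spins cancel in the hole. *)
Lemma rot_axis c q v : qsq q != 0 -> q.1.1.2 = 0 -> q.1.2 = 0 ->
  rot q (shift3 c v) = shift3 c (rot q v).
Proof.
case: q => [[[p i] j] k]; case: v => [[x y] z]; rewrite /rot /qsq /shift3 /= => + i0 j0.
rewrite i0 j0 !(expr0n, addr0) /= => h.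
by congr ((_, _), _); field.
Qed.

Lemma bar_out q : ~ core q -> bar q = q.
Proof.
case: q => v t nq; rewrite /bar.
have [tJ|tJ] := boolP (1/10 <= t <= 1/5); last first.
  rewrite /spin2' /spin1 /= !rot_quat1 ?tm_out //.
  rewrite -[shift3 (-1) v](rot_quat1 (sg2 (hole v)) _ (tm_out tJ)).
  by rewrite rotK ?qsq_quat_neq0 // shift3NK.
have [h|h] := ltP (hole v) 1.
  have [E _] := spins_hole t (ltW h).
  have := hole_spin2' (v, t); rewrite E /= => h2.
  have [_ ->] := @spins_hole (shift3 1 (rot (qconj (quat 1 (tm t))) (shift3 (-1) v))) t ltac:(by rewrite h2 ltW).
  rewrite rot_axis ?qsq_quat_neq0; [|by []|by rewrite /quat /=; ring|by rewrite /quat /=; ring].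
  rewrite -{1}[quat 1 (tm t)]qconjK rotK ?qsq_conj ?qsq_quat_neq0 //.
  by rewrite shift3NK.
have [n|n] := boolP (991/1000 <= sq3 v <= 1008/1000); first by case: nq; split.
have h2 : 2 <= hole v.
  rewrite leNgt; apply/negP => /hole_shell /andP[n1 n2]; move/negP: n; apply.
  by apply/andP; split; lra.
have E : spin2' (v, t) = (v, t).
  rewrite /spin2' /= sg2_out // -[shift3 (-1) v](rot_quat0 (tm t)).
  by rewrite rotK ?qsq_quat_neq0 // shift3NK.
by rewrite E /spin1 /= sg1_out // rot_quat0.
Qed.

Lemma bar'_out q : ~ core q -> bar' q = q.
Proof. by move=> nq; rewrite -{1}(bar_out nq) barK. Qed.

(** A point sent outside [core] would have an image fixed by the inverse, hence would be its own
    image. *)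
Lemma bar_core q : core q -> core (bar q).
Proof.
move=> cq; apply: contrapT => h; move: (h); rewrite -(barK q) in cq.
by rewrite bar'_out in cq.
Qed.

Lemma bar'_core q : core q -> core (bar' q).
Proof.
move=> cq; apply: contrapT => h; move: (h); rewrite -(bar'K q) in cq.
by rewrite bar_out in cq.
Qed.

(** * The shear, and the embedded barbell *)

Definition dip n := 99/100 * (1 - st (600 * n - 1)).
(** The lift is 3/10 on the neck around the axis, 6/10 where [dip] is being switched off, and 0 far
    from the axis. A spin lasting from 1/10 to 2/10 thus takes place in the disjoint time slots
    [[4/10, 5/10]], [[7/10, 8/10]] and [[1/10, 2/10]]. *)
Definition rise n := 6/10 * (1 - st (150 * n - 1/2)) - 3/10 * (1 - st (2500 * n - 1)).
Definition plane (q : R4) := q.1.1.1 ^+ 2 + q.1.1.2 ^+ 2.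

(* The descent [99/100] brings the hole at [e3] to [e3 / 100], so that a neck of
   the shell passes through the dilated hole; the rise keeps them apart in time. *)
Definition shear (q : R4) : R4 :=
  (q.1.1.1, q.1.1.2, q.1.2 - dip (plane q), q.2 + rise (plane q)).
Definition shear' (q : R4) : R4 :=
  (q.1.1.1, q.1.1.2, q.1.2 + dip (plane q), q.2 - rise (plane q)).

Lemma shearK q : shear' (shear q) = q.
Proof. by case: q => [[[x y] z] t]; rewrite /shear /shear' /plane /= subrK addrK. Qed.
Lemma shear'K q : shear (shear' q) = q.
Proof. by case: q => [[[x y] z] t]; rewrite /shear /shear' /plane /= subrK addrK. Qed.

Definition beta q := shear (bar (shear' q)).
Definition beta' q := shear (bar' (shear' q)).
Definition inC : set R4 := [set q | core (shear' q)].

Lemma betaK q : beta' (beta q) = q.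
Proof. by rewrite /beta' /beta shearK barK shear'K. Qed.
Lemma beta'K q : beta (beta' q) = q.
Proof. by rewrite /beta' /beta shearK bar'K shear'K. Qed.
Lemma beta_out q : ~ inC q -> beta q = q.
Proof. by move=> h; rewrite /beta bar_out ?shear'K. Qed.
Lemma beta'_out q : ~ inC q -> beta' q = q.
Proof. by move=> h; rewrite /beta' bar'_out ?shear'K. Qed.
Lemma beta_inC q : inC q -> inC (beta q).
Proof. by move=> h; rewrite /inC /beta /= shearK; apply: bar_core. Qed.
Lemma beta'_inC q : inC q -> inC (beta' q).
Proof. by move=> h; rewrite /inC /beta' /= shearK; apply: bar'_core. Qed.

Lemma dip_lo n : n <= 1/600 -> dip n = 99/100.
Proof. by move=> h; rewrite /dip st_le0; [ring|lra]. Qed.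
Lemma dip_hi n : 1/300 <= n -> dip n = 0.
Proof. by move=> h; rewrite /dip st_ge1; [ring|lra]. Qed.
Lemma dip_ge0 n : 0 <= dip n <= 99/100.
Proof. by rewrite /dip; have /andP[a b] := st01 (600 * n - 1); apply/andP; split; lra. Qed.

Lemma rise_lo n : n <= 1/2500 -> rise n = 3/10.
Proof.
by move=> h; rewrite /rise st_le0; [rewrite st_le0; [ring|lra]|lra].
Qed.
Lemma rise_low n : n <= 1/1250 -> 3/10 <= rise n.
Proof.
move=> h; rewrite /rise st_le0; last by lra.
by have /andP[a b] := st01 (2500 * n - 1); lra.
Qed.
Lemma rise_mid n : 1/1250 <= n <= 1/300 -> rise n = 6/10.
Proof.
move=> /andP[h h']; rewrite /rise st_le0; last by lra.
by rewrite st_ge1; [ring|lra].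
Qed.
Lemma rise_hi n : 1/100 <= n -> rise n = 0.
Proof.
move=> h; rewrite /rise st_ge1; last by lra.
by rewrite st_ge1; [ring|lra].
Qed.
Lemma rise_ge0 n : 0 <= rise n <= 6/10.
Proof.
have [h|h] := leP n (1/300).
  rewrite /rise st_le0; last by lra.
  by have /andP[a b] := st01 (2500 * n - 1); apply/andP; split; lra.
rewrite /rise [X in _ - _ * (1 - X)]st_ge1; last by lra.
by have /andP[a b] := st01 (150 * n - 1/2); apply/andP; split; lra.
Qed.

(** * Support of the embedded barbell and its dilates *)

Lemma inC_time q : inC q -> 1/10 <= q.2 <= 8/10.
Proof.
case=> /andP[h1 h2] _ _; have /andP[r1 r2] := rise_ge0 (plane q).
by move: h1 h2; rewrite /shear' /= => h1 h2; apply/andP; split; lra.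
Qed.

(** A point near the origin comes, before the shear, from a height about 99/100 on the axis, which
    is still below the inner radius of the shell. So [inC] stays away from the origin and can be
    projected to the quotient. *)
Lemma inC_bounds x y z t : inC (x, y, z, t) ->
  [/\ `|x| <= 2, `|y| <= 2, `|z| <= 2 & 1/250 <= `|x| \/ 1/250 <= `|y| \/ 1/250 <= `|z|].
Proof.
case=> _; rewrite /shear' /plane /sq3 /= => /andP[h1 h2] _.
have := dip_ge0 (x ^+ 2 + y ^+ 2) => /andP[d0 d1].
have X := sqr_ge0 x; have Y := sqr_ge0 y.
have Z := sqr_ge0 (z + dip (x ^+ 2 + y ^+ 2)).
split; try (rewrite ler_norml; apply/andP; split; nra).
have [xs|xs] := ltP `|x| (1/250); last by left.
have [ys|ys] := ltP `|y| (1/250); last by right; left.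
have [zs|zs] := ltP `|z| (1/250); last by right; right.
move: xs ys zs; rewrite !ltr_norml => /andP[x1 x2] /andP[y1 y2] /andP[z1 z2].
have xx : x ^+ 2 <= 1/250/250 by nra.
have yy : y ^+ 2 <= 1/250/250 by nra.
have E : dip (x ^+ 2 + y ^+ 2) = 99/100 by apply: dip_lo; lra.
by move: h1; rewrite E => h1; exfalso; nra.
Qed.

Let far_below r z : 100 <= r -> (r * z + 99/100) ^+ 2 <= 1008/1000 ->
  99/100 <= (z + 99/100) ^+ 2 -> False.
Proof.
move=> r1 h1 h2.
have h3 : -2 <= r * z <= 2 by apply/andP; split; nra.
case/andP: h3 => h3 h4.
have [z0|z0] := leP z (1/1000); last first.
  have : 100 * z <= r * z by apply: ler_wpM2r => //; lra.
  nra.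
have z1 : z <= - 1 by nra.
have : r * z <= 100 * z by rewrite ler_wnM2r //; lra.
lra.
Qed.

Let near_pole r z : 100 <= r -> (r * z) ^+ 2 <= 1008/1000 ->
  99/100 <= (z + 99/100) ^+ 2 -> 49/10000 <= z /\ r * z <= 1005/1000.
Proof.
move=> r1 h1 h2.
have h3 : - (1005/1000) <= r * z <= 1005/1000 by apply/andP; split; nra.
case/andP: h3 => h3 h4; split=> //.
have z1 : - 1 <= z.
  rewrite leNgt; apply/negP => z1.
  have : r * z <= 100 * z by rewrite ler_wnM2r //; lra.
  lra.
nra.
Qed.

Let sqrt_near1 (u : R) : 0 <= u -> 981/1000 <= u ^+ 2 -> 99/100 <= u.
Proof. nra. Qed.

(** The smaller point is so close to the axis that it is fully lowered and lifted by 3/10, which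
    puts [t] in [[4/10, 5/10]]. Let [m] be the squared distance of the larger point to the axis. For
    [m <= 1/600] both are lowered and the heights disagree. For [m] between 1/600 and 1/300, or at
    least 1/100, the larger point lives in another time slot. In between, the larger point is near
    [e3] when [r = 100], so the smaller one is in the hole; a larger [r] is impossible by height. *)
Lemma inC_disjoint (r x y z t : R) : r = 100 \/ 100 * 100 <= r ->
  inC (x, y, z, t) -> ~ inC (r * x, r * y, r * z, t).
Proof.
move=> hr [/= /andP[p1 p2] /andP[p3 p4] p5] [/= /andP[q1 q2] /andP[q3 q4] _].
have r100 : 100 <= r by case: hr; lra.
move: p1 p2 p3 p4 p5 q1 q2 q3 q4.
rewrite /hole /sq3 /shift3 /plane /= !exprMn -mulrDr.
set n := x ^+ 2 + y ^+ 2; set m := r ^+ 2 * n => p1 p2 p3 p4 p5 q1 q2 q3 q4.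
have n0 : 0 <= n by apply: addr_ge0; apply: sqr_ge0.
have r2 : 100 * 100 <= r ^+ 2 by clear -r100; nra.
have mn : 100 * 100 * n <= m by apply: ler_wpM2r.
have m1 : m <= 1008/1000.
  by have := sqr_ge0 (r * z + dip m); clear -q4; lra.
have n1 : n <= 1008/1000 / 100 / 100 by clear -m1 mn; lra.
have dn : dip n = 99/100 by apply: dip_lo; clear -n1; lra.
have rn : rise n = 3/10 by apply: rise_lo; clear -n1; lra.
rewrite dn rn in p1 p2 p3 p4 p5.
have [k1 k2] : 2/10 <= rise m /\ rise m <= 4/10 by clear -p1 p2 q1 q2; split; lra.
have zz : 99/100 <= (z + 99/100) ^+ 2 by clear -p3 n1; lra.
have [l|l] := leP m (1/600).
  apply: (far_below r100 _ zz); rewrite dip_lo // in q4.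
  by have m0 : 0 <= m; [apply: mulr_ge0 => //; apply: sqr_ge0|clear -q4 m0; lra].
have [l'|l'] := leP m (1/300).
  have E : rise m = 6/10 by apply: rise_mid; apply/andP; split; clear -l l'; lra.
  by clear -E k2; lra.
rewrite dip_hi ?addr0 in q3 q4; last by clear -l'; lra.
have m0 : 0 <= m by apply: mulr_ge0 => //; apply: sqr_ge0.
have q5 : (r * z) ^+ 2 <= 1008/1000 by clear -q4 m0; lra.
have [z3 z5] := near_pole r100 q5 zz.
case: hr => hr; last first.
  have : 100 * 100 * z <= r * z by apply: ler_wpM2r => //; clear -z3; lra.
  by clear -z3 z5; lra.
have [g|g] := leP (1/100) m.
  by have E := rise_hi g; clear -E k1; lra.
have z4 : 99/100 <= r * z.
  apply: sqrt_near1; first by apply: mulr_ge0; clear -r100 z3; lra.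
  by clear -q3 g; lra.
have z6 : (r * z - 1) ^+ 2 <= 1/1000 by clear -z4 z5; nra.
have E : m = 100 ^+ 2 * n by rewrite /m hr.
(* Dividing lengths by 100 turns the factor [500^2] into 25, and [25 (1/100 + 1/1000) < 1]: the neck
   fits inside the dilated hole. *)
move: p5; have -> : 500 ^+ 2 * (x ^+ 2 + y ^+ 2 + (z + 99 / 100 + -1) ^+ 2) =
   25 * (100 ^+ 2 * n + (100 * z - 1) ^+ 2) by rewrite /n; field.
by rewrite -E -hr; clear -g z6; lra.
Qed.

(** * Smoothness of the barbell *)

Definition sm4 (n : nat) (f : 'rV[R]_n -> R4) v :=
  [/\ sm (fun w => (f w).1.1.1) v, sm (fun w => (f w).1.1.2) v,
      sm (fun w => (f w).1.2) v & sm (fun w => (f w).2) v].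
Definition sm3 (n : nat) (f : 'rV[R]_n -> R3) v :=
  [/\ sm (fun w => (f w).1.1) v, sm (fun w => (f w).1.2) v & sm (fun w => (f w).2) v].

Ltac smt := repeat first [assumption | refine (sm_cst _ _) | refine (sm_st _) |
  refine (smD _ _) | refine (smN _) | refine (smM _ _) | refine (smX _ _)].

Lemma sm_qsq (n : nat) (q : 'rV[R]_n -> R4) v : sm4 q v -> sm (fun w => qsq (q w)) v.
Proof. by case=> *; rewrite /qsq; smt. Qed.

Lemma sm_rot (n : nat) (q : 'rV[R]_n -> R4) (f : 'rV[R]_n -> R3) v :
  qsq (q v) != 0 -> sm4 q v -> sm3 f v -> sm3 (fun w => rot (q w) (f w)) v.
Proof.
move=> q0 qs; have := smV q0 (sm_qsq qs); case: qs => ? ? ? ? ? [? ? ?].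
by split; rewrite /rot /=; smt.
Qed.

Lemma sm_quat (n : nat) (s a : 'rV[R]_n -> R) v : sm s v -> sm a v ->
  sm4 (fun w => quat (s w) (a w)) v.
Proof. by move=> *; split; rewrite /quat /=; smt. Qed.

Lemma sm_qconj (n : nat) (q : 'rV[R]_n -> R4) v : sm4 q v -> sm4 (fun w => qconj (q w)) v.
Proof. by case=> *; split; rewrite /qconj /=; smt. Qed.

Lemma sm_sq3 (n : nat) (f : 'rV[R]_n -> R3) v : sm3 f v -> sm (fun w => sq3 (f w)) v.
Proof. by case=> *; rewrite /sq3; smt. Qed.

Lemma sm_shift3 (n : nat) c (f : 'rV[R]_n -> R3) v : sm3 f v -> sm3 (fun w => shift3 c (f w)) v.
Proof. by case=> *; split; rewrite /shift3 /=; smt. Qed.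

Lemma sm_hole (n : nat) (f : 'rV[R]_n -> R3) v : sm3 f v -> sm (fun w => hole (f w)) v.
Proof. by move=> fs; have := sm_sq3 (sm_shift3 (-1) fs) => h; rewrite /hole; smt. Qed.

Lemma sm4_pair (n : nat) (f : 'rV[R]_n -> R3) (g : 'rV[R]_n -> R) v :
  sm3 f v -> sm g v -> sm4 (fun w => (f w, g w)) v.
Proof. by case. Qed.

Lemma sm4_fst (n : nat) (f : 'rV[R]_n -> R4) v : sm4 f v ->
  sm3 (fun w => (f w).1) v /\ sm (fun w => (f w).2) v.
Proof. by case. Qed.

Lemma sm_spin1 (n : nat) (f : 'rV[R]_n -> R4) v : sm4 f v ->
  sm4 (fun w => spin1 (f w)) v /\ sm4 (fun w => spin1' (f w)) v.
Proof.
move=> /sm4_fst[f3 ft]; have h := sm_sq3 f3.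
have Q : sm4 (fun w => quat (sg1 (sq3 (f w).1)) (tm (f w).2)) v.
  by apply: sm_quat; rewrite ?/sg1 ?/tm; smt.
split; apply: sm4_pair => //; apply: sm_rot => //.
- exact: qsq_quat_neq0.
- by rewrite /= qsq_conj; apply: qsq_quat_neq0.
exact: sm_qconj.
Qed.

Lemma sm_spin2 (n : nat) (f : 'rV[R]_n -> R4) v : sm4 f v ->
  sm4 (fun w => spin2 (f w)) v /\ sm4 (fun w => spin2' (f w)) v.
Proof.
move=> /sm4_fst[f3 ft]; have h := sm_hole f3.
have Q : sm4 (fun w => quat (sg2 (hole (f w).1)) (tm (f w).2)) v.
  by apply: sm_quat; rewrite ?/sg2 ?/tm; smt.
have s := sm_shift3 (-1) f3.
split; apply: sm4_pair => //; apply: sm_shift3; apply: sm_rot => //.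
- exact: qsq_quat_neq0.
- by rewrite /= qsq_conj; apply: qsq_quat_neq0.
exact: sm_qconj.
Qed.

Lemma sm_plane (n : nat) (f : 'rV[R]_n -> R4) v : sm4 f v -> sm (fun w => plane (f w)) v.
Proof. by case=> *; rewrite /plane; smt. Qed.

Lemma sm_shear (n : nat) (f : 'rV[R]_n -> R4) v : sm4 f v ->
  sm4 (fun w => shear (f w)) v /\ sm4 (fun w => shear' (f w)) v.
Proof.
move=> fs; have h := sm_plane fs; case: fs => *.
by split; split; rewrite /shear /shear' /dip /rise /=; smt.
Qed.

Lemma sm_beta (n : nat) (f : 'rV[R]_n -> R4) v : sm4 f v ->
  sm4 (fun w => beta (f w)) v /\ sm4 (fun w => beta' (f w)) v.
Proof.
move=> fs; split; apply: (sm_shear _).1.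
  exact: (sm_spin1 (sm_spin2 (sm_shear fs).2).2).1.
exact: (sm_spin2 (sm_spin1 (sm_shear fs).2).2).1.
Qed.

End Barbell.

(** * The cover of the cylinder *)

Section Cover.
Context {R : realType}.
Notation R3 := (R * R * R)%type.
Notation R4 := (R * R * R * R)%type.
Local Notation lam := (@lam R).
Implicit Types (q : R4) (v w : 'rV[R]_(3 + 1)).

Definition mk3 (u : R3) : 'rV[R]_3 := \row_(i < 3) [:: u.1.1; u.1.2; u.2]`_i.
Definition mk4 q : 'rV[R]_(3 + 1) := row_mx (mk3 q.1) (const_mx q.2).
Definition q3 (x : 'rV[R]_3) : R3 := (x 0 0, x 0 1, x 0 2).
Definition q4 v : R4 := (q3 (lsubmx v), rsubmx v 0 0).
Definition pr4 q : hopf_pt R * R := (pr (mk3 q.1), q.2).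

Lemma q3K x : mk3 (q3 x) = x.
Proof.
apply/rowP => i; rewrite mxE; case: i => [[|[|[|i]]] hi] //=.
all: by congr (x _ _); apply: val_inj.
Qed.

Lemma mk3K u : q3 (mk3 u) = u.
Proof. by case: u => [[a b] c]; rewrite /q3 !mxE. Qed.

Lemma mk4K q : q4 (mk4 q) = q.
Proof. by case: q => u t; rewrite /q4 /mk4 row_mxKl row_mxKr mk3K mxE. Qed.

Lemma pr4_q4 v : pr4 (q4 v) = (pr (lsubmx v), rsubmx v 0 0).
Proof. by rewrite /pr4 /q4 /= q3K. Qed.

Lemma sm_q4 v : sm4 q4 v.
Proof.
by split; [apply: sm_ext (sm_coord (lshift 1 0) v)|apply: sm_ext (sm_coord (lshift 1 1) v)
  |apply: sm_ext (sm_coord (lshift 1 2) v)|apply: sm_ext (sm_coord (rshift 3 0) v)] => w;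
  rewrite /q4 /= mxE.
Qed.

Lemma rV_continuous (T : topologicalType) n (F : T -> 'rV[R]_n) (x : T) :
  (forall j, {for x, continuous (fun y => F y 0 j)}) -> {for x, continuous F}.
Proof.
move=> H A [P PA PB].
have h : forall j : 'I_n, \forall y \near x, P 0 j (F y 0 j).
  by move=> j; apply: (H j); apply: PA.
have hh : \forall y \near x, forall j, P 0 j (F y 0 j) by apply: filter_forall.
suff : \forall y \near x, A (F y) by [].
near=> y; have hy : forall j, P 0 j (F y 0 j) by near: y.
by apply: PB => i j; rewrite ord1.
Unshelve. all: by end_near. Qed.

Lemma mk3_continuous (T : topologicalType) (f : T -> R3) (x : T) :
  {for x, continuous (fun y => (f y).1.1)} -> {for x, continuous (fun y => (f y).1.2)} ->
  {for x, continuous (fun y => (f y).2)} -> {for x, continuous (fun y => mk3 (f y))}.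
Proof.
move=> h1 h2 h3; apply: rV_continuous => j.
have E (g : T -> R) : (forall y, mk3 (f y) 0 j = g y) -> (fun y => mk3 (f y) 0 j) = g.
  by move=> h; apply/funext.
case: j E => [[|[|[|i]]] hi] // E.
- by rewrite (E (fun y => (f y).1.1)) // => y; rewrite mxE.
- by rewrite (E (fun y => (f y).1.2)) // => y; rewrite mxE.
by rewrite (E (fun y => (f y).2)) // => y; rewrite mxE.
Qed.

Lemma sm_mk3 n (f : 'rV[R]_n -> R3) (v : 'rV[R]_n) : sm3 f v -> forall j, sm (fun u => mk3 (f u) 0 j) v.
Proof.
by move=> [h1 h2 h3]; case=> [[|[|[|i]]] hi] //; [apply: sm_ext h1|apply: sm_ext h2
  |apply: sm_ext h3] => u; rewrite mxE.
Qed.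

Lemma pr4_continuous n (f : 'rV[R]_n -> R4) (v : 'rV[R]_n) : sm4 f v -> mk3 (f v).1 != 0 ->
  {for v, continuous (fun u => pr4 (f u))}.
Proof.
move=> [h1 h2 h3 h4] v0.
have c : {for v, continuous (fun u => mk3 (f u).1)}.
  by apply: mk3_continuous; [exact: sm_continuous h1|exact: sm_continuous h2|exact: sm_continuous h3].
have a : {for v, continuous (fun u => pr (mk3 (f u).1))}.
  exact: (continuous_comp c (pr_continuous v0)).
exact: (cvg_pair a (sm_continuous h4)).
Qed.

Lemma nbhs_pr4 v (A : set (hopf_pt R * R)) : lsubmx v != 0 ->
  nbhs v [set w | A (pr4 (q4 w))] -> nbhs (pr4 (q4 v)) A.
Proof.
move=> v0 /nbhs_ballP [e /= e0 he]; rewrite pr4_q4.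
exists (pr @` ball (lsubmx v) e, ball (rsubmx v 0 0 : R) e) => /=.
  split; last exact: nbhsx_ballx.
  apply/(nbhs_pr _ v0); apply: filterS (nbhsx_ballx (lsubmx v) e e0).
  by move=> y hy; exists y.
move=> [p t] /= [[y hy <-] ht].
have := he (row_mx y (const_mx t)); rewrite /= pr4_q4 row_mxKl row_mxKr mxE.
apply; split=> // i j; rewrite ord1 -[v]hsubmxK.
case: (split_ordP j) => k ->.
  by rewrite !row_mxEl; case: hy => _; apply.
by rewrite !row_mxEr !mxE; move: ht; rewrite mxE ord1.
Qed.

Lemma cover_exists (x : hopf_pt R * R) : exists v, lsubmx v != 0 /\ pr4 (q4 v) = x.
Proof.
exists (row_mx (rep x.1) (const_mx x.2)).
rewrite pr4_q4 row_mxKl row_mxKr mxE pr_rep rep_neq0; split=> //.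
by case: x.
Qed.

(** It suffices to have a smooth lift [B] of [f] near each point of the cover, since the charts of
    the target change it by a locally constant power of [lam]. *)
Lemma smooth_map_local (S : set (hopf_pt R * R)) (f : hopf_pt R * R -> hopf_pt R * R) :
  (forall v, lsubmx v != 0 -> exists B : R4 -> R4,
    [/\ forall w, sm4 (fun w => B (q4 w)) w, mk3 (B (q4 v)).1 != 0 &
        \forall w \near v, f (pr4 (q4 w)) = pr4 (B (q4 w))]) ->
  smooth_map (atlas_timesR (@hatlas R)) (atlas_timesR (@hatlas R)) S f.
Proof.
move=> H; split.
  apply: continuous_subspaceT => x; have [v [v0 <-]] := cover_exists x.
  have [B [Bs B0 hB]] := H v v0; move=> A.
  rewrite (nbhs_singleton hB) => hA; apply: nbhs_pr4 => //.
  have := pr4_continuous (Bs v) B0 hA => h.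
  near=> w; rewrite /= (_ : f _ = pr4 (B (q4 w))); last by near: w.
  by near: w.
move=> _ _ [_ [c c0 <-] <-] [_ [d d0 <-] <-] j.
apply: smooth_on_near => _ [[p t] [_ /= [[x wx xp] _] dp] <-].
rewrite -xp wrep_pr //; set v := row_mx x (const_mx t).
have v0 : lsubmx v != 0 by rewrite row_mxKl; apply: window_neq0 wx.
have pv : pr4 (q4 v) = (p, t) by rewrite pr4_q4 row_mxKl row_mxKr mxE xp.
have [B [Bs B0 hB]] := H v v0.
move: dp; rewrite -pv (nbhs_singleton hB) => -[dp _].
have [k hk] := transition d0 B0 dp.
have ct : {for v, continuous (fun w => mk3 (B (q4 w)).1)}.
  by case: (Bs v) => h1 h2 h3 _; apply: mk3_continuous; [exact: sm_continuous h1
   |exact: sm_continuous h2|exact: sm_continuous h3].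
have hk' : \forall w \near v, wrep d (pr (mk3 (B (q4 w)).1)) = lam ^ k *: mk3 (B (q4 w)).1.
  exact: (ct _ hk).
have E : \forall w \near v, local_rep (chart_timesR (hchart c)) (chart_timesR (hchart d)) f w =
   row_mx (lam ^ k *: mk3 (B (q4 w)).1) (const_mx (B (q4 w)).2).
  near=> w; rewrite /local_rep /= -pr4_q4.
  have -> : f (pr4 (q4 w)) = pr4 (B (q4 w)) by near: w.
  rewrite /= (_ : wrep d _ = lam ^ k *: mk3 (B (q4 w)).1) //.
  by near: w.
case: (split_ordP j) => i ji.
  exists (fun w => lam ^ k * mk3 (B (q4 w)).1 0 i); split.
    move=> w; apply: smM; first exact: sm_cst.
    by apply: sm_mk3; case: (sm4_fst (Bs w)).
  apply: filterS E => w Ew _; rewrite [LHS](congr1 (fun m : 'rV_(3 + 1) => m 0 j) Ew).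
  by rewrite ji row_mxEl mxE.
exists (fun w => (B (q4 w)).2); split; first by move=> w; case: (Bs w).
apply: filterS E => w Ew _; rewrite [LHS](congr1 (fun m : 'rV_(3 + 1) => m 0 j) Ew).
by rewrite ji row_mxEr mxE.
Unshelve. all: by end_near. Qed.

End Cover.

(** * The concordance *)

Section Concordance.
Context {R : realType}.
Notation R4 := (R * R * R * R)%type.
Local Notation lam := (@lam R).
Implicit Types (q : R4) (v w : 'rV[R]_(3 + 1)) (k : int).

Definition sc (r : R) q : R4 := (r * q.1.1.1, r * q.1.1.2, r * q.1.2, q.2).

Lemma mk3_sc r q : mk3 (sc r q).1 = r *: mk3 q.1.
Proof. by apply/rowP => i; rewrite !mxE; case: i => [[|[|[|i]]] hi]. Qed.

Lemma scK k q : sc (lam ^ (- k)) (sc (lam ^ k) q) = q.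
Proof.
case: q => [[[x y] z] t]; rewrite /sc /= !mulrA -expfzDr ?lam_neq0 // addNr expr0z.
by rewrite !mul1r.
Qed.

Lemma sc_sc j k q : sc (lam ^ j) (sc (lam ^ k) q) = sc (lam ^ (j + k)) q.
Proof. by rewrite /sc /= !mulrA -!expfzDr ?lam_neq0. Qed.

Lemma pr4_sc k q : mk3 q.1 != 0 -> pr4 (sc (lam ^ k) q) = pr4 q.
Proof. by move=> q0; rewrite /pr4 mk3_sc pr_scale. Qed.

Lemma pr4_inj q q' : mk3 q.1 != 0 -> mk3 q'.1 != 0 -> pr4 q = pr4 q' ->
  exists k, q' = sc (lam ^ k) q.
Proof.
move=> q0 q0' [E Et]; have [k Ek] := pr_eqP q0 q0' E; exists k.
rewrite -mk3_sc in Ek; have := congr1 q3 Ek; rewrite !mk3K => E1.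
by rewrite [LHS]surjective_pairing E1 -Et.
Qed.

Lemma mk3_norm (u : R * R * R) : [/\ `|u.1.1| <= `|mk3 u|, `|u.1.2| <= `|mk3 u|,
  `|u.2| <= `|mk3 u| & forall c, `|u.1.1| <= c -> `|u.1.2| <= c -> `|u.2| <= c ->
   `|mk3 u| <= c].
Proof.
have H i : `|mk3 u 0 i| <= `|mk3 u|.
  by rewrite [leRHS]mx_normrE; apply/bigmax_geP; right; exists (0, i).
split; [have := H 0|have := H 1|have := H 2|]; rewrite ?mxE //.
move=> c h1 h2 h3; rewrite [leLHS]mx_normrE; apply/bigmax_leP; split.
  by apply: le_trans h1.
by case=> i [[|[|[|j]]] hj] _ //=; rewrite !mxE.
Qed.

Lemma inC_norm q : inC q -> 1/250 <= `|mk3 q.1| <= 2.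
Proof.
case: q => [[[x y] z] t] /inC_bounds [x2 y2 z2 h].
have [hx hy hz hc] := mk3_norm (x, y, z); rewrite hc //= andbT.
by case: h => [|[]] h; apply: le_trans h _.
Qed.

Lemma inC_neq0 q : inC q -> mk3 q.1 != 0.
Proof. by move=> /inC_norm /andP[h _]; rewrite -normr_gt0; lra. Qed.

Lemma inC_sc_pos k q : 0 < k -> inC q -> ~ inC (sc (lam ^ k) q).
Proof.
case: q => [[[x y] z] t] k0 /inC_disjoint h; apply: h.
have [->|k1] := eqVneq k 1; first by left; rewrite expr1z lamE.
right; rewrite -!lamE -[X in X * X <= _]expr1z -expfzDr ?lam_neq0 // ler_eXz2l ?lam_gt1 //.
by lia.
Qed.

Lemma inC_sc k q : inC q -> inC (sc (lam ^ k) q) -> k = 0.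
Proof.
move=> h1 h2; have [k0|k0|//] := ltgtP k 0; last by case: (inC_sc_pos k0 h1 h2).
have := @inC_sc_pos (- k) _ _ h2; rewrite scK; case=> //.
by rewrite oppr_gt0.
Qed.

Lemma inC_unique q q' : inC q -> inC q' -> pr4 q = pr4 q' -> q = q'.
Proof.
move=> h h' E; have [k Ek] := pr4_inj (inC_neq0 h) (inC_neq0 h') E.
by move: h'; rewrite Ek => /(inC_sc h) ->; rewrite expr0z /sc !mul1r; case: (q) => [[[]]].
Qed.

Lemma sm_sc r n (f : 'rV[R]_n -> R4) (v : 'rV[R]_n) : sm4 f v ->
  sm4 (fun u => sc r (f u)) v.
Proof.
by case=> h1 h2 h3 h4; split=> //=; (apply: smM => //; exact: sm_cst).
Qed.

Lemma inC_closed r : closed [set v | inC (sc r (q4 v))].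
Proof.
have cn (f : 'rV[R]_(3 + 1) -> R) : (forall w, sm f w) -> continuous f.
  by move=> h w; apply: sm_continuous.
have S w : sm4 (fun w => shear' (sc r (q4 w))) w.
  by apply: (sm_shear _).2; apply: sm_sc; apply: sm_q4.
have c1 : continuous (fun w => (shear' (sc r (q4 w))).2).
  by apply: cn => w; case: (S w).
have c2 : continuous (fun w => sq3 (shear' (sc r (q4 w))).1).
  by apply: cn => w; apply: sm_sq3; case: (sm4_fst (S w)).
have c3 : continuous (fun w => hole (shear' (sc r (q4 w))).1).
  by apply: cn => w; apply: sm_hole; case: (sm4_fst (S w)).
have cl (f : 'rV[R]_(3 + 1) -> R) (a : R) : continuous f ->
    closed [set w | a <= f w] /\ closed [set w | f w <= a].
  move=> fc; split.
    by apply: (@closed_comp _ _ f [set x | a <= x]) => [w _|]; [apply: fc|exact: closed_ge].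
  by apply: (@closed_comp _ _ f [set x | x <= a]) => [w _|]; [apply: fc|exact: closed_le].
rewrite (_ : [set v | _] =
   ([set w | 1/10 <= (shear' (sc r (q4 w))).2] `&` [set w | (shear' (sc r (q4 w))).2 <= 1/5])
   `&` (([set w | 991/1000 <= sq3 (shear' (sc r (q4 w))).1] `&`
    [set w | sq3 (shear' (sc r (q4 w))).1 <= 1008/1000]) `&`
   [set w | 1 <= hole (shear' (sc r (q4 w))).1])); last first.
  apply/seteqP; split=> w /=; first by case=> /andP[? ?] /andP[? ?] ?.
  by move=> [[a b] [[c d] e]]; split=> //; apply/andP.
apply: closedI; first by apply: closedI; [exact: (cl _ _ c1).1|exact: (cl _ _ c1).2].
apply: closedI; last exact: (cl _ _ c3).1.
by apply: closedI; [exact: (cl _ _ c2).1|exact: (cl _ _ c2).2].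
Qed.

Lemma notinC_near k v : ~ inC (sc (lam ^ k) (q4 v)) ->
  \forall w \near v, ~ inC (sc (lam ^ k) (q4 w)).
Proof.
move=> h; have := closed_openC (@inC_closed (lam ^ k)) => o.
by apply: open_nbhs_nbhs; split; [exact: o|].
Qed.

Let window_low (X : R) : 1/250 < X * (100 * 2) -> 1/100/100/100 < X.
Proof. lra. Qed.

(** Only finitely many dilates of [inC] come near [v]; they are closed, and at most one of them
    contains [v], so the others are avoided by a neighbourhood. *)
Lemma inC_near v : lsubmx v != 0 -> exists k,
  \forall w \near v, forall j, inC (sc (lam ^ j) (q4 w)) -> j = k.
Proof.
move=> v0; have n0 : 0 < `|lsubmx v| by rewrite normr_gt0.
have [m /andP[m1 m2]] := dilation_exists n0.
have N : \forall w \near v, `|lsubmx v| / 2 < `|lsubmx w| < `|lsubmx v| * 2.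
  have c : {for v, continuous (fun w => `|lsubmx w|)}.
    apply: (@continuous_comp _ _ _ (fun w => lsubmx w) (fun x => `|x|)).
      exact/differentiable_continuous/differentiable_lsubmx.
    exact: norm_continuous.
  apply: (c [set r | `|lsubmx v| / 2 < r < `|lsubmx v| * 2]).
  have : open_nbhs `|lsubmx v| (`]`|lsubmx v| / 2, `|lsubmx v| * 2[ : set R).
    split; first exact: itv_open.
    by rewrite /= in_itv /=; apply/andP; split; lra.
  by move/open_nbhs_nbhs; apply: filterS => r; rewrite /= in_itv.
(* Once [lam ^ m] normalises [v], the bounds [1/250] and [2] on the norms in [inC] leave three
   possible exponents. *)
have J w j : `|lsubmx v| / 2 < `|lsubmx w| < `|lsubmx v| * 2 ->
    inC (sc (lam ^ j) (q4 w)) -> j \in [:: m - 2; m - 1; m].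
  move=> /andP[w1 w2] /inC_norm; rewrite mk3_sc /q4 /= q3K normZlam => /andP[i1 i2].
  have jm : lam ^ j = lam ^ (j - m) * lam ^ m by rewrite -expfzDr ?lam_neq0 // subrK.
  have pm := lamX_gt0 (R := R) m; have pj := lamX_gt0 (R := R) (j - m).
  rewrite jm -mulrA in i1 i2.
  have u : lam ^ (j - m) < lam ^ 1.
    rewrite expr1z ltNge; apply/negP => h.
    have h1 : lam * (lam ^ m * `|lsubmx w|) <= 2.
      apply: le_trans i2; apply: ler_wpM2r => //; apply: mulr_ge0 => //; exact: ltW.
    have h2 : 1/2 <= lam ^ m * `|lsubmx w|.
      have : lam ^ m * (`|lsubmx v| / 2) <= lam ^ m * `|lsubmx w|.
        by rewrite ler_pM2l // ltW.
      lra.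
    by move: h1 h2; set X := lam ^ m * _; rewrite lamE; lra.
  have l : lam ^ (- 3) < lam ^ (j - m).
    have h1 : lam ^ m * `|lsubmx w| < lam * 2.
      have : lam ^ m * `|lsubmx w| < lam ^ m * (`|lsubmx v| * 2) by rewrite ltr_pM2l.
      rewrite mulrA; lra.
    have h2 : 1/250 < lam ^ (j - m) * (lam * 2).
      by apply: le_lt_trans i1 _; rewrite ltr_pM2l.
    have h3 : lam ^ (- 3) = 1 / 100 / 100 / 100 :> R.
      by rewrite -[3]/(3%:Z) -exprnN -!lamE !exprS expr0 mulr1; field; exact: lam_neq0.
    by rewrite h3; apply: window_low; rewrite -[X in X * 2]lamE.
  rewrite !ltr_eXz2l ?lam_gt1 // in u l.
  rewrite !inE; have [|[|]] : j = m - 2 \/ j = m - 1 \/ j = m by lia.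
  - by move=> ->; rewrite eqxx.
  - by move=> ->; rewrite eqxx orbT.
  by move=> ->; rewrite eqxx !orbT.
have L (s : seq int) : (forall j, j \in s -> ~ inC (sc (lam ^ j) (q4 v))) ->
    \forall w \near v, forall j, j \in s -> ~ inC (sc (lam ^ j) (q4 w)).
  elim: s => [|a s IH] hs; first by near=> w => j; rewrite in_nil.
  have := IH (fun j js => hs j (mem_behead (s := a :: s) js)) => h1.
  have h2 := notinC_near (hs a (mem_head _ _)).
  near=> w => j; rewrite inE => /orP[/eqP ->|js]; first by near: w.
  by have h : forall j, j \in s -> ~ inC (sc (lam ^ j) (q4 w)); [near: w|apply: h].
pose s := [:: m - 2; m - 1; m].
have [[k hk]|nk] := pselect (exists k, inC (sc (lam ^ k) (q4 v))).
  exists k; have h := L [seq j <- s | j != k] _; near=> w => j hj.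
  apply/eqP/negPn/negP => jk.
  have hw : forall j, j \in [seq j <- s | j != k] -> ~ inC (sc (lam ^ j) (q4 w)).
    near: w; apply: h => i; rewrite mem_filter => /andP[ik _] hi.
    have E : sc (lam ^ i) (q4 v) = sc (lam ^ (i - k)) (sc (lam ^ k) (q4 v)).
      by rewrite sc_sc subrK.
    rewrite E in hi; have := inC_sc hk hi => /eqP; rewrite subr_eq0; exact/negP.
  apply: (hw j) => //; rewrite mem_filter jk /=; apply: J hj; near: w; exact: N.
exists 0; have h := L s _; near=> w => j hj; exfalso.
have hw : forall j, j \in s -> ~ inC (sc (lam ^ j) (q4 w)).
  by near: w; apply: h => i _ hi; apply: nk; exists i.
by apply: (hw j) => //; apply: J hj; near: w; exact: N.
Unshelve. all: by end_near. Qed.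

(** The choice of [q] is harmless: the dilates of [inC] being disjoint, a point of the quotient has
    at most one lift in [inC] ([inC_unique]). *)
Definition Hm (F : R4 -> R4) (x : hopf_pt R * R) : hopf_pt R * R :=
  if pselect (exists q, inC q /\ pr4 q = x) is left e then pr4 (F (sval (cid e))) else x.

Lemma Hm_in F q : inC q -> Hm F (pr4 q) = pr4 (F q).
Proof.
move=> qC; rewrite /Hm; case: pselect => [e|[]]; last by exists q.
by case: (cid e) => q' /= [q'C E]; rewrite (inC_unique q'C qC E).
Qed.

Lemma Hm_out F x : ~ (exists q, inC q /\ pr4 q = x) -> Hm F x = x.
Proof. by rewrite /Hm; case: pselect. Qed.

Section Map.
Variable F : R4 -> R4.
Hypotheses (F_out : forall q, ~ inC q -> F q = q) (F_in : forall q, inC q -> inC (F q)).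
Hypothesis F_sm : forall n (f : 'rV[R]_n -> R4) (v : 'rV[R]_n), sm4 f v -> sm4 (fun u => F (f u)) v.

Lemma F_neq0 q : mk3 q.1 != 0 -> mk3 (F q).1 != 0.
Proof.
move=> q0; have [qC|qC] := pselect (inC q); first by apply/inC_neq0/F_in.
by rewrite F_out.
Qed.

(** This is the local lift from which smoothness follows: [F] conjugated by the only dilation that
    can bring [q] into the support. *)
Lemma Hm_scaled k q : mk3 q.1 != 0 -> (forall j, inC (sc (lam ^ j) q) -> j = k) ->
  Hm F (pr4 q) = pr4 (sc (lam ^ (- k)) (F (sc (lam ^ k) q))).
Proof.
move=> q0 hj; have s0 : mk3 (sc (lam ^ k) q).1 != 0 by rewrite mk3_sc scale_neq0.
rewrite pr4_sc ?F_neq0 // -(pr4_sc k q0).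
have [h|h] := pselect (inC (sc (lam ^ k) q)); first exact: Hm_in.
rewrite F_out // Hm_out // => -[q' [q'C E]].
have [j Ej] := pr4_inj s0 (inC_neq0 q'C) (esym E).
move: (q'C); rewrite Ej sc_sc => /hj jk; move: q'C; rewrite Ej.
have -> : j = 0 by lia.
by rewrite sc_sc add0r.
Qed.

Lemma Hm_smooth S : smooth_map (atlas_timesR (@hatlas R)) (atlas_timesR (@hatlas R)) S (Hm F).
Proof.
apply: smooth_map_local => v v0; have [k hk] := inC_near v0.
have q0 w : lsubmx w != 0 -> mk3 (q4 w).1 != 0 by rewrite /q4 /= q3K.
exists (fun q => sc (lam ^ (- k)) (F (sc (lam ^ k) q))); split.
- by move=> w; apply: sm_sc; apply: F_sm; apply: sm_sc; apply: sm_q4.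
- by rewrite mk3_sc scale_neq0 ?F_neq0 ?mk3_sc ?scale_neq0 ?q0.
have c : {for v, continuous (fun w => lsubmx w)}.
  exact/differentiable_continuous/differentiable_lsubmx.
have n0 : \forall w \near v, lsubmx w != 0 by exact: (c _ (near_neq0 v0)).
near=> w; apply: Hm_scaled; first by apply: q0; near: w.
by near: w.
Unshelve. all: by end_near. Qed.

End Map.

Lemma HmK F G : (forall q, inC q -> inC (F q)) -> (forall q, G (F q) = q) ->
  forall x, Hm G (Hm F x) = x.
Proof.
move=> FC FG x; have [[q [qC <-]]|h] := pselect (exists q, inC q /\ pr4 q = x).
  by rewrite Hm_in // Hm_in ?FG //; apply: FC.
by rewrite Hm_out ?Hm_out.
Qed.

Lemma Hm_cases F x : (forall q, inC q -> inC (F q)) ->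
  Hm F x = x \/ 1/10 <= x.2 <= 8/10 /\ 1/10 <= (Hm F x).2 <= 8/10.
Proof.
move=> FC; have [[q [qC <-]]|h] := pselect (exists q, inC q /\ pr4 q = x).
  by right; rewrite Hm_in //=; split; apply: inC_time => //; apply: FC.
by left; apply: Hm_out.
Qed.

Definition twist : hopf R * R -> hopf R * R := Hm beta.

Lemma twist_concordance : concordance twist.
Proof.
split.
  exists (Hm beta'); split.
  - apply: Hm_smooth; [exact: beta_out|exact: beta_inC|].
    by move=> n f v h; exact: (sm_beta h).1.
  - apply: Hm_smooth; [exact: beta'_out|exact: beta'_inC|].
    by move=> n f v h; exact: (sm_beta h).2.
  - move=> x; case: (Hm_cases x (@beta_inC R)) => [|[_ /andP[h1 h2]]] => [|_].
      by rewrite /twist => ->.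
    by split=> //; apply/andP; split; rewrite /twist; lra.
  - move=> x; case: (Hm_cases x (@beta'_inC R)) => [|[_ /andP[h1 h2]]] => [|_].
      by move=> ->.
    by split=> //; apply/andP; split; lra.
  move=> x _; split; first by apply: HmK; [exact: beta_inC|exact: betaK].
  by apply: HmK; [exact: beta'_inC|exact: beta'K].
exists ([set: hopf R] `*` [set t : R | t < 1/10]); split.
  split; last by move=> p; split=> //=; lra.
  rewrite openE => -[p t] /= [_ t1]; exists ([set: hopf_pt R], [set t : R | t < 1/10]) => /=.
    by split; [exact: filterT|apply: open_nbhs_nbhs; split=> //; exact: open_lt].
  by [].
move=> x _ [_ /= xt]; case: (Hm_cases x (@beta_inC R)) => // -[/andP[h _] _]; exfalso; lra.
Qed.

Lemma twist_end : concordance_end twist = id.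
Proof.
apply/funext => p; rewrite /concordance_end.
case: (Hm_cases (p, 1) (@beta_inC R)) => [|[/andP[_ h] _]]; first by rewrite /twist => ->.
by exfalso; move: h => /=; lra.
Qed.

End Concordance.

(** * The barbell along the axis *)

Section Axis.
Context {R : realType}.
Notation R4 := (R * R * R * R)%type.
Implicit Types (a s r t n : R).

(* [1 - cos theta] and [sin theta], for the angle [theta] encoded by [a]. *)
Definition vers a : R := 2 * (1 - a ^+ 2) ^+ 2 / (a ^+ 2 + (1 - a ^+ 2) ^+ 2).
Definition sine a : R := 2 * a * (1 - a ^+ 2) / (a ^+ 2 + (1 - a ^+ 2) ^+ 2).
(* [sin psi] and [cos psi], for the angle [psi] encoded by [s]. *)
Definition sinp s : R := 2 * s * (1 - s) / (1 - 2 * s + 2 * s ^+ 2).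
Definition cosp s : R := (1 - 2 * s) / (1 - 2 * s + 2 * s ^+ 2).

Lemma den_a a : 0 < a ^+ 2 + (1 - a ^+ 2) ^+ 2.
Proof. by have := sqr_ge0 (a ^+ 2 - 1/2); nra. Qed.
Lemma den_s s : 0 < 1 - 2 * s + 2 * s ^+ 2.
Proof. nra. Qed.

Lemma sinp_cosp s : sinp s ^+ 2 + cosp s ^+ 2 = 1.
Proof. by rewrite /sinp /cosp; field; rewrite lt0r_neq0 ?den_s. Qed.

Lemma sine_vers a : sine a ^+ 2 = vers a * (2 - vers a).
Proof. by rewrite /sine /vers; field; rewrite lt0r_neq0 ?den_a. Qed.

Lemma vers_bound a : 0 <= vers a <= 2.
Proof.
have d := den_a a; rewrite /vers; apply/andP; split.
  by apply: divr_ge0; [apply: mulr_ge0 => //; apply: sqr_ge0|apply: ltW].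
by rewrite ler_pdivrMr // ler_pM2l // lerDr sqr_ge0.
Qed.

(** The first turn fixes [- e3], so this is Rodrigues' formula for the second. The image sweeps the
    sphere once: it equals [e3] only for [psi] a right angle and [theta] a half turn. *)
Lemma rot_axis_quat s a : rot (quat s a) (0, 0, -1) =
  (sinp s * cosp s * vers a, sinp s * sine a, -1 + vers a * sinp s ^+ 2).
Proof.
have da := lt0r_neq0 (den_a a); have ds := lt0r_neq0 (den_s s).
rewrite /rot qsq_quat /quat /= /sinp /cosp /sine /vers.
by congr ((_, _), _); field; rewrite da ds.
Qed.

Lemma rotZ q (c x y z : R) : rot q (c * x, c * y, c * z) =
  (c * (rot q (x, y, z)).1.1, c * (rot q (x, y, z)).1.2, c * (rot q (x, y, z)).2).
Proof. by rewrite /rot /=; congr ((_, _), _); ring. Qed.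

(* The arc over [- r e3], with [u = r - 99/100] the distance of the unsheared
   arc to the origin; [lag t] encodes the angle of rotation. *)
Definition lag t := tm (t - 3/10).
(** The value of [plane] at the rotated point, which governs [dip] and [rise]. *)
Definition off (u t : R) := u ^+ 2 * ((sinp (sg1 (u ^+ 2)) * cosp (sg1 (u ^+ 2)) * vers (lag t)) ^+ 2 +
   (sinp (sg1 (u ^+ 2)) * sine (lag t)) ^+ 2).
Definition arc (u t : R) : R4 :=
  (u * (sinp (sg1 (u ^+ 2)) * cosp (sg1 (u ^+ 2)) * vers (lag t)),
   u * (sinp (sg1 (u ^+ 2)) * sine (lag t)),
   u * (-1 + vers (lag t) * sinp (sg1 (u ^+ 2)) ^+ 2) - dip (off u t),
   t - 3/10 + rise (off u t)).

Lemma rot_quat0' a v : rot (qconj (quat 0 a)) v = v.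
Proof. by rewrite -{1}(rot_quat0 a v) rotK // qsq_quat_neq0. Qed.

(** The hole is at the opposite pole, and [- u e3] is far from it for [r >= 1/10]; so only the spin
    of the shell acts on the ray. *)
Lemma beta_axis r t : 1/10 <= r -> beta (0, 0, - r, t) = arc (r - 99/100) t.
Proof.
move=> r0; rewrite /beta /shear' /plane /= !expr0n /= addr0.
rewrite dip_lo ?rise_lo; [|lra|lra].
set u := r - 99/100; have -> : - r + 99/100 = u * -1 by rewrite /u; lra.
have h : spin2' (0, 0, u * -1, t - 3/10) = (0, 0, u * -1, t - 3/10).
  rewrite /spin2' /= sg2_out.
    by rewrite rot_quat0' shift3NK.
  by rewrite /hole /sq3 /shift3 /= /u; nra.
rewrite /bar h /spin1 /= /sq3 /= !expr0n /= !add0r.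
have -> : (u * -1) ^+ 2 = u ^+ 2 by ring.
have -> : rot (quat (sg1 (u ^+ 2)) (tm (t - 3 / 10))) (0, 0, u * -1) =
    rot (quat (sg1 (u ^+ 2)) (tm (t - 3 / 10))) (u * 0, u * 0, u * -1) by rewrite mulr0.
rewrite rotZ rot_axis_quat /shear /=.
have P A B Z T : plane (u * A, u * B, Z, T) = u ^+ 2 * (A ^+ 2 + B ^+ 2).
  by rewrite /plane /=; ring.
by rewrite P.
Qed.

Lemma st_le (x y : R) : x <= y -> st x <= st y.
Proof.
move=> xy; have [x1|x1] := leP 1 x; first by rewrite !st_ge1 //; lra.
have [y0|y0] := leP y 0; first by rewrite !st_le0 //; lra.
by have [->//|xy'] := eqVneq x y; apply/ltW/st_lt => //; rewrite lt_neqAle xy' xy.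
Qed.

Lemma lag_le t1 t2 : t1 <= t2 -> lag t2 <= lag t1.
Proof. by move=> h; rewrite /lag /tm; have := @st_le (10 * (t1 - 3/10) - 1) (10 * (t2 - 3/10) - 1); lra. Qed.

Lemma lag_bound t : -1 <= lag t <= 1.
Proof. by rewrite /lag /tm; have /andP[a b] := st01 (10 * (t - 3/10) - 1); apply/andP; split; lra. Qed.

Lemma sg1_up (u : R) : u ^+ 2 <= 1006/1000 -> sg1 (u ^+ 2) = st (500 * u ^+ 2 - 991/2).
Proof. by move=> h; rewrite /sg1 [X in 1 - X]st_le0; [ring|lra]. Qed.

Lemma st_inner (x : R) : 0 < st x < 1 -> 0 < x < 1.
Proof.
move=> /andP[h1 h2]; apply/andP; split; rewrite ltNge; apply/negP => h.
  by rewrite st_le0 // ltxx in h1.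
by rewrite st_ge1 // ltxx in h2.
Qed.

Lemma off_sphere (u t : R) : off u t = u ^+ 2 - (u * (-1 + vers (lag t) * sinp (sg1 (u ^+ 2)) ^+ 2)) ^+ 2.
Proof.
rewrite /off; set p := sinp _; set c := cosp _; set k := vers _.
have pc : c ^+ 2 = 1 - p ^+ 2 by have := sinp_cosp (sg1 (u ^+ 2)); rewrite -/p -/c; lra.
have E : (p * sine (lag t)) ^+ 2 = p ^+ 2 * (k * (2 - k)) by rewrite exprMn sine_vers.
have -> : (p * c * k) ^+ 2 = p ^+ 2 * (1 - p ^+ 2) * k ^+ 2 by rewrite -pc; ring.
by rewrite E; ring.
Qed.

Lemma sq_le (x y : R) : 0 <= y -> x ^+ 2 <= y ^+ 2 -> -y <= x <= y.
Proof. by move=> y0 h; rewrite -ler_norml -(@ler_pXn2r _ 2) ?nnegrE // real_normK ?num_real. Qed.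

Lemma sq_lt (x y : R) : 0 <= x -> x < y -> x ^+ 2 < y ^+ 2.
Proof. nra. Qed.

(** [X] stands for the height on the sphere of radius [u] and [Y] for the squared distance to the
    axis. As [Y1] is [Y2 / 10^4], the first point is almost at the pole, and [100 X1 - 99 = X2 <= u]
    then bounds [u]. This excludes the outer ramp, where [u^2 > 1006/1000]. *)
Lemma coincidence_eq (u X1 X2 Y1 Y2 : R) : 0 < u -> u <= 11/10 ->
  Y1 = u ^+ 2 - X1 ^+ 2 -> Y2 = u ^+ 2 - X2 ^+ 2 -> Y2 = 100 * (100 * Y1) ->
  100 * X1 - 99 = X2 -> 0 <= Y1 ->
  [/\ u - u / 1000 <= X1, X1 <= u & u <= 1002/1000].
Proof.
move=> u0 u11 h1 h2 h3 h4 h5.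
have x1 : -u <= X1 <= u by apply: sq_le; [apply: ltW|lra].
have x2 : -u <= X2 <= u by apply: sq_le; [apply: ltW|lra].
case/andP: x1 => _ x1; case/andP: x2 => x2 x3.
have X1p : 0 <= X1 by lra.
have y : X1 ^+ 2 >= u ^+ 2 - u ^+ 2 / 1000.
  have : 0 <= X2 ^+ 2 by apply: sqr_ge0.
  have := sqr_ge0 u; clear -h1 h2 h3; lra.
have lo : u - u / 1000 <= X1.
  rewrite leNgt; apply/negP => c.
  have : X1 ^+ 2 < (u - u / 1000) ^+ 2.
    exact: sq_lt X1p c.
  have -> : (u - u / 1000) ^+ 2 = u ^+ 2 - 2 * (u ^+ 2 / 1000) + u ^+ 2 / 1000 / 1000 by field.
  by have := sqr_ge0 u; clear -y; lra.
by split=> //; clear -h4 lo x3; lra.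
Qed.

Lemma dip0 : dip (0 : R) = 99/100.
Proof. by apply: dip_lo; lra. Qed.

Lemma vers_mono (a1 a2 : R) : 0 < a2 -> a2 <= a1 -> a1 <= 1 -> vers a1 <= vers a2.
Proof.
move=> a20 a12 a11; have d1 := den_a a1; have d2 := den_a a2.
rewrite /vers ler_pdivrMr // mulrAC ler_pdivlMr // -!mulrA ler_pM2l //.
have b : 0 <= 1 - a1 ^+ 2 <= 1 - a2 ^+ 2 by apply/andP; split; nra.
case/andP: b => b1 b2.
have h1 : (1 - a1 ^+ 2) ^+ 2 <= (1 - a2 ^+ 2) ^+ 2 by nra.
have h2 : a2 ^+ 2 <= a1 ^+ 2 by nra.
have h3 : (1 - a1 ^+ 2) ^+ 2 * a2 ^+ 2 <= (1 - a2 ^+ 2) ^+ 2 * a1 ^+ 2.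
  by apply: ler_pM => //; apply: sqr_ge0.
lra.
Qed.

Lemma angle_small (a : R) : -1 <= a < 0 -> 1995/1000 <= vers a -> -(1/100) <= sine a -> -(11/2000) < a.
Proof.
move=> /andP[a1 a0] h1 h2; have d := den_a a.
rewrite /vers ler_pdivlMr // in h1; rewrite /sine ler_pdivlMr // in h2.
set b := 1 - a ^+ 2 in d h1 h2.
have b0 : 0 <= b by rewrite /b; nra.
have b1 : b <= 1 by rewrite /b; nra.
have n : a ^+ 2 + b ^+ 2 <= 2 / (1995/1000) * b ^+ 2 by lra.
have h3 : - 2 * a * b <= 1/100 * (2 / (1995/1000)) * b ^+ 2 by lra.
have bp : 0 < b by rewrite lt_neqAle b0 andbT; apply/eqP => b00; rewrite -b00 in n d; nra.
have h4 : - 2 * a <= 1/100 * (2 / (1995/1000)) * b.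
  by rewrite -(ler_pM2r bp); lra.
lra.
Qed.

Lemma angle_mid (a : R) : -1 <= a < 0 -> 139/100 <= vers a <= 171/100 -> -(6/10) < a < -(1/10).
Proof.
move=> /andP[a1 a0] /andP[h1 h2]; have d := den_a a.
rewrite /vers ler_pdivlMr // in h1; rewrite /vers ler_pdivrMr // in h2.
have A0 := sqr_ge0 a; set A := a ^+ 2 in A0 d h1 h2.
have A1 : A <= 1 by rewrite /A; nra.
have AA : 1/100 < A < 36/100.
  apply/andP; split; rewrite ltNge; apply/negP => h.
    have : (1 - A) ^+ 2 >= 98/100 by nra.
    lra.
  have : (1 - A) ^+ 2 <= 41/100 by nra.
  lra.
by case/andP: AA; rewrite /A => h3 h4; apply/andP; split; nra.
Qed.

(** Localises the double points: [psi] is a right angle, the first point is just past the half turn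
    and so near [e3], and the second is further along. The local degree is read off from
    [box_signs]. *)
Lemma coincidence (u t1 t2 : R) : -(89/100) <= u -> t1 <= t2 ->
  100 * (arc u t1).1.1.1 = (arc u t2).1.1.1 ->
  100 * (arc u t1).1.1.2 = (arc u t2).1.1.2 ->
  100 * (arc u t1).1.2 = (arc u t2).1.2 ->
  (arc u t2).2 <= (arc u t1).2 ->
  [/\ 0 < u, u ^+ 2 <= 1, st (500 * u ^+ 2 - 991/2) = 1/2,
      -(11/2000) < lag t1 < 0 & -(6/10) < lag t2 < -(1/10)].
Proof.
move=> um t12; rewrite /arc /=.
have Y1E := off_sphere u t1; have Y2E := off_sphere u t2.
have Y10 : 0 <= off u t1 by apply: mulr_ge0; [apply: sqr_ge0|apply: addr_ge0; apply: sqr_ge0].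
have Y20 : 0 <= off u t2 by apply: mulr_ge0; [apply: sqr_ge0|apply: addr_ge0; apply: sqr_ge0].
have Y12 : 100 * (u * (sinp (sg1 (u ^+ 2)) * cosp (sg1 (u ^+ 2)) * vers (lag t1))) =
    u * (sinp (sg1 (u ^+ 2)) * cosp (sg1 (u ^+ 2)) * vers (lag t2)) ->
   100 * (u * (sinp (sg1 (u ^+ 2)) * sine (lag t1))) =
   u * (sinp (sg1 (u ^+ 2)) * sine (lag t2)) -> off u t2 = 100 * (100 * off u t1).
  by move=> h1 h2; rewrite /off !mulrDr -!exprMn -h1 -h2; ring.
have [s sD] : exists s, s = sg1 (u ^+ 2) by eexists.
have [k1 k1D] : exists k, k = vers (lag t1) by eexists.
have [k2 k2D] : exists k, k = vers (lag t2) by eexists.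
have [n1 n1D] : exists k, k = sine (lag t1) by eexists.
have [n2 n2D] : exists k, k = sine (lag t2) by eexists.
have k1b := vers_bound (lag t1); have k2b := vers_bound (lag t2).
have t12E : t1 = t2 -> k1 = k2 by move=> E; rewrite k1D k2D E.
have YE : t1 = t2 -> off u t1 = off u t2 by move=> ->.
have off2 : off u t2 = u ^+ 2 * ((sinp s * cosp s * k2) ^+ 2 + (sinp s * n2) ^+ 2).
  by rewrite /off -sD -k2D -n2D.
have sE : u ^+ 2 <= 1006/1000 -> s = st (500 * u ^+ 2 - 991/2) by rewrite sD; apply: sg1_up.
have s01 : 0 <= st (500 * u ^+ 2 - 991/2) <= 1 by apply: st01.
have ur : s != 0 -> 991/1000 <= u ^+ 2 <= 1008/1000.
  by move=> s0; apply/negPn/negP => h'; move: s0; rewrite sD sg1_out // eqxx.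
move: Y1E Y2E Y10 Y20 Y12 YE off2; rewrite -!sD -!k1D -!k2D -!n1D -!n2D.
rewrite -!k1D in k1b; rewrite -!k2D in k2b.
move: (off u t1) (off u t2) => Y1 Y2.
have [X1 X1D] : exists X, X = u * (-1 + k1 * sinp s ^+ 2) by eexists.
have [X2 X2D] : exists X, X = u * (-1 + k2 * sinp s ^+ 2) by eexists.
rewrite -!X1D -!X2D => Y1E Y2E Y10 Y20 Y12 YE off2 e1 e2 e3 h; have {}Y12 := Y12 e1 e2.
have X1s := sqr_ge0 X1; have X2s := sqr_ge0 X2.
(* Where the shell does not turn, both points are at height [- (u + 99/100)] on the axis, and the
   equation would make this height 0. *)
have s0 : s != 0.
  apply/eqP => s0; have p0 : sinp s = 0 by rewrite s0 /sinp mulr0 !mul0r.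
  have x1 : X1 = - u by rewrite X1D p0 expr0n mulr0 addr0 mulrN1.
  have x2 : X2 = - u by rewrite X2D p0 expr0n mulr0 addr0 mulrN1.
  have y1 : Y1 = 0 by rewrite Y1E x1 sqrrN subrr.
  have y2 : Y2 = 0 by rewrite Y2E x2 sqrrN subrr.
  by move: e3; rewrite x1 x2 y1 y2 dip0 => e3; clear -e3 um; lra.
have {}ur := ur s0.
case/andP: ur => u1 u2.
have u0 : 0 < u by clear -um u1; nra.
have Y1s : Y1 <= 1/2500 by clear -Y2E Y12 X2s u2; lra.
rewrite dip_lo in e3; last by clear -Y1s; lra.
rewrite [rise Y1]rise_lo // in h.
have t12' : t1 < t2.
  rewrite lt_neqAle t12 andbT; apply/eqP => E.
  have XX : X1 = X2 by rewrite X1D X2D t12E.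
  have {}YE := YE E.
  have y1 : Y1 = 0 by clear -YE Y12; lra.
  rewrite -YE y1 dip0 in e3.
  have x1 : X1 = 99/100 by clear -e3 XX; lra.
  by move: Y1E; rewrite y1 x1 => Y1E; clear -Y1E u1; lra.
(* Otherwise the second point is lifted by at least 3/10, like the first, and the time order of
   [t1 < t2] is kept. *)
have Y2b : 1/300 < Y2.
  rewrite ltNge; apply/negP => Y2b.
  have [y|y] := leP Y2 (1/1250); first by have q := rise_low y; clear -q h t12'; lra.
  have q : rise Y2 = 6/10 by apply: rise_mid; rewrite Y2b andbT ltW.
  by rewrite q in h; clear -h t12'; lra.
rewrite [dip Y2]dip_hi ?subr0 in e3; last exact: ltW.
have e4 : 100 * X1 - 99 = X2 by clear -e3; lra.
have u11 : u <= 11/10 by clear -u2 u0; nra.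
have [X1l X1u u3] := coincidence_eq u0 u11 Y1E Y2E Y12 e4 Y10.
have {}sE : s = st (500 * u ^+ 2 - 991/2) by apply: sE; clear -u0 u3; nra.
rewrite -sE in s01.
have p0 : sinp s != 0.
  apply/eqP => p0; have x2 : X2 = - u by rewrite X2D p0 expr0n mulr0 addr0 mulrN1.
  by move: Y2b; rewrite Y2E x2 sqrrN subrr => q; clear -q; lra.
have s1 : 0 < s < 1.
  case/andP: s01 => s01 s02; rewrite !lt_neqAle s01 s02 !andbT eq_sym s0 /=.
  by apply/eqP => s1; move/eqP: p0; apply; rewrite s1 /sinp subrr mulr0 mul0r.
(* If [sin psi cos psi] is not 0, the first coordinates give [100 k1 = k2 <= 2]; then the first
   point is still near [- e3], not near [e3]. *)
have C0 : cosp s = 0.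
  apply/eqP/negPn/negP => c0.
  have un : u != 0 by rewrite lt0r_neq0.
  have E : 100 * k1 = k2.
    have pcu : u * (sinp s * cosp s) != 0.
      exact: (mulf_neq0 un (mulf_neq0 p0 c0)).
    apply: (mulfI pcu).
    transitivity (100 * (u * (sinp s * cosp s * k1))); first by ring.
    by rewrite e1; ring.
  have k1s : k1 <= 2/100 by case/andP: k2b => _ q; clear -q E; lra.
  have pp : sinp s ^+ 2 <= 1.
    by rewrite -(sinp_cosp s) lerDl sqr_ge0.
  have kp : k1 * sinp s ^+ 2 <= 2/100.
    by apply: le_trans k1s; case/andP: k1b => q _; rewrite ler_piMr.
  have : 0 <= u * (1 - k1 * sinp s ^+ 2).
    by apply: mulr_ge0; [apply: ltW|clear -kp; lra].
  have -> : u * (1 - k1 * sinp s ^+ 2) = - X1 by rewrite X1D; ring.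
  by clear -X1l u0; lra.
have sh : s = 1/2.
  move: C0; rewrite /cosp => /eqP; rewrite mulf_eq0 invr_eq0 (negbTE (lt0r_neq0 (den_s s))) orbF.
  by move=> /eqP q; clear -q; lra.
have p1 : sinp s = 1 by rewrite sh /sinp; field.
have uu : 991/1000 < u ^+ 2 < 993/1000.
  have := @st_inner (500 * u ^+ 2 - 991/2); rewrite -sE => /(_ s1) /andP[q1 q2].
  by clear -q1 q2; apply/andP; split; lra.
case/andP: uu => u4 u5.
have ub : 995/1000 < u < 997/1000 by clear -u4 u5 u0; apply/andP; split; nra.
case/andP: ub => u6 u7.
rewrite p1 !mul1r in e2.
have e5 : 100 * n1 = n2.
  by apply: (mulfI (lt0r_neq0 u0)); rewrite -[RHS]e2; ring.
rewrite p1 expr1n mulr1 in X1D; rewrite p1 expr1n mulr1 in X2D.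
have v2 : n2 != 0.
  apply/eqP => z; move: Y2b; rewrite off2 p1 C0 z !(mulr0, mul0r, expr0n, addr0) /=.
  by move=> q; clear -q; lra.
have /andP[l1 l1'] := lag_bound t1; have /andP[l2 l2'] := lag_bound t2.
have l12 := lag_le t12.
have bp a : -1 <= a <= 1 -> 0 <= 1 - a ^+ 2 by clear => /andP[? ?]; nra.
have sgn a : -1 <= a <= 1 -> (0 < sine a -> 0 < a) /\ (sine a < 0 -> a < 0).
  move=> ha; have b0 := bp a ha; have d := den_a a; split => hs.
    rewrite ltNge; apply/negP => a0; move: hs; rewrite ltNge => /negP; apply.
    rewrite /sine; apply: mulr_le0_ge0; last by rewrite invr_ge0 ltW.
    by apply: mulr_le0_ge0 => //; clear -a0; lra.
  rewrite ltNge; apply/negP => a0; move: hs; rewrite ltNge => /negP; apply.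
  by rewrite /sine; apply: divr_ge0; [apply: mulr_ge0 => //; clear -a0; lra|apply: ltW].
have [_ sn1] := sgn (lag t1) ltac:(by apply/andP).
have [sp2 sn2] := sgn (lag t2) ltac:(by apply/andP).
(* Before the half turn [vers] grows with time, so [X1 <= X2 = 100 X1 - 99]. This forces [X1 >= 1],
   whereas [X1 <= u < 1]. *)
have neg : n2 < 0.
  rewrite lt_neqAle v2 leNgt; apply/negP => pos; rewrite n2D in pos.
  have k12 := vers_mono (sp2 pos) l12 l1'.
  have : X1 <= X2 by rewrite X1D X2D ler_pM2l // lerD2l k1D k2D.
  by rewrite -e4; clear -X1u u7; lra.
have neg1 : n1 < 0 by clear -e5 neg; lra.
have a1n : lag t1 < 0 by apply: sn1; rewrite -n1D.
have a2n : lag t2 < 0 by apply: sn2; rewrite -n2D.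
have k1B : 1995/1000 <= k1.
  have h6 : u * (999/1000) <= u * (-1 + k1) by rewrite -X1D; clear -X1l; lra.
  by rewrite ler_pM2l // in h6; clear -h6; lra.
have s2b : -1 <= n2.
  have := sine_vers (lag t2); rewrite -n2D -k2D; have := sqr_ge0 (k2 - 1); clear; nra.
have k2B : 139/100 <= k2 <= 171/100.
  have h6 : 39/100 <= u * (-1 + k2) <= 7/10.
    by rewrite -X2D -e4; clear -X1l X1u u6 u7; apply/andP; split; lra.
  case/andP: h6 => h6 h7; clear -h6 h7 u6 u7; apply/andP; split; nra.
split.
- by [].
- by clear -u5; lra.
- by rewrite -sE.
- rewrite a1n andbT; apply: angle_small.
  + by rewrite l1 a1n.
  + by rewrite -k1D.
  + by rewrite -n1D; clear -e5 s2b; lra.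
by apply: angle_mid; [rewrite l2 a2n|rewrite -k2D].
Qed.

End Axis.

(** * The box around the coincidence *)

Section Box.
Context {R : realType}.
Implicit Types (a s r t n : R).

Lemma st_ivt (y : R) : 0 < y -> y < 1 -> exists x, 0 < x < 1 /\ st x = y.
Proof.
move=> y0 y1; have [||x _ xy] := @IVT R st 0 1 y ler01.
- by apply: continuous_subspaceT; apply: st_continuous.
- rewrite st_le0 // st_ge1 //; have -> : Num.min 0 1 = 0 :> R by apply/min_idPl/ler01.
  have -> : Num.max 0 1 = 1 :> R by apply/max_idPr/ler01.
  by rewrite (ltW y0) (ltW y1).
by exists x; split=> //; apply: st_inner; rewrite xy y0.
Qed.

Lemma lag_ivt (a : R) : -1 < a < 1 -> exists t, 2/5 <= t <= 1/2 /\ lag t = a.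
Proof.
move=> /andP[a0 a1]; have [||x [/andP[x0 x1] xE]] := @st_ivt ((1 - a) / 2); [lra|lra|].
exists ((x + 1) / 10 + 3/10); split; first by apply/andP; split; lra.
rewrite /lag /tm; have -> : 10 * ((x + 1) / 10 + 3/10 - 3/10) - 1 = x by field.
by rewrite xE; field.
Qed.

Lemma radius_ivt (y : R) : 0 < y -> y < 1 -> exists u, [/\ 995/1000 < u, u < 997/1000,
  991/1000 < u ^+ 2 < 993/1000 & st (500 * u ^+ 2 - 991/2) = y].
Proof.
move=> y0 y1; have [x [/andP[x0 x1] xE]] := st_ivt y0 y1.
exists (Num.sqrt ((x + 991/2) / 500)).
have e : Num.sqrt ((x + 991/2) / 500) ^+ 2 = (x + 991/2) / 500.
  by apply: sqr_sqrtr; lra.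
have p : 0 <= Num.sqrt ((x + 991/2) / 500) by apply: sqrtr_ge0.
move: (Num.sqrt _) e p => u e p.
rewrite e; split.
- by clear -e p x0 x1; nra.
- by clear -e p x0 x1; nra.
- by clear -x0 x1; apply/andP; split; lra.
have -> : 500 * ((x + 991/2) / 500) - 991/2 = x by field.
by [].
Qed.

(** The walls are prescribed through the values of the profiles because these decide the signs
    there: [sg1] around 1/2 for the sign of [cos psi], [lag t1] from 0 to where [100 * sine] drops
    below -1, and [lag t2] such that [vers] falls from nearly 2 to nearly 1. *)
Record box (ul ur t1l t1r t2l t2r : R) : Prop := Box {
  box_ul : 995/1000 < ul /\ 991/1000 < ul ^+ 2 /\ st (500 * ul ^+ 2 - 991/2) = 999/2000;
  box_ur : ur < 997/1000 /\ ur ^+ 2 < 993/1000 /\ st (500 * ur ^+ 2 - 991/2) = 1001/2000;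
  box_u : ul < ur;
  box_t1 : 2/5 <= t1l < t1r;
  box_t12 : t1r < t2l;
  box_t2 : t2l < t2r <= 1/2;
  box_l1 : lag t1l = 0 /\ lag t1r = - (11/2000);
  box_l2 : lag t2l = - (1/10) /\ lag t2r = - (6/10) }.

Lemma box_exists : exists ul ur t1l t1r t2l t2r, box ul ur t1l t1r t2l t2r.
Proof.
have B0 : -1 < (0 : R) < 1 by clear; apply/andP; split; lra.
have B1 : -1 < (-(11/2000) : R) < 1 by clear; apply/andP; split; lra.
have B2 : -1 < (-(1/10) : R) < 1 by clear; apply/andP; split; lra.
have B3 : -1 < (-(6/10) : R) < 1 by clear; apply/andP; split; lra.
have [t1l [/andP[a1 a2] a3]] := lag_ivt B0.
have [t1r [/andP[b1 b2] b3]] := lag_ivt B1.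
have [t2l [/andP[c1 c2] c3]] := lag_ivt B2.
have [t2r [/andP[d1 d2] d3]] := lag_ivt B3.
have C1 : 0 < 999/2000 :> R /\ 999/2000 < 1 :> R by clear; split; lra.
have C2 : 0 < 1001/2000 :> R /\ 1001/2000 < 1 :> R by clear; split; lra.
have [ul [u1 u2 /andP[u3 u4] u5]] := radius_ivt C1.1 C1.2.
have [ur [v1 v2 /andP[v3 v4] v5]] := radius_ivt C2.1 C2.2.
have C3 : 999/2000 < 1001/2000 :> R by clear; lra.
have C4 : -(11/2000) < 0 :> R by clear; lra.
have C5 : -(1/10) < -(11/2000) :> R by clear; lra.
have C6 : -(6/10) < -(1/10) :> R by clear; lra.
have L t t' : lag t' < lag t -> t < t'.
  by move=> h; rewrite ltNge; apply/negP => /lag_le; rewrite leNgt h.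
exists ul, ur, t1l, t1r, t2l, t2r; split.
- by [].
- by [].
- rewrite ltNge; apply/negP => h.
  have : st (500 * ur ^+ 2 - 991/2) <= st (500 * ul ^+ 2 - 991/2).
    by apply: st_le; clear -h v1 u1; nra.
  by rewrite u5 v5 leNgt C3.
- by rewrite a1 /=; apply: L; rewrite a3 b3.
- by apply: L; rewrite b3 c3.
- by rewrite d2 andbT; apply: L; rewrite c3 d3.
- by [].
- by [].
Qed.

Lemma coincidence_box ul ur t1l t1r t2l t2r u t1 t2 : box ul ur t1l t1r t2l t2r ->
  -(89/100) <= u -> t1 <= t2 ->
  100 * (arc u t1).1.1.1 = (arc u t2).1.1.1 ->
  100 * (arc u t1).1.1.2 = (arc u t2).1.1.2 ->
  100 * (arc u t1).1.2 = (arc u t2).1.2 ->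
  (arc u t2).2 <= (arc u t1).2 ->
  [/\ ul < u < ur, t1l < t1 < t1r & t2l < t2 < t2r].
Proof.
move=> [[b1 [_ b2]] [b3 [_ b4]] b5 b6 b7 b8 [l1 l2] [l3 l4]] um t12 e1 e2 e3 h.
have [u0 u1 us /andP[a1 a2] /andP[c1 c2]] := coincidence um t12 e1 e2 e3 h.
have L t t' : lag t' < lag t -> t < t'.
  by move=> q; rewrite ltNge; apply/negP => /lag_le; rewrite leNgt q.
have U x y : 0 < x -> st (500 * x ^+ 2 - 991/2) < st (500 * y ^+ 2 - 991/2) -> 0 < y -> x < y.
  move=> x0 q y0; rewrite ltNge; apply/negP => yx; move: q; rewrite ltNge => /negP; apply.
  by apply: st_le; clear -yx x0 y0; nra.
have ul0 : 0 < ul by clear -b1; lra.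
have ur0 : 0 < ur by clear -b1 b5; lra.
split; apply/andP; split; [apply: U|apply: U|apply: L|apply: L|apply: L|apply: L] => //;
  rewrite ?us ?b2 ?b4 ?l1 ?l2 ?l3 ?l4 //; clear; lra.
Qed.

Lemma vers_near2 (a : R) : -(11/2000) <= a <= 0 -> 2 - 1/10/1000 <= vers a.
Proof.
move=> /andP[h1 h2]; have d := den_a a; rewrite /vers ler_pdivlMr //.
have A : 0 <= a ^+ 2 <= 1/32/1000 by apply/andP; split; nra.
case/andP: A => A1 A2; set A := a ^+ 2 in A1 A2 d *.
have B : (1 - A) ^+ 2 >= 99/100 by nra.
lra.
Qed.

Lemma vers_mid (a : R) : -(6/10) <= a <= -(1/10) -> 106/100 <= vers a <= 198/100.
Proof.
move=> /andP[h1 h2]; have d := den_a a.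
have A : 1/100 <= a ^+ 2 <= 36/100 by apply/andP; split; nra.
case/andP: A => A1 A2; rewrite /vers; set A := a ^+ 2 in A1 A2 d *.
apply/andP; split; first by rewrite ler_pdivlMr //; nra.
by rewrite ler_pdivrMr //; nra.
Qed.

Lemma small_sq (x : R) : -(1/500) <= x -> x <= 1/500 -> x ^+ 2 <= 1/100/1000.
Proof. nra. Qed.

Lemma cosp_small s : 999/2000 <= s <= 1001/2000 ->
  [/\ cosp s ^+ 2 <= 1/100/1000, 1 - 1/100/1000 <= sinp s ^+ 2 <= 1 & 0 < sinp s].
Proof.
move=> /andP[s1 s2]; have d : 1/2 <= 1 - 2 * s + 2 * s ^+ 2.
  by have := sqr_ge0 (1 - 2 * s); nra.
have d0 := den_s s; have sc := sinp_cosp s.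
have c : cosp s ^+ 2 <= 1/100/1000.
  have c1 : -(1/500) <= cosp s <= 1/500.
    rewrite /cosp; apply/andP; split; first by rewrite ler_pdivlMr //; lra.
    by rewrite ler_pdivrMr //; lra.
  by case/andP: c1; apply: small_sq.
split=> //; first by apply/andP; split; have := sqr_ge0 (cosp s); lra.
by rewrite /sinp; apply: divr_gt0 => //; nra.
Qed.

Lemma cosp_sign s : (s < 1/2 -> 0 < cosp s) /\ (1/2 < s -> cosp s < 0).
Proof.
split=> h; rewrite /cosp; first by apply: divr_gt0; [lra|apply: den_s].
by rewrite ltr_pdivrMr ?den_s // mul0r; lra.
Qed.

Lemma sine_neg (a : R) : -(6/10) <= a <= -(1/10) -> -1 <= sine a < 0.
Proof.
move=> /andP[h1 h2]; have d := den_a a.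
have A : a ^+ 2 <= 36/100 by nra.
rewrite /sine; apply/andP; split.
  by rewrite ler_pdivlMr //; have := sqr_ge0 (a + (1 - a ^+ 2)); nra.
by rewrite ltr_pdivrMr // mul0r; nra.
Qed.

Lemma sine_corner : 100 * sine (-(11/2000) : R) < -1.
Proof.
have d := den_a (-(11/2000) : R); rewrite /sine mulrA ltr_pdivrMr //; lra.
Qed.

Lemma vers_corners : 197/100 <= vers (-(1/10) : R) /\ vers (-(6/10) : R) <= 108/100.
Proof.
have d := den_a (-(1/10) : R); have d' := den_a (-(6/10) : R).
by rewrite /vers; split; [rewrite ler_pdivlMr //; lra|rewrite ler_pdivrMr //; lra].
Qed.

(* Coordinates of the two points of the arcs, up to the common factor [u]. *)
Lemma signs_core (u k1 n1 k2 p c : R) : 995/1000 < u < 997/1000 -> 991/1000 < u ^+ 2 ->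
  2 - 1/10/1000 <= k1 <= 2 -> n1 ^+ 2 = k1 * (2 - k1) ->
  106/100 <= k2 <= 198/100 -> c ^+ 2 <= 1/100/1000 -> 1 - 1/100/1000 <= p ^+ 2 <= 1 ->
  [/\ u ^+ 2 * ((p * c * k1) ^+ 2 + (p * n1) ^+ 2) <= 1/2500,
      1/100 <= u ^+ 2 - (u * (-1 + k2 * p ^+ 2)) ^+ 2,
      47/100 <= 100 * (u * (-1 + k1 * p ^+ 2) - 99/100) <= 70/100 &
      (197/100 <= k2 -> 95/100 <= u * (-1 + k2 * p ^+ 2)) /\
      (k2 <= 108/100 -> u * (-1 + k2 * p ^+ 2) <= 1/10)].
Proof.
move=> /andP[u1 u2] u3 /andP[k11 k12] n1E /andP[k21 k22] cs /andP[p1 p2].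
have c0 := sqr_ge0 c; have n0 := sqr_ge0 n1.
have u4 : u ^+ 2 <= 1 by clear -u1 u2; nra.
have u0 := sqr_ge0 u.
have n2 : n1 ^+ 2 <= 2 * (1/10/1000).
  by rewrite n1E; apply: ler_pM; clear -k11 k12; lra.
have kk : k1 ^+ 2 <= 4 by clear -k11 k12; nra.
have kp k : 0 <= k <= 2 -> k - 2 * (1/100/1000) <= k * p ^+ 2 <= k.
  by clear -p1 p2 => /andP[q1 q2]; apply/andP; split; nra.
have /andP[h1 h2] := kp k1 ltac:(by apply/andP; split; clear -k11 k12; lra).
have /andP[h3 h4] := kp k2 ltac:(by apply/andP; split; clear -k21 k22; lra).
move: (k1 * p ^+ 2) (k2 * p ^+ 2) h1 h2 h3 h4 => x y h1 h2 h3 h4.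
split.
- have A : (p * c * k1) ^+ 2 <= 4 * (1/100/1000).
    rewrite !exprMn; have q : c ^+ 2 * k1 ^+ 2 <= 1/100/1000 * 4.
      by apply: ler_pM => //; apply: sqr_ge0.
    rewrite -mulrA; apply: le_trans (ler_piMl _ p2) _; last by clear -q; lra.
    by apply: mulr_ge0 => //; apply: sqr_ge0.
  have B : (p * n1) ^+ 2 <= 2 * (1/10/1000).
    by rewrite exprMn; apply: le_trans n2; apply: ler_piMl.
  apply: le_trans (ler_piMl _ u4) _; last by clear -A B; lra.
  by apply: addr_ge0; apply: sqr_ge0.
- have z : 0 <= -1 + y <= 98/100 by clear -k21 k22 h3 h4; apply/andP; split; lra.
  have zz : (-1 + y) ^+ 2 <= 97/100 by case/andP: z; clear; move: (-1 + y) => z; nra.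
  rewrite exprMn.
  have -> : u ^+ 2 - u ^+ 2 * (-1 + y) ^+ 2 = u ^+ 2 * (1 - (-1 + y) ^+ 2) by ring.
  have : 991/1000 * (3/100) <= u ^+ 2 * (1 - (-1 + y) ^+ 2).
    by apply: ler_pM; clear -u3 zz; lra.
  by clear; lra.
- have z : 1 - 2/10/1000 <= -1 + x <= 1 by clear -k11 k12 h1 h2; apply/andP; split; lra.
  have u5 : 4977/5000 <= u.
    rewrite leNgt; apply/negP => q; have : u ^+ 2 < 991/1000 by clear -q u1; nra.
    by clear -u3; lra.
  case/andP: z => z1 z2; apply/andP; split.
    have : u * (1 - 2/10/1000) <= u * (-1 + x) by rewrite ler_pM2l //; clear -u1; lra.
    by clear -u5; lra.
  have : u * (-1 + x) <= u by rewrite ler_piMr //; clear -u1; lra.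
  by clear -u2; lra.
split=> q.
  have : 995/1000 * (96/100) <= u * (-1 + y).
    by apply: ler_pM; clear -u1 q h3; lra.
  by clear; lra.
have : u * (-1 + y) <= 1 * (1/10).
  by apply: ler_pM; clear -u1 u2 q k21 h3 h4; lra.
by clear; lra.
Qed.

(** The configuration of the Poincare-Miranda theorem: each equation has opposite signs on one pair
    of opposite walls, so zeros in the box count for 1 or -1 in total, and the time difference is
    positive on the whole box. *)
Lemma box_signs ul ur t1l t1r t2l t2r u t1 t2 : box ul ur t1l t1r t2l t2r ->
  ul <= u <= ur -> t1l <= t1 <= t1r -> t2l <= t2 <= t2r ->
  [/\ (u = ul -> 0 < 100 * (arc u t1).1.1.1 - (arc u t2).1.1.1) /\
      (u = ur -> 100 * (arc u t1).1.1.1 - (arc u t2).1.1.1 < 0),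
      (t1 = t1l -> 0 < 100 * (arc u t1).1.1.2 - (arc u t2).1.1.2) /\
      (t1 = t1r -> 100 * (arc u t1).1.1.2 - (arc u t2).1.1.2 < 0),
      (t2 = t2l -> 100 * (arc u t1).1.2 - (arc u t2).1.2 < 0) /\
      (t2 = t2r -> 0 < 100 * (arc u t1).1.2 - (arc u t2).1.2) &
      0 < (arc u t1).2 - (arc u t2).2].
Proof.
move=> [[b1 [b1' b2]] [b3 [b3' b4]] b5 /andP[b6 b6'] b7 /andP[b8 b8'] [l1 l2] [l3 l4]].
move=> /andP[u1 u2] /andP[t11 t12] /andP[t21 t22].
have ul0 : 0 < ul by clear -b1; lra.
have uu : 995/1000 < u < 997/1000 by apply/andP; split; clear -b1 b3 u1 u2; lra.
have sqmono (x y : R) : 0 < x -> x <= y -> x ^+ 2 <= y ^+ 2 by clear => q r; nra.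
have us : 991/1000 < u ^+ 2 by apply: lt_le_trans b1' _; apply: sqmono.
have us' : u ^+ 2 < 993/1000.
  by apply: le_lt_trans b3'; apply: sqmono => //; clear -ul0 u1; lra.
have sE : sg1 (u ^+ 2) = st (500 * u ^+ 2 - 991/2) by apply: sg1_up; clear -us'; lra.
have s1 : 999/2000 <= sg1 (u ^+ 2).
  by rewrite sE -b2; apply: st_le; have := sqmono _ _ ul0 u1; clear; lra.
have s2 : sg1 (u ^+ 2) <= 1001/2000.
  rewrite sE -b4; apply: st_le; have : u ^+ 2 <= ur ^+ 2.
    by apply: sqmono => //; clear -ul0 u1; lra.
  by clear; lra.
have a1 : -(11/2000) <= lag t1 <= 0.
  by rewrite -l2 -l1; apply/andP; split; apply: lag_le.
have a2 : -(6/10) <= lag t2 <= -(1/10).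
  by rewrite -l4 -l3; apply/andP; split; apply: lag_le.
have [cs ps p0] := cosp_small (introT andP (conj s1 s2)).
have [cp cn] := cosp_sign (sg1 (u ^+ 2)).
have sl : u = ul -> 0 < cosp (sg1 (u ^+ 2)).
  by move=> E; apply: cp; rewrite sE E b2; clear; lra.
have sr : u = ur -> cosp (sg1 (u ^+ 2)) < 0.
  by move=> E; apply: cn; rewrite sE E b4; clear; lra.
have k1 : 2 - 1/10/1000 <= vers (lag t1) <= 2.
  by rewrite vers_near2 //; case/andP: (vers_bound (lag t1)).
have k2 := vers_mid a2; have n2 := sine_neg a2.
have [f1 f2 w3 [w4 w5]] := signs_core uu us k1 (sine_vers (lag t1)) k2 cs ps.
have [v1 v2] := vers_corners.
have z3 : t2 = t2l -> 95/100 <= u * (-1 + vers (lag t2) * sinp (sg1 (u ^+ 2)) ^+ 2).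
  by move=> E; apply: w4; rewrite E l3.
have z4 : t2 = t2r -> u * (-1 + vers (lag t2) * sinp (sg1 (u ^+ 2)) ^+ 2) <= 1/10.
  by move=> E; apply: w5; rewrite E l4.
have y1 : t1 = t1l -> sine (lag t1) = 0.
  by move=> ->; rewrite l1 /sine mulr0 !mul0r.
have y2 : t1 = t1r -> 100 * sine (lag t1) < -1.
  by move=> ->; rewrite l2; apply: sine_corner.
rewrite /arc /=.
have O1 : off u t1 <= 1/2500 by exact: f1.
have O2 : 1/100 <= off u t2 by rewrite off_sphere.
have d1 : dip (off u t1) = 99/100 by apply: dip_lo; clear -O1; lra.
have r1 : rise (off u t1) = 3/10 by apply: rise_lo.
have d2 : dip (off u t2) = 0 by apply: dip_hi; clear -O2; lra.
have r2 : rise (off u t2) = 0 by apply: rise_hi.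
rewrite d1 d2 r1 r2 subr0.
move: k1 k2 n2 w3 z3 z4 y1 y2 sl sr p0.
move: (vers (lag t1)) (vers (lag t2)) (sine (lag t1)) (sine (lag t2)) (sinp _) (cosp _).
move=> k1 k2 n1 n2 p c K1 K2 N2 w3 z3 z4 y1 y2 sl sr p0.
have u0 : 0 < u by case/andP: uu => q _; clear -q; lra.
have up : 0 < u * p by apply: mulr_gt0.
have kk : 0 < 100 * k1 - k2.
  by case/andP: K1 => q1 _; case/andP: K2 => _ q2; clear -q1 q2; lra.
case/andP: N2 => N2 N3; case/andP: w3 => w3 w3'.
have E1 : 100 * (u * (p * c * k1)) - u * (p * c * k2) = u * p * (100 * k1 - k2) * c by ring.
have E2 : 100 * (u * (p * n1)) - u * (p * n2) = u * p * (100 * n1 - n2) by ring.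
rewrite E1 E2; split.
- split=> E; first by apply: mulr_gt0; [apply: mulr_gt0|apply: sl].
  by rewrite pmulr_rlt0; [apply: sr|apply: mulr_gt0].
- split=> E; first by apply: mulr_gt0 => //; rewrite y1 //; clear -N3; lra.
  by rewrite pmulr_rlt0 //; have q := y2 E; clear -q N2; lra.
- split=> E; first by have q := z3 E; clear -q w3'; lra.
  by have q := z4 E; clear -q w3; lra.
by clear -t12 t21 b7 t22 b8' b6 t11; lra.
Qed.

End Box.

(** * Diffeomorphisms of the cylinder preserve its top *)

Section Critical.
Context {R : realType}.
Variable n : nat.
Implicit Types (h : 'rV[R]_n -> R) (v w : 'rV[R]_n).

Lemma along_derive h v k (s : R) : derivable h (v + s *: delta_mx 0 k) (delta_mx 0 k) ->
  is_derive s 1 (fun x : R => h (v + x *: delta_mx 0 k)) (partial k h (v + s *: delta_mx 0 k)).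
Proof.
have E : (fun t : R => t^-1 *: ((h \o shift (v + s *: delta_mx 0 k)) (t *: delta_mx 0 k)
     - h (v + s *: delta_mx 0 k))) =
   (fun t : R => t^-1 *: (((fun x : R => h (v + x *: delta_mx 0 k)) \o shift s) (t *: (1 : R))
     - (fun x : R => h (v + x *: delta_mx 0 k)) s)).
  apply/funext => t; rewrite /= addrCA -scalerDl; congr (_ *: (h (_ + (_ + _) *: _) - _)).
  by rewrite /GRing.scale /= mulr1.
by move=> d; apply: DeriveDef; [move: d; rewrite /derivable E|rewrite /partial /derive E].
Qed.

Lemma lipschitz_at (f : R -> R) (D : R) : is_derive (0 : R) 1 f D ->
  \forall x \near (0 : R), `|f x - f 0| <= (`|D| + 1) * `|x|.
Proof.
move=> [fd <-]; have /cvgrPdist_lt/(_ 1 ltr01) := fd.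
rewrite near_withinE => H; near=> x; have [->|x0] := eqVneq x 0.
  by rewrite subrr normr0 mulr0.
have : x != 0 -> `|lim ((fun h : R => h^-1 *: ((f \o shift 0) (h *: 1) - f 0)) @ 0^')
   - x^-1 *: ((f \o shift 0) (x *: 1) - f 0)| < 1 by near: x.
move=> /(_ x0); rewrite /= addr0 /GRing.scale /= mulr1 -/('D_1 f 0) => h.
have : `|x^-1 * (f x - f 0)| <= `|'D_1 f 0| + 1.
  have -> : x^-1 * (f x - f 0) = 'D_1 f 0 - ('D_1 f 0 - x^-1 * (f x - f 0)) by ring.
  by apply: le_trans (ler_normB _ _) _; rewrite lerD2l ltW.
by rewrite normrM normfV ler_pdivrMl ?normr_gt0 // mulrC.
Unshelve. all: by end_near. Qed.

Lemma coord_norm v i : `|v 0 i| <= `|v|.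
Proof. by rewrite [leRHS]mx_normrE; apply/bigmax_geP; right; exists (0, i). Qed.

Lemma norm_le v (c : R) : 0 <= c -> (forall i, `|v 0 i| <= c) -> `|v| <= c.
Proof.
move=> c0 h; rewrite [leLHS]mx_normrE; apply/bigmax_leP; split=> //.
by case=> i j _; rewrite ord1.
Qed.

Lemma near_norm v (P : 'rV[R]_n -> Prop) : (\forall w \near v, P w) ->
  exists2 r : R, 0 < r & forall w, `|w - v| < r -> P w.
Proof.
move=> /nbhs_ballP [r /= r0 hr]; exists r => // w wr; apply: hr.
by rewrite mx_norm_ball /ball_ /= distrC.
Qed.

(** Go from [v] to [w] one coordinate at a time, [pj k] having changed the first [k] of them. By the
    mean value theorem, each move costs at most [e / (n + 1)] times the distance. *)
Lemma critical_point h (U : set 'rV[R]_n) v : open U -> U v -> smooth_open U h ->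
  (forall k, partial k h v = 0) -> forall e, 0 < e ->
  \forall w \near v, `|h w - h v| <= e * `|w - v|.
Proof.
move=> Uo Uv hs h0 e e0; pose d := e / n.+1%:R.
have d0 : 0 < d by rewrite divr_gt0 ?ltr0n.
have nU : \forall w \near v, U w by apply: open_nbhs_nbhs.
have np : \forall w \near v, forall k, `|partial k h w| <= d.
  apply: (@filter_forall _ _ _ (nbhs v)) => k; have /cvgrPdist_le/(_ d d0) := (hs [:: k] v Uv).1.
  by rewrite /= h0; apply: filterS => w; rewrite sub0r normrN.
have [r r0 hr] := near_norm (filterI nU np).
near=> w; have wr : `|w - v| < r.
  near: w; apply/nbhs_ballP; exists r => //= y.
  by rewrite mx_norm_ball /ball_ /= distrC.
pose pj (k : nat) : 'rV[R]_n := \row_j (if (j < k)%N then w 0 j else v 0 j).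
have claim k : (k <= n)%N -> `|h (pj k) - h v| <= k%:R * d * `|w - v|.
  elim: k => [|k IH] kn.
    have -> : pj 0%N = v by apply/rowP => j; rewrite mxE ltn0.
    by rewrite subrr normr0 !mul0r.
  pose i := Ordinal kn; pose dk := w 0 i - v 0 i.
  have dkw : `|dk| <= `|w - v| by have := coord_norm (w - v) i; rewrite !mxE.
  have inball (t : R) : 0 <= t <= 1 -> `|pj k + (t * dk) *: delta_mx 0 i - v| < r.
    move=> /andP[t0 t1]; apply: le_lt_trans wr.
    apply: norm_le => // j; rewrite !mxE eqxx /=.
    have cj := coord_norm (w - v) j; rewrite !mxE in cj.
    have [->|ji] := eqVneq j i.
      rewrite /= ltnn mulr1 addrAC subrr add0r normrM (ger0_norm t0).
      by apply: le_trans dkw; rewrite ler_piMl.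
    rewrite mulr0 addr0; case: ifP => _ //; by rewrite subrr normr0.
  have dv (t : R) : 0 <= t <= 1 -> is_derive t 1 (fun t => h (pj k + (t * dk) *: delta_mx 0 i))
      (partial i h (pj k + (t * dk) *: delta_mx 0 i) * dk).
    move=> ht; apply: (@is_derive_comp_1 R (fun t => t * dk) (fun s => h (pj k + s *: delta_mx 0 i))).
      have := @is_deriveM R R id (fun=> dk) t 1 1 0 (is_derive_id _ _) (is_derive_cst _ _ _).
      rewrite scaler0 add0r /GRing.scale /= mulr1; exact.
    by apply: along_derive; apply: (hs [::] _ _).2; apply: (hr _ (inball t ht)).1.
  have [||c cI] := @MVT R (fun t => h (pj k + (t * dk) *: delta_mx 0 i))
     (fun t => partial i h (pj k + (t * dk) *: delta_mx 0 i) * dk) 0 1 ltr01.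
  - by move=> t; rewrite in_itv /= => /andP[t0 t1]; apply: dv; rewrite !ltW.
  - apply: derivable_within_continuous => t; rewrite in_itv /= => ht.
    by case: (dv t ht).
  rewrite mul0r scale0r addr0 mul1r subr0 mulr1.
  have -> : pj k + dk *: delta_mx 0 i = pj k.+1.
    apply/rowP => j; rewrite !mxE eqxx /= ltnS.
    have [->|ji] := eqVneq j i; first by rewrite /= ltnn leqnn mulr1 /dk addrC subrK.
    by rewrite mulr0 addr0 [(j <= k)%N]leq_eqVlt (_ : (j == k :> nat) = false) //; apply/negbTE.
  move=> E; have := IH (ltnW kn) => IHk.
  have -> : h (pj k.+1) - h v = (h (pj k.+1) - h (pj k)) + (h (pj k) - h v) by rewrite subrKA.
  rewrite E; apply: le_trans (ler_normD _ _) _.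
  rewrite -[k.+1]addn1 natrD addrC !mulrDl; apply: lerD => //.
  rewrite normrM mul1r; apply: ler_pM => //.
  have cI' : 0 <= c <= 1 by move: cI; rewrite in_itv /= => /andP[? ?]; rewrite !ltW.
  exact: (hr _ (inball c cI')).2.
have pn : pj n = w by apply/rowP => j; rewrite mxE ltn_ord.
have := claim n (leqnn n); rewrite pn => /le_trans; apply.
apply: ler_wpM2r => //; rewrite /d mulrA ler_pdivrMr ?ltr0n // mulrC ler_pM2l //.
by rewrite ler_nat.
Unshelve. all: by end_near. Qed.

Lemma local_max_partial h (U : set 'rV[R]_n) v : open U -> U v -> smooth_open U h ->
  (\forall w \near v, h w <= h v) -> forall k, partial k h v = 0.
Proof.
move=> Uo Uv hs hm k; have nU : \forall w \near v, U w by apply: open_nbhs_nbhs.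
have [r r0 hr] := near_norm (filterI nU hm).
have inb (t : R) : t \in `](- r), r[ -> `|v + t *: delta_mx 0 k - v| < r.
  rewrite in_itv /= -ltr_norml => tr.
  rewrite addrAC subrr add0r; apply: le_lt_trans tr; apply: norm_le => // j.
  rewrite !mxE eqxx /=; case: (_ == _); rewrite ?mulr1 ?mulr0 //.
  by rewrite normr0.
have dv (t : R) : t \in `](- r), r[ -> is_derive t 1 (fun t : R => h (v + t *: delta_mx 0 k))
    (partial k h (v + t *: delta_mx 0 k)).
  by move=> tr; apply: along_derive; apply: (hs [::] _ _).2; apply: (hr _ (inb t tr)).1.
have z : (0 : R) \in `](- r), r[ by rewrite in_itv /= oppr_lt0 r0.
have := @derive1_at_max R (fun t : R => h (v + t *: delta_mx 0 k)) (- r) r 0.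
case=> //; first by lra.
- by move=> t tr; case: (dv t tr).
- by move=> t tr; rewrite scale0r addr0; apply: (hr _ (inb t tr)).2.
move=> _ <-; case: (dv 0 z) => _ ->; by rewrite scale0r addr0.
Qed.

End Critical.

Lemma within_near (X Y : topologicalType) (S : set X) (f : X -> Y) x (B : set Y) :
  {within S, continuous f} -> S x -> nbhs (f x) B -> \forall y \near x, S y -> B (f y).
Proof. by move=> /subspace_continuousP fc Sx nB; apply: (fc x Sx). Qed.

Section Top.
Context {R : realType} (M : closed_manifold R).
Local Notation n := (dim M).

Lemma chart_near (c : chart R M n) p : atlas c -> chart_dom c p ->
  \forall w \near (chart_map c p : 'rV[R]_n), chart_img c w.
Proof.
move=> /atlas_chart [_ io _ _ _] dp; apply: open_nbhs_nbhs; split=> //.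
by exists p.
Qed.

Lemma chart_imgE (c : chart R M n) w : atlas c -> chart_img c w ->
  chart_dom c (chart_inv c w) /\ chart_map c (chart_inv c w) = w.
Proof. by move=> /atlas_chart [_ _ _ _ ci] [p dp <-]; rewrite ci. Qed.

Lemma chart_timesRK (c : chart R M n) x : atlas c -> chart_dom c x.1 ->
  chart_inv (chart_timesR c) (chart_map (chart_timesR c) x) = x.
Proof.
move=> ca cx; rewrite /= row_mxKl row_mxKr mxE; have [_ _ _ _ ->] := atlas_chart ca; last by [].
by case: x {cx}.
Qed.

Lemma cylinder_top (F : M * R -> M * R) p : cylinder_diffeo F ->
  (forall q, F (q, 0) = (q, 0)) -> (F (p, 1)).2 = 1.
Proof.
move=> [K [Fs Ks FC KC FK]] F0.
have C1 : cylinder M (p, 1) by split=> //=; rewrite /unit_itv /= ler01 lexx.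
have [q0 q1] : 0 <= (F (p, 1)).2 /\ (F (p, 1)).2 <= 1.
  by have [_ /= /andP] := FC _ C1.
apply/eqP; rewrite eq_le q1 /= leNgt; apply/negP => q1'.
have q0' : 0 < (F (p, 1)).2.
  rewrite lt_neqAle q0 andbT; apply/eqP => z.
  have C0 : cylinder M ((F (p, 1)).1, 0) by split=> //=; rewrite /unit_itv /= ler01 lexx.
  have := (FK _ C0).1; rewrite F0 => e1.
  have := (FK _ C1).1; rewrite [F (p, 1)]surjective_pairing -z e1 => /(congr1 snd) /= /eqP.
  by rewrite eq_sym oner_eq0.
set q := F (p, 1) in q0 q1 q1' q0'.
have Kq : K q = (p, 1) := (FK _ C1).1.
have Cq : cylinder M q := FC _ C1.
have [c [ca cq]] := atlas_cover q.1; have [d [da dp]] := atlas_cover p.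
pose c' := chart_timesR c; pose d' := chart_timesR d.
have c'a : atlas_timesR (@atlas R M) c' by exists c.
have d'a : atlas_timesR (@atlas R M) d' by exists d.
have c'q : chart_dom c' q by split.
have d'p : chart_dom d' (p, 1) by split.
have dopen : \forall x \near ((p, 1) : M * R), chart_dom d' x.
  have : open_nbhs p (chart_dom d) by split=> //; case: (atlas_chart da).
  move/open_nbhs_nbhs => np; exists (chart_dom d, setT) => /=; first by split=> //; exact: filterT.
  by move=> x [? _]; split.
have copen : \forall x \near (q : M * R), chart_dom c' x.
  have : open_nbhs q.1 (chart_dom c) by split=> //; case: (atlas_chart ca).
  move/open_nbhs_nbhs => np; exists (chart_dom c, setT) => /=; first by split=> //; exact: filterT.
  by move=> x [? _]; split.
pose w0 := chart_map c' q; pose v0 := chart_map d' (p, 1).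
pose kap w := (K (chart_inv c' w)).2.
have w0inv : chart_inv c' w0 = q.
  exact: chart_timesRK.
have A0 : (chart_map c' @` [set x | [/\ cylinder M x, chart_dom c' x & chart_dom d' (K x)]]) w0.
  by exists q => //; split=> //; rewrite Kq.
have [U [h [Uo Uw hs hE]]] := Ks.2 c' d' c'a d'a (rshift n 0) w0 A0.
have inv_near : \forall w \near w0, chart_dom c (chart_inv c (lsubmx w)) /\
    chart_map c (chart_inv c (lsubmx w)) = lsubmx w.
  have lc : {for w0, continuous (fun w : 'rV[R]_(n + 1) => lsubmx w)}.
    exact/differentiable_continuous/differentiable_lsubmx.
  have := chart_near ca cq; rewrite -[chart_map c q.1](row_mxKl _ (const_mx q.2 : 'rV[R]_1)).
  move=> /lc; rewrite near_simpl => iN; near=> w.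
  by apply: (chart_imgE ca); near: w.
have inv_cont : (fun w => chart_inv c' w) @ w0 --> q.
  rewrite [X in _ --> X]surjective_pairing.
  apply: (@cvg_pair _ _ _ (nbhs w0) (nbhs q.1) (nbhs q.2) _ _ _
    (fun w : 'rV[R]_(n + 1) => chart_inv c (lsubmx w)) (fun w : 'rV[R]_(n + 1) => rsubmx w 0 0)).
    have -> : q.1 = chart_inv c (lsubmx w0) by have := w0inv => /(congr1 fst).
    move=> B nB; have lc : {for w0, continuous (fun w : 'rV[R]_(n + 1) => lsubmx w)}.
      exact/differentiable_continuous/differentiable_lsubmx.
    have [_ _ _ ic _] := atlas_chart ca.
    have iw : chart_img c (lsubmx w0) by exists q.1 => //; rewrite row_mxKl.
    have nn := within_near ic iw nB.
    have iN := chart_near ca cq; rewrite -[chart_map c q.1](row_mxKl _ (const_mx q.2 : 'rV[R]_1)) in iN.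
    have nI : \forall w \near w0, (chart_img c (lsubmx w) -> B (chart_inv c (lsubmx w)))
      /\ chart_img c (lsubmx w) := lc _ (@filterI _ (nbhs (lsubmx w0)) _ _ _ nn iN).
    by apply: (@filterS _ (nbhs w0) _ _ _ _ (nI _)) => w [h1 h2]; exact: h1.
  have -> : q.2 = rsubmx w0 0 0 by rewrite row_mxKr mxE.
  have rc : {for w0, continuous (fun w : 'rV[R]_(n + 1) => rsubmx w)}.
    exact/differentiable_continuous/differentiable_rsubmx.
  have cc : {for rsubmx w0, continuous (fun w : 'rV[R]_1 => w 0 0)} by exact: coord_continuous.
  exact: (continuous_comp rc cc).
have Sq : \forall x \near (q : M * R), cylinder M x.
  exists (setT, [set t : R | 0 < t < 1]) => /=.
    split; first exact: filterT.
    have : open_nbhs q.2 (`]0, 1[ : set R).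
      by split; [exact: itv_open|rewrite /= in_itv /= q0' q1'].
    by move/open_nbhs_nbhs; apply: filterS => t; rewrite /= in_itv.
  by move=> x [_ /= /andP[? ?]]; split=> //=; rewrite /unit_itv /= !ltW.
have KN : \forall x \near (q : M * R), cylinder M x /\ chart_dom d' (K x).
  have := @within_near _ _ _ K q (chart_dom d') Ks.1 Cq; rewrite Kq => /(_ dopen) hK.
  by near=> x; have Cx : cylinder M x; [near: x|split=> //; move: Cx; near: x].
have kE : \forall w \near w0, h w = kap w /\ kap w <= 1.
  have UN : \forall w \near w0, U w by apply: open_nbhs_nbhs.
  have := inv_cont _ KN; rewrite near_simpl => KN'.
  near=> w.
  have [i1 i2] : chart_dom c (chart_inv c (lsubmx w)) /\
    chart_map c (chart_inv c (lsubmx w)) = lsubmx w by near: w.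
  have [k1 k2] : cylinder M (chart_inv c' w) /\ chart_dom d' (K (chart_inv c' w)) by near: w.
  split; last by have [_ /= /andP[]] := KC _ k1.
  rewrite -hE; last by near: w.
    by rewrite /local_rep /= row_mxEr mxE.
  exists (chart_inv c' w); first by split.
  rewrite /c' /= i2 -[RHS]hsubmxK; congr row_mx; apply/rowP => i.
  by rewrite mxE ord1.
have hw0 : h w0 = 1.
  by have [-> _] := nbhs_singleton kE; rewrite /kap w0inv Kq.
have hmax : \forall w \near w0, h w <= h w0.
  by near=> w; rewrite hw0; have [-> //] : h w = kap w /\ kap w <= 1; near: w.
have crit := local_max_partial Uo Uw hs hmax.
(* The arc [t |-> F (p, t)] in the chart [c'] is Lipschitz at [t = 1]. *)
have At : \forall t \near (1 : R), t <= 1 -> cylinder M (p, t) /\ chart_dom c' (F (p, t)).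
  have := @within_near _ _ _ F (p, 1) (chart_dom c') Fs.1 C1 copen => hF.
  have ct : {for (1 : R), continuous (fun t : R => (p, t) : M * R)}.
    by apply: (@cvg_pair _ _ _ (nbhs (1 : R)) (nbhs p) (nbhs (1 : R)) _ _ _ (fun=> p) id);
      [apply: cvg_cst|apply: cvg_id].
  have := ct _ hF; rewrite near_simpl => hF'.
  near=> t => t1; have Ct : cylinder M (p, t).
    split=> //=; rewrite /unit_itv /= t1 andbT; near: t.
    by near=> t; have : 0 < t; [near: t; apply: lt_nbhsr; exact: ltr01|move/ltW].
  by split=> //; move: Ct; near: t.
pose phi t := chart_map c' (F (p, t)).
have lip j : exists C : R, 0 < C /\ \forall t \near (1 : R), t <= 1 ->
    `|phi t 0 j - w0 0 j| <= C * (1 - t).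
  have A1 : (chart_map d' @` [set x | [/\ cylinder M x, chart_dom d' x & chart_dom c' (F x)]]) v0.
    by exists (p, 1).
  have [V [g [Vo Vv gs gE]]] := Fs.2 d' c' d'a c'a j v0 A1.
  have e1 : v0 + 0 *: delta_mx 0 (rshift n 0) = v0 by rewrite scale0r addr0.
  have gd : derivable g (v0 + 0 *: delta_mx 0 (rshift n 0)) (delta_mx 0 (rshift n 0)).
    by rewrite e1; apply: (gs [::] v0 Vv).2.
  pose D := partial (rshift n 0) g v0.
  exists (`|D| + 1); split; first by have := normr_ge0 D; lra.
  have L := lipschitz_at (along_derive gd).
  have st1 : (fun t : R => t - 1) @ (1 : R) --> (0 : R).
    by rewrite -[X in _ --> X](subrr (1 : R)); apply: cvgB; [apply: cvg_id|apply: cvg_cst].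
  have := st1 _ L; rewrite near_simpl => L1.
  have vt t : v0 + (t - 1) *: delta_mx 0 (rshift n 0) = chart_map d' (p, t).
    rewrite /v0 /d' /=; apply/rowP => i; rewrite [LHS]mxE [X in _ + X]mxE [delta_mx _ _ _ _]mxE eqxx /=.
    case: (split_ordP i) => k ->; rewrite ?row_mxEl ?row_mxEr ?mxE.
      by rewrite (_ : (lshift 1 k == rshift n 0) = false) ?mulr0 ?addr0 // eq_lrshift.
    by rewrite ord1 eqxx mulr1 addrC subrK.
  have VN : \forall t \near (1 : R), V (chart_map d' (p, t)).
    have vc : (fun t : R => v0 + (t - 1) *: delta_mx 0 (rshift n 0)) @ (1 : R) --> v0.
      rewrite -[X in _ --> X]e1; apply: cvgD; first exact: cvg_cst.
      by apply: cvgZr_tmp; exact: st1.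
    have := vc V (open_nbhs_nbhs (conj Vo Vv)); rewrite near_simpl => VN.
    by near=> t; rewrite -vt; near: t.
  near=> t => t1.
  have [Ct Dt] : cylinder M (p, t) /\ chart_dom c' (F (p, t)).
    have h1 : t <= 1 -> cylinder M (p, t) /\ chart_dom c' (F (p, t)) by near: t.
    exact: h1.
  have gt : phi t 0 j = g (chart_map d' (p, t)).
    rewrite -gE; last by near: t.
      by rewrite /local_rep chart_timesRK.
    by exists (p, t).
  have g1 : w0 0 j = g v0.
    by rewrite -gE // /local_rep chart_timesRK.
  rewrite gt g1 -vt.
  have : `|g (v0 + (t - 1) *: delta_mx 0 (rshift n 0)) - g (v0 + 0 *: delta_mx 0 (rshift n 0))|
    <= (`|partial (rshift n 0) g (v0 + 0 *: delta_mx 0 (rshift n 0))| + 1) * `|t - 1| by near: t.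
  by rewrite e1 -/D distrC [`|t - 1|]distrC [`|1 - t|]ger0_norm ?subr_ge0 // distrC.
have [C [C0 hC]] : exists C : R, 0 < C /\ \forall t \near (1 : R), t <= 1 ->
    `|phi t - w0| <= C * (1 - t).
  have [Cf hCf] := choice lip.
  exists (\sum_j Cf j + 1); split.
    by apply: ltr_wpDl => //; apply: sumr_ge0 => j _; case: (hCf j) => /ltW.
  have hN : \forall t \near (1 : R), forall j, t <= 1 -> `|phi t 0 j - w0 0 j| <= Cf j * (1 - t).
    by apply: (@filter_forall _ _ _ (nbhs (1 : R)) _) => j; case: (hCf j).
  near=> t => t1; have ht : forall j, t <= 1 -> `|phi t 0 j - w0 0 j| <= Cf j * (1 - t) by near: t.
  have S0 : 0 <= \sum_j Cf j by apply: sumr_ge0 => j _; case: (hCf j) => /ltW.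
  apply: norm_le; first by apply: mulr_ge0; lra.
  move=> j; rewrite !mxE; have := ht j t1; rewrite !mxE => /le_trans; apply.
  apply: ler_wpM2r; first by lra.
  rewrite (bigD1 j) //= -addrA lerDl; apply: addr_ge0 => //.
  by apply: sumr_ge0 => i _; case: (hCf i) => /ltW.
(* With the Lipschitz constant [C], this makes the variation of the height at most [(1 - t) / 2],
   while it is [1 - t]. *)
have eps0 : 0 < 1 / (2 * C) by apply: divr_gt0 => //; apply: mulr_gt0.
have hcrit := critical_point Uo Uw hs crit eps0.
have [r r0 hr] := near_norm (filterI hcrit kE).
have [t [t1 tP]] : exists t : R, t < 1 /\ [/\ t <= 1 -> cylinder M (p, t) /\ chart_dom c' (F (p, t)),
    t <= 1 -> `|phi t - w0| <= C * (1 - t) & C * (1 - t) < r].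
  have hs3 : \forall t \near (1 : R), C * (1 - t) < r.
    near=> t; have : `|1 - t| < r / C.
      by near: t; apply/nbhs_ballP; exists (r / C) => //=; apply: divr_gt0.
    by rewrite ltr_pdivlMr // mulrC => /(le_lt_trans _); apply; rewrite ler_pM2l // ler_norm.
  have hN := @filterI _ (nbhs (1 : R)) _ _ _ At (@filterI _ (nbhs (1 : R)) _ _ _ hC hs3).
  have [s /= s0 hh] := (nbhs_ballP _ _).1 (hN _ _).
  exists (1 - s / 2); split; first by rewrite ltrBlDr ltrDl divr_gt0.
  have [|h1 [h2 h3]] := hh (1 - s / 2); last by split.
  rewrite /ball /= opprB addrC subrK ger0_norm ?divr_ge0 ?ltW //.
  by rewrite ltr_pdivrMr // ltr_pMr // ltr1n.
case: tP => tP1 tP2 tP3.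
have [Ct Dt] := tP1 (ltW t1); have pt := tP2 (ltW t1).
have [hc [hk _]] := hr (phi t) (le_lt_trans pt tP3).
have kt : kap (phi t) = t.
  by rewrite /kap /phi chart_timesRK ?(FK _ Ct).1 //; case: Dt.
move: hc; rewrite hk hw0 kt => hc.
have : `|t - 1| <= 1 / (2 * C) * (C * (1 - t)).
  by apply: le_trans hc _; apply: ler_wpM2l => //; apply: ltW.
rewrite distrC ger0_norm; last by lra.
have -> : 1 / (2 * C) * (C * (1 - t)) = (1 - t) / 2 by field; rewrite lt0r_neq0.
lra.
Unshelve. all: by end_near. Qed.

End Top.

(** * Cup products on a cubical grid *)

Section CupProducts.
Variables (X : Type) (e : nat -> X -> X).
Hypothesis eC : forall i j x, e i (e j x) = e j (e i x).
Implicit Types (f g : X -> int) (x : X).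

(** A cochain [c i j x] is evaluated on the square with lowest corner [x] and directions [i], [j],
    and similarly in other degrees; the [del] are the cubical coboundaries. *)
Definition del0 f i x := f (e i x) - f x.
Definition del1 (c1 : nat -> X -> int) i j x := del0 (c1 j) i x - del0 (c1 i) j x.
Definition del2 (c2 : nat -> nat -> X -> int) i j k x :=
  del0 (c2 j k) i x - del0 (c2 i k) j x + del0 (c2 i j) k x.
Definition del3 (c3 : nat -> nat -> nat -> X -> int) i j k l x :=
  del0 (c3 j k l) i x - del0 (c3 i k l) j x + del0 (c3 i j l) k x
  - del0 (c3 i j k) l x.

(* Cup products of the coboundary of a function with a cochain. *)
Definition cup1 f g i x := del0 f i x * g (e i x).
Definition cup2 f (c1 : nat -> X -> int) i j x := cup1 f (c1 j) i x - cup1 f (c1 i) j x.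
Definition cup3 f (c2 : nat -> nat -> X -> int) i j k x :=
  cup1 f (c2 j k) i x - cup1 f (c2 i k) j x + cup1 f (c2 i j) k x.
Definition cup4 f (c3 : nat -> nat -> nat -> X -> int) i j k l x :=
  cup1 f (c3 j k l) i x - cup1 f (c3 i k l) j x + cup1 f (c3 i j l) k x
  - cup1 f (c3 i j k) l x.

(** The Leibniz rule: the first factor is a coboundary, hence closed, and moving past it costs a
    sign. *)
Lemma del_cup1 f g i j x : del1 (cup1 f g) i j x = - cup2 f (del0 g) i j x.
Proof. by rewrite /del1 /cup2 /cup1 /del0 (eC j i); ring. Qed.

Lemma del_cup2 f c1 i j k x :
  del2 (cup2 f c1) i j k x = - cup3 f (del1 c1) i j k x.
Proof.
by rewrite /del2 /cup3 /cup2 /cup1 /del1 /del0 (eC j i) (eC k i) (eC k j); ring.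
Qed.

Lemma del_cup3 f c2 i j k l x :
  del3 (cup3 f c2) i j k l x = - cup4 f (del2 c2) i j k l x.
Proof.
rewrite /del3 /cup4 /cup3 /cup1 /del2 /del0 (eC j i) (eC k i) (eC k j).
by rewrite (eC l i) (eC l j) (eC l k); ring.
Qed.

Lemma eq_cup3 f c2 c2' i j k x : (forall a b y, c2 a b y = c2' a b y) ->
  cup3 f c2 i j k x = cup3 f c2' i j k x.
Proof. by move=> E; rewrite /cup3 /cup1 !E. Qed.

Lemma eq_cup4 f c3 c3' i j k l x : (forall a b d y, c3 a b d y = c3' a b d y) ->
  cup4 f c3 i j k l x = cup4 f c3' i j k l x.
Proof. by move=> E; rewrite /cup4 /cup1 !E. Qed.

Lemma cup3N f c2 i j k x :
  cup3 f (fun a b y => - c2 a b y) i j k x = - cup3 f c2 i j k x.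
Proof. by rewrite /cup3 /cup1; ring. Qed.

(** [U4] is [df1 df2 df3 f4] and [Z4] is [df1 df2 df3 df4]; [U3] and [Z3] are the analogues for
    three functions. For functions recording signs, [Z4] counts common zeros, and [U4] counts the
    common zeros of the first three at which the fourth is positive. *)
Definition U4 f1 f2 f3 f4 := cup3 f1 (cup2 f2 (cup1 f3 f4)).
Definition Z4 f1 f2 f3 f4 := cup4 f1 (cup3 f2 (cup2 f3 (del0 f4))).
Definition U3 f1 f2 f3 := cup2 f1 (cup1 f2 f3).
Definition Z3 f1 f2 f3 := cup3 f1 (cup2 f2 (del0 f3)).

Lemma del_U3 f1 f2 f3 i j k x :
  del2 (U3 f1 f2 f3) i j k x = Z3 f1 f2 f3 i j k x.
Proof.
rewrite /U3 del_cup2 (@eq_cup3 _ _ (fun a b y => - cup2 f2 (del0 f3) a b y)).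
  by rewrite cup3N opprK.
by move=> a b y; rewrite del_cup1.
Qed.

Lemma del_U4 f1 f2 f3 f4 i j k l x :
  del3 (U4 f1 f2 f3 f4) i j k l x = - Z4 f1 f2 f3 f4 i j k l x.
Proof.
rewrite /U4 del_cup3 (@eq_cup4 _ _ (fun a b d y => cup3 f2 (cup2 f3 (del0 f4)) a b d y)) //.
move=> a b d y; rewrite del_cup2.
rewrite (@eq_cup3 _ _ (fun a b y => - cup2 f3 (del0 f4) a b y)).
  by rewrite cup3N opprK.
by move=> a' b' y'; rewrite del_cup1.
Qed.

End CupProducts.

(** * A discrete Stokes theorem on the four-dimensional grid *)

Definition grid := (nat * nat * nat * nat)%type.
Definition gnext (i : nat) (x : grid) : grid :=
  let: (a, b, c, d) := x in
  match i with
  | 0 => (a.+1, b, c, d) | 1 => (a, b.+1, c, d)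
  | 2 => (a, b, c.+1, d) | _ => (a, b, c, d.+1)
  end.

Lemma gnextC i j x : gnext i (gnext j x) = gnext j (gnext i x).
Proof. by case: x => [[[a b] c] d]; case: i => [|[|[|i]]]; case: j => [|[|[|j]]]. Qed.

Lemma sum2_telescope (F : nat -> nat -> int) m n m' n' : (m <= n)%N ->
  \sum_(m <= b < n) \sum_(m' <= c < n') (F b.+1 c - F b c) =
  \sum_(m' <= c < n') (F n c - F m c).
Proof. by move=> mn; rewrite exchange_big /=; apply: eq_bigr => c _; rewrite telescope_sumr. Qed.

Definition i_of (f : grid -> bool) (x : grid) : int := (f x)%:R.

Section NoDegree.
Variables (A N : nat) (f1 f2 f3 f4 : grid -> bool).

(** A function of constant sign on a cell. Hypothesis [cubes] below is thus the discrete form of the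
    four functions having no common zero. *)
Definition cube_cst (f : grid -> bool) (a b c d : nat) := exists v, forall a' b' c' d',
  (a <= a' <= a.+1)%N -> (b <= b' <= b.+1)%N -> (c <= c' <= c.+1)%N ->
  (d <= d' <= d.+1)%N -> f (a', b', c', d') = v.
Definition face_cst (f : grid -> bool) (b c d : nat) v := forall b' c' d',
  (b <= b' <= b.+1)%N -> (c <= c' <= c.+1)%N ->
  (d <= d' <= d.+1)%N -> f (0%N, b', c', d') = v.

Local Notation g1 := (i_of f1).
Local Notation g2 := (i_of f2).
Local Notation g3 := (i_of f3).
Local Notation g4 := (i_of f4).
Local Notation U := (U4 gnext g1 g2 g3 g4).
Local Notation M := (3 * N)%N.

Hypothesis cubes : forall a b c d, (a < A)%N -> (b < M)%N -> (c < M)%N -> (d < M)%N ->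
  [\/ cube_cst f1 a b c d, cube_cst f2 a b c d, cube_cst f3 a b c d | cube_cst f4 a b c d].
Hypothesis endA : forall b c d, (b <= M)%N -> (c <= M)%N -> (d <= M)%N -> f4 (A, b, c, d) = false.
Hypothesis endc : forall a b d, (a <= A)%N -> (b <= M)%N -> (d <= M)%N ->
  f4 (a, b, 0%N, d) = false /\ f4 (a, b, M, d) = false.
Hypothesis endd : forall a b c, (a <= A)%N -> (b <= M)%N -> (c <= M)%N ->
  f4 (a, b, c, 0%N) = false /\ f4 (a, b, c, M) = false.
Hypothesis per : forall a c d, (a <= A)%N -> (c <= M)%N -> (d <= M)%N ->
  [/\ f1 (a, M, c, d) = f1 (a, 0%N, c, d), f2 (a, M, c, d) = f2 (a, 0%N, c, d),
      f3 (a, M, c, d) = f3 (a, 0%N, c, d) & f4 (a, M, c, d) = f4 (a, 0%N, c, d)].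
Definition inB b := (N <= b < 2 * N)%N.
Hypothesis outB : forall b c d, (b < M)%N -> (c < M)%N -> (d < M)%N ->
  ~~ [&& inB b, inB c & inB d] ->
  [\/ exists v, face_cst f1 b c d v, exists v, face_cst f2 b c d v,
      exists v, face_cst f3 b c d v | face_cst f4 b c d false].
Definition inB' b := (N <= b <= 2 * N)%N.
Variables (v1 v2 v3 : bool).
Hypothesis N0 : (0 < N)%N.
Hypothesis B1 : forall c d, inB' c -> inB' d -> f1 (0, N, c, d)%N = v1 /\ f1 (0, 2 * N, c, d)%N = ~~ v1.
Hypothesis B2 : forall b d, inB' b -> inB' d -> f2 (0, b, N, d)%N = v2 /\ f2 (0, b, 2 * N, d)%N = ~~ v2.
Hypothesis B3 : forall b c, inB' b -> inB' c -> f3 (0, b, c, N)%N = v3 /\ f3 (0, b, c, 2 * N)%N = ~~ v3.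
Hypothesis B4 : forall b c d, inB' b -> inB' c -> inB' d -> f4 (0, b, c, d)%N = true.

(** Each term of [Z4] is a product of differences of all four functions along edges of the cube, one
    of which is 0. *)
Lemma Z4_cube a b c d : (a < A)%N -> (b < M)%N -> (c < M)%N -> (d < M)%N ->
  Z4 gnext g1 g2 g3 g4 0 1 2 3 (a, b, c, d) = 0.
Proof.
move=> ha hb hc hd; rewrite /Z4 /cup4 /cup3 /cup2 /cup1 /del0 /gnext /i_of.
case: (cubes ha hb hc hd) => -[v cst]; rewrite !cst ?leqnn ?leqnSn ?ltnSn //; ring.
Qed.

Lemma U_outB b c d : (b < M)%N -> (c < M)%N -> (d < M)%N ->
  ~~ [&& inB b, inB c & inB d] -> U 1 2 3 (0, b, c, d)%N = 0.
Proof.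
move=> hb hc hd o; rewrite /U4 /cup3 /cup2 /cup1 /del0 /gnext /i_of.
case: (outB hb hc hd o) => [[v cst]|[v cst]|[v cst]|cst];
  rewrite !cst ?leqnn ?leqnSn ?ltnSn //= ?mulr0n; ring.
Qed.

Lemma sum_box (F : nat -> nat -> nat -> int) :
  (forall b c d, (b < M)%N -> (c < M)%N -> (d < M)%N ->
    ~~ [&& inB b, inB c & inB d] -> F b c d = 0) ->
  \sum_(0 <= b < M) \sum_(0 <= c < M) \sum_(0 <= d < M) F b c d =
  \sum_(N <= b < 2 * N) \sum_(N <= c < 2 * N) \sum_(N <= d < 2 * N) F b c d.
Proof.
have S (G : nat -> int) : (forall b, (b < M)%N -> ~~ inB b -> G b = 0) ->
    \sum_(0 <= b < M) G b = \sum_(N <= b < 2 * N) G b.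
  move=> H; rewrite (big_cat_nat (n := N)) /=; [|lia|lia].
  rewrite (big_cat_nat (n := (2 * N)%N) (m := N)) /=; [|lia|lia].
  rewrite big_nat_cond big1 ?add0r; last first.
    by move=> b h; apply: H; [lia|rewrite /inB; lia].
  rewrite [X in _ + X]big_nat_cond [X in _ + X]big1 ?addr0 //.
  by move=> b h; apply: H; [lia|rewrite /inB; lia].
move=> H; rewrite S; last first.
  move=> b hb nb; rewrite big_nat_cond big1 // => c /andP[/andP[_ hc] _].
  rewrite big_nat_cond big1 // => d /andP[/andP[_ hd] _].
  by apply: H => //; rewrite (negbTE nb).
rewrite [LHS]big_nat_cond [RHS]big_nat_cond; apply: eq_bigr => b /andP[hb _].
rewrite S; last first.
  move=> c hc nc; rewrite big_nat_cond big1 // => d /andP[/andP[_ hd] _].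
  by apply: H => //; [lia|rewrite (negbTE nc) andbF].
rewrite [LHS]big_nat_cond [RHS]big_nat_cond; apply: eq_bigr => c /andP[hc _].
apply: S => d hd nd.
by apply: H => //; [lia|lia|rewrite (negbTE nd) !andbF].
Qed.

(** In the middle box [f4] is 1, so [U] is [df1 df2 df3 = d (df1 df2 f3)]. On the walls for [b] and
    [c] this vanishes because [f1], resp. [f2], is constant there, so only the walls for [d] remain.
    The same is repeated for [df1 df2], and then for [df1]. *)
Lemma sum_inB : \sum_(N <= b < 2 * N) \sum_(N <= c < 2 * N) \sum_(N <= d < 2 * N)
   U 1 2 3 (0, b, c, d)%N =
  ((~~ v3)%:R - v3%:R) * ((~~ v2)%:R - v2%:R) * ((~~ v1)%:R - v1%:R).
Proof.
have NN : (N <= 2 * N)%N by lia.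
have in0 : inB' N by rewrite /inB'; lia.
have in1 : inB' (2 * N) by rewrite /inB'; lia.
have inb b : (N <= b < 2 * N)%N -> inB' b /\ inB' b.+1.
  by move=> h; rewrite /inB'; split; lia.
pose G := U3 gnext g1 g2 g3.
transitivity (\sum_(N <= b < 2 * N) \sum_(N <= c < 2 * N) \sum_(N <= d < 2 * N)
   ((G 2 3 (0, b.+1, c, d)%N - G 2 3 (0, b, c, d)%N)
    - (G 1 3 (0, b, c.+1, d)%N - G 1 3 (0, b, c, d)%N)
    + (G 1 2 (0, b, c, d.+1)%N - G 1 2 (0, b, c, d)%N))).
  rewrite [LHS]big_nat_cond [RHS]big_nat_cond; apply: eq_bigr => b /andP[hb _].
  rewrite [LHS]big_nat_cond [RHS]big_nat_cond; apply: eq_bigr => c /andP[hc _].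
  rewrite [LHS]big_nat_cond [RHS]big_nat_cond; apply: eq_bigr => d /andP[hd _].
  transitivity (Z3 gnext g1 g2 g3 1 2 3 (0, b, c, d)%N); last first.
    by rewrite -(del_U3 gnextC) /del2 /del0.
  have [[b0 b1] [c0 c1] [d0 d1]] := And3 (inb b hb) (inb c hc) (inb d hd).
  rewrite /U4 /Z3 /cup3 /cup2 /cup1 /del0 /gnext /i_of.
  by rewrite !B4 //= ?mulr1n; ring.
have Gb b c d : (N <= c < 2 * N)%N -> (N <= d < 2 * N)%N -> b = N \/ b = (2 * N)%N ->
    G 2 3 (0, b, c, d)%N = 0.
  move=> hc hd hb; have [[c0 c1] [d0 d1]] := conj (inb c hc) (inb d hd).
  rewrite /G /U3 /cup2 /cup1 /del0 /gnext /i_of.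
  case: hb => ->; have X := fun c d hc hd => B1 (c := c) (d := d) hc hd.
    by rewrite !(fun c d hc hd => (B1 (c := c) (d := d) hc hd).1) //; ring.
  by rewrite !(fun c d hc hd => (B1 (c := c) (d := d) hc hd).2) //; ring.
have Gc b c d : (N <= b < 2 * N)%N -> (N <= d < 2 * N)%N -> c = N \/ c = (2 * N)%N ->
    G 1 3 (0, b, c, d)%N = 0.
  move=> hb hd hc; have [[b0 b1] [d0 d1]] := conj (inb b hb) (inb d hd).
  rewrite /G /U3 /cup2 /cup1 /del0 /gnext /i_of.
  case: hc => ->.
    by rewrite !(fun c d hc hd => (B2 (b := c) (d := d) hc hd).1) //; ring.
  by rewrite !(fun c d hc hd => (B2 (b := c) (d := d) hc hd).2) //; ring.
have Gd b c d v : (N <= b < 2 * N)%N -> (N <= c < 2 * N)%N ->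
    (d = N /\ v = v3) \/ (d = (2 * N)%N /\ v = ~~ v3) ->
    G 1 2 (0, b, c, d)%N = v%:R * (cup2 gnext g1 (del0 gnext g2) 1 2 (0, b, c, d)%N).
  move=> hb hc hd; have [[b0 b1] [c0 c1]] := conj (inb b hb) (inb c hc).
  rewrite /G /U3 /cup2 /cup1 /del0 /gnext /i_of.
  case: hd => -[-> ->].
    by rewrite !(fun c d hc hd => (B3 (b := c) (c := d) hc hd).1) //; ring.
  by rewrite !(fun c d hc hd => (B3 (b := c) (c := d) hc hd).2) //; ring.
have Q d : inB' d -> \sum_(N <= b < 2 * N) \sum_(N <= c < 2 * N)
    cup2 gnext g1 (del0 gnext g2) 1 2 (0, b, c, d)%N =
    ((~~ v2)%:R - v2%:R) * ((~~ v1)%:R - v1%:R).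
  move=> hd; pose H := cup1 gnext g1 g2.
  transitivity (\sum_(N <= b < 2 * N) \sum_(N <= c < 2 * N)
     (- (H 2 (0, b.+1, c, d)%N - H 2 (0, b, c, d)%N)
      + (H 1 (0, b, c.+1, d)%N - H 1 (0, b, c, d)%N))).
    apply: eq_bigr => b _; apply: eq_bigr => c _.
    have := del_cup1 gnextC g1 g2 1 2 (0, b, c, d)%N => /(congr1 (fun z => - z)).
    by rewrite opprK => <-; rewrite /del1 /del0 /H /=; ring.
  under eq_bigr do rewrite big_split /=.
  rewrite big_split /=.
  under eq_bigr do rewrite sumrN.
  rewrite sumrN (sum2_telescope (fun b c => H 2 (0, b, c, d)%N)) //.
  rewrite (_ : \sum_(N <= c < 2 * N) (H 2 (0, 2 * N, c, d)%N - H 2 (0, N, c, d)%N) = 0)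
    ?oppr0 ?add0r; last first.
    rewrite big_nat_cond big1 // => c /andP[hc _]; have [c0 c1] := inb c hc.
    rewrite /H /cup1 /del0 /gnext /i_of.
    rewrite !(B1 c0 hd).1 !(B1 c1 hd).1 !(B1 c0 hd).2 !(B1 c1 hd).2; ring.
  have -> : \sum_(N <= b < 2 * N) \sum_(N <= c < 2 * N)
     (H 1 (0, b, c.+1, d)%N - H 1 (0, b, c, d)%N) =
     \sum_(N <= b < 2 * N) ((~~ v2)%:R - v2%:R) *
       (i_of f1 (0, b.+1, N, d)%N - i_of f1 (0, b, N, d)%N) +
     \sum_(N <= b < 2 * N) (~~ v2)%:R *
       ((i_of f1 (0, b.+1, 2 * N, d)%N - i_of f1 (0, b.+1, N, d)%N) -
       (i_of f1 (0, b, 2 * N, d)%N - i_of f1 (0, b, N, d)%N)).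
    rewrite -big_split /= [LHS]big_nat_cond [RHS]big_nat_cond.
    apply: eq_bigr => b /andP[hb _]; have [b0 b1] := inb b hb.
    rewrite telescope_sumr // /H /cup1 /del0 /gnext /i_of.
    rewrite /= (B2 b1 hd).1 (B2 b1 hd).2; ring.
  rewrite -!mulr_sumr !telescope_sumr //.
  rewrite /i_of (B1 in0 hd).1 (B1 in0 hd).2 (B1 in1 hd).1 (B1 in1 hd).2; ring.
have E : \sum_(N <= b < 2 * N) \sum_(N <= c < 2 * N) \sum_(N <= d < 2 * N)
   ((G 2 3 (0, b.+1, c, d)%N - G 2 3 (0, b, c, d)%N)
    - (G 1 3 (0, b, c.+1, d)%N - G 1 3 (0, b, c, d)%N)
    + (G 1 2 (0, b, c, d.+1)%N - G 1 2 (0, b, c, d)%N)) =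
   \sum_(N <= d < 2 * N) (\sum_(N <= b < 2 * N) \sum_(N <= c < 2 * N)
      (G 2 3 (0, b.+1, c, d)%N - G 2 3 (0, b, c, d)%N))
   - \sum_(N <= b < 2 * N) (\sum_(N <= c < 2 * N) \sum_(N <= d < 2 * N)
      (G 1 3 (0, b, c.+1, d)%N - G 1 3 (0, b, c, d)%N))
   + \sum_(N <= b < 2 * N) (\sum_(N <= c < 2 * N) \sum_(N <= d < 2 * N)
      (G 1 2 (0, b, c, d.+1)%N - G 1 2 (0, b, c, d)%N)).
  rewrite [X in X - _ + _]exchange_big /=.
  under [X in X - _ + _]eq_bigr do rewrite exchange_big /=.
  rewrite -sumrB -big_split /=; apply: eq_bigr => b _.
  rewrite -sumrB -big_split /=; apply: eq_bigr => c _.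
  by rewrite -sumrB -big_split.
rewrite E.
rewrite [X in X - _ + _]big_nat_cond [X in X - _ + _]big1; last first.
  move=> d /andP[hd _]; rewrite (sum2_telescope (fun b c => G 2 3 (0, b, c, d)%N)) //.
  rewrite big_nat_cond big1 // => c /andP[hc _].
  by rewrite !Gb ?subr0 //; [left|right].
rewrite [X in _ - X + _]big_nat_cond [X in _ - X + _]big1; last first.
  move=> b /andP[hb _]; rewrite (sum2_telescope (fun c d => G 1 3 (0, b, c, d)%N)) //.
  rewrite big_nat_cond big1 // => d /andP[hd _].
  by rewrite !Gc ?subr0 //; [left|right].
rewrite subr0 add0r.
transitivity ((~~ v3)%:R * (\sum_(N <= b < 2 * N) \sum_(N <= c < 2 * N)
    cup2 gnext g1 (del0 gnext g2) 1 2 (0, b, c, 2 * N)%N) -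
   v3%:R * (\sum_(N <= b < 2 * N) \sum_(N <= c < 2 * N)
    cup2 gnext g1 (del0 gnext g2) 1 2 (0, b, c, N)%N)); last first.
  by rewrite !Q //; ring.
rewrite !mulr_sumr -sumrB [LHS]big_nat_cond [RHS]big_nat_cond.
apply: eq_bigr => b /andP[hb _].
rewrite !mulr_sumr -sumrB [LHS]big_nat_cond [RHS]big_nat_cond.
apply: eq_bigr => c /andP[hc _].
rewrite telescope_sumr // (@Gd _ _ _ (~~ v3)) //; last by right.
by rewrite (@Gd _ _ _ v3) //; left.
Qed.

(* The boundary of the box carries no degree except on the slice [a = 0],
   where it is the local degree [+-1] of the middle box. *)
Lemma no_degree : False.
Proof.
have S : \sum_(0 <= b < M) \sum_(0 <= c < M) \sum_(0 <= d < M) U 1 2 3 (0, b, c, d)%N = 0.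
  have tele a b c d : del3 gnext U 0 1 2 3 (a, b, c, d) =
     (U 1 2 3 (a.+1, b, c, d) - U 1 2 3 (a, b, c, d))
     - (U 0 2 3 (a, b.+1, c, d) - U 0 2 3 (a, b, c, d))
     + (U 0 1 3 (a, b, c.+1, d) - U 0 1 3 (a, b, c, d))
     - (U 0 1 2 (a, b, c, d.+1) - U 0 1 2 (a, b, c, d)) by [].
  have : \sum_(0 <= b < M) \sum_(0 <= c < M) \sum_(0 <= d < M) \sum_(0 <= a < A)
     del3 gnext U 0 1 2 3 (a, b, c, d) = 0.
    rewrite big_nat_cond big1 // => b /andP[/andP[_ hb] _].
    rewrite big_nat_cond big1 // => c /andP[/andP[_ hc] _].
    rewrite big_nat_cond big1 // => d /andP[/andP[_ hd] _].
    rewrite big_nat_cond big1 // => a /andP[/andP[_ ha] _].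
    by rewrite (del_U4 gnextC) Z4_cube // oppr0.
  pose T1 b c d := \sum_(0 <= a < A) (U 1 2 3 (a.+1, b, c, d) - U 1 2 3 (a, b, c, d)).
  pose T2 b c d := \sum_(0 <= a < A) (U 0 2 3 (a, b.+1, c, d) - U 0 2 3 (a, b, c, d)).
  pose T3 b c d := \sum_(0 <= a < A) (U 0 1 3 (a, b, c.+1, d) - U 0 1 3 (a, b, c, d)).
  pose T4 b c d := \sum_(0 <= a < A) (U 0 1 2 (a, b, c, d.+1) - U 0 1 2 (a, b, c, d)).
  have -> : \sum_(0 <= b < M) \sum_(0 <= c < M) \sum_(0 <= d < M) \sum_(0 <= a < A)
     del3 gnext U 0 1 2 3 (a, b, c, d) =
     \sum_(0 <= b < M) \sum_(0 <= c < M) \sum_(0 <= d < M) T1 b c d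
     - \sum_(0 <= b < M) \sum_(0 <= c < M) \sum_(0 <= d < M) T2 b c d
     + \sum_(0 <= b < M) \sum_(0 <= c < M) \sum_(0 <= d < M) T3 b c d
     - \sum_(0 <= b < M) \sum_(0 <= c < M) \sum_(0 <= d < M) T4 b c d.
    rewrite -sumrB -big_split -sumrB; apply: eq_bigr => b _.
    rewrite -sumrB -big_split -sumrB; apply: eq_bigr => c _.
    rewrite -sumrB -big_split -sumrB; apply: eq_bigr => d _.
    by rewrite /T1 /T2 /T3 /T4 -sumrB -big_split -sumrB; apply: eq_bigr => a _.
  (* The two faces in the direction [b] cancel by periodicity; those in the directions [c] and [d],
     and the face [a = A], vanish because [f4] does. *)
  have E2 : \sum_(0 <= b < M) \sum_(0 <= c < M) \sum_(0 <= d < M) T2 b c d = 0.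
    pose S b := \sum_(0 <= c < M) \sum_(0 <= d < M) \sum_(0 <= a < A) U 0 2 3 (a, b, c, d).
    transitivity (\sum_(0 <= b < M) (S b.+1 - S b)).
      apply: eq_bigr => b _; rewrite /S -sumrB; apply: eq_bigr => c _.
      by rewrite -sumrB; apply: eq_bigr => d _; rewrite -sumrB.
    rewrite telescope_sumr //; apply/eqP; rewrite subr_eq0; apply/eqP.
    rewrite /S [LHS]big_nat_cond [RHS]big_nat_cond; apply: eq_bigr => c /andP[/andP[_ hc] _].
    rewrite [LHS]big_nat_cond [RHS]big_nat_cond; apply: eq_bigr => d /andP[/andP[_ hd] _].
    rewrite [LHS]big_nat_cond [RHS]big_nat_cond; apply: eq_bigr => a /andP[/andP[_ ha] _].
    have p (k : nat) (f : grid -> bool) : f = f1 \/ f = f2 \/ f = f3 \/ f = f4 ->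
        forall a c d, (a <= A)%N -> (c <= M)%N -> (d <= M)%N -> f (a, M, c, d) = f (a, 0%N, c, d).
      move=> hf a' c' d' h1 h2 h3; have [q1 q2 q3 q4] := per h1 h2 h3.
      by case: hf => [->|[->|[->|->]]].
    have q1 := p 0%N f1 (or_introl erefl).
    have q2 := p 0%N f2 (or_intror (or_introl erefl)).
    have q3 := p 0%N f3 (or_intror (or_intror (or_introl erefl))).
    have q4 := p 0%N f4 (or_intror (or_intror (or_intror erefl))).
    rewrite /U4 /cup3 /cup2 /cup1 /del0 /gnext /i_of.
    by rewrite !q1 ?q2 ?q3 ?q4 //; lia.
  have E3 : \sum_(0 <= b < M) \sum_(0 <= c < M) \sum_(0 <= d < M) T3 b c d = 0.
    rewrite big_nat_cond big1 // => b /andP[/andP[_ hb] _].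
    pose S c := \sum_(0 <= d < M) \sum_(0 <= a < A) U 0 1 3 (a, b, c, d).
    transitivity (\sum_(0 <= c < M) (S c.+1 - S c)).
      apply: eq_bigr => c _; rewrite /S -sumrB; apply: eq_bigr => d _.
      by rewrite -sumrB.
    have S0 c : c = M \/ c = 0%N -> S c = 0.
      move=> hc; rewrite /S big_nat_cond big1 // => d /andP[/andP[_ hd] _].
      rewrite big_nat_cond big1 // => a /andP[/andP[_ ha] _].
      rewrite /U4 /cup3 /cup2 /cup1 /del0 /gnext /i_of.
      case: hc => ->.
        by rewrite !(fun a b d ha hb hd => (@endc a b d ha hb hd).2) ?mulr0 ?subr0 ?mulr0 ?addr0 //; lia.
      by rewrite !(fun a b d ha hb hd => (@endc a b d ha hb hd).1) ?mulr0 ?subr0 ?mulr0 ?addr0 //; lia.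
    by rewrite telescope_sumr // !S0 ?subr0; auto.
  have E4 : \sum_(0 <= b < M) \sum_(0 <= c < M) \sum_(0 <= d < M) T4 b c d = 0.
    rewrite big_nat_cond big1 // => b /andP[/andP[_ hb] _].
    rewrite big_nat_cond big1 // => c /andP[/andP[_ hc] _].
    pose S d := \sum_(0 <= a < A) U 0 1 2 (a, b, c, d).
    transitivity (\sum_(0 <= d < M) (S d.+1 - S d)).
      by apply: eq_bigr => d _; rewrite /S -sumrB.
    have S0 d : d = M \/ d = 0%N -> S d = 0.
      move=> hd; rewrite /S big_nat_cond big1 // => a /andP[/andP[_ ha] _].
      rewrite /U4 /cup3 /cup2 /cup1 /del0 /gnext /i_of.
      case: hd => ->.
        by rewrite !(fun a b d ha hb hd => (@endd a b d ha hb hd).2) ?mulr0 ?subr0 ?mulr0 ?addr0 //; lia.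
      by rewrite !(fun a b d ha hb hd => (@endd a b d ha hb hd).1) ?mulr0 ?subr0 ?mulr0 ?addr0 //; lia.
    by rewrite telescope_sumr // !S0 ?subr0; auto.
  have -> : \sum_(0 <= b < M) \sum_(0 <= c < M) \sum_(0 <= d < M) T1 b c d =
     - \sum_(0 <= b < M) \sum_(0 <= c < M) \sum_(0 <= d < M) U 1 2 3 (0, b, c, d)%N.
    rewrite -sumrN [LHS]big_nat_cond [RHS]big_nat_cond; apply: eq_bigr => b /andP[/andP[_ hb] _].
    rewrite -sumrN [LHS]big_nat_cond [RHS]big_nat_cond; apply: eq_bigr => c /andP[/andP[_ hc] _].
    rewrite -sumrN [LHS]big_nat_cond [RHS]big_nat_cond; apply: eq_bigr => d /andP[/andP[_ hd] _].
    rewrite /T1 telescope_sumr // -[RHS]add0r; congr (_ - _).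
    rewrite /U4 /cup3 /cup2 /cup1 /del0 /gnext /i_of.
    by rewrite !endA ?mulr0 ?subr0 ?mulr0 ?addr0 //; lia.
  by rewrite E2 E3 E4 subr0 addr0 subr0 => /eqP; rewrite oppr_eq0 => /eqP.
rewrite sum_box ?sum_inB in S; last by move=> *; apply: U_outB.
by move/eqP: S; case: (v1); case: (v2); case: (v3).
Qed.

End NoDegree.

(** * Lifting homotopies from the Hopf manifold *)

Section Lifting.
Context {R : realType}.
Local Notation lam := (@lam R).
Implicit Types (x y : 'rV[R]_3) (p q : hopf_pt R).

(** A property [D] inherited by subsets replaces an open cover. *)
Lemma lebesgue_number (T : pseudoMetricType R) (K : set T) (D : set T -> Prop) : compact K ->
  (forall A B : set T, A `<=` B -> D B -> D A) ->
  (forall x : T, K x -> exists2 B, nbhs x B & D B) ->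
  exists2 d : R, 0 < d & forall x : T, K x -> D (ball x d).
Proof.
move=> Kc Ds hD; have /(_ _ (at_right (0 : R)) (fun d (x : T) => D (ball x d))) := (compact_near_coveringP K).1 Kc.
case=> [x Kx|d /= d0 hd].
  have [B /nbhs_ballP [e /= e0 eB] DB] := hD x Kx.
  exists (ball x (e / 2), [set d : R | 0 < d < e / 2]) => /=.
    split; first by apply: nbhsx_ballx; apply: divr_gt0.
    by exists (e / 2) => [|t /=]; [apply: divr_gt0|rewrite sub0r normrN => /ltr_normlW -> ->].
  move=> [y d] /= [xy /andP[_ de]]; apply: Ds DB => z yz; apply: eB.
  by apply: ball_split xy (le_ball (ltW de) yz).
exists (d / 2); first by apply: divr_gt0.
apply: hd => /=; last by apply: divr_gt0.
rewrite sub0r normrN gtr0_norm ?divr_gt0 //; lra.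
Qed.

Lemma fine_mesh (d : R) : 0 < d -> exists2 N, (0 < N)%N & 1 / d < N%:R.
Proof.
move=> d0; exists (Num.truncn (1 / d)).+1 => //; have := truncn_itv (x := 1 / d).
by case/(_ (divr_ge0 ler01 (ltW d0)))/andP.
Qed.

(** As [lam] is 100, this is [|x| / 10 < |y| < 10 |x|], an annulus centred at [|x|] on the
    logarithmic scale; it contains at most one point of each orbit. *)
Definition tracks x y := window (`|x| / 10) y.
Definition step x p := wrep (`|x| / 10) p.
(** Quantifying over all lifts of [p] makes this a relation on the quotient, compatible with
    dilations of the lifts. *)
Definition linked p q := forall x, x != 0 -> pr x = p -> exists2 y, tracks x y & pr y = q.

Lemma tracks_refl x : x != 0 -> tracks x x.
Proof.
rewrite -normr_gt0 => x0; rewrite /tracks /window /= lamE; apply/andP; split; lra.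
Qed.

Lemma tracks_neq0 x y : x != 0 -> tracks x y -> y != 0.
Proof. by rewrite -normr_gt0 => x0; apply: window_neq0; apply: divr_gt0. Qed.

Lemma tracks_scale k x y : tracks x y -> tracks (lam ^ k *: x) (lam ^ k *: y).
Proof.
rewrite /tracks /window /= !normZlam => /andP[h1 h2].
by rewrite -!mulrA !ltr_pM2l ?lamX_gt0 // h1 mulrA.
Qed.

Lemma step_pr x y : x != 0 -> tracks x y -> step x (pr y) = y.
Proof. by rewrite -normr_gt0 => x0; apply: wrep_pr; apply: divr_gt0. Qed.

Lemma linked_pr x q : x != 0 -> linked (pr x) q -> tracks x (step x q) /\ pr (step x q) = q.
Proof. by move=> x0 /(_ x x0 erefl) [y ty <-]; rewrite step_pr. Qed.

Lemma linkedI x y : x != 0 -> tracks x y -> linked (pr x) (pr y).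
Proof.
move=> x0 ty z z0 /esym/(pr_eqP x0 z0) [k ->]; exists (lam ^ k *: y).
  exact: tracks_scale.
by apply: pr_scale; apply: tracks_neq0 ty.
Qed.

Lemma step_scale k x q : x != 0 -> linked (pr x) q ->
  step (lam ^ k *: x) q = lam ^ k *: step x q.
Proof.
move=> x0 /(_ x x0 erefl) [y ty <-]; rewrite [step x _]step_pr // -(pr_scale k (tracks_neq0 x0 ty)).
by rewrite step_pr ?scale_neq0 //; apply: tracks_scale.
Qed.

Lemma tracks_open x y : x != 0 -> tracks x y -> exists2 e, 0 < e &
  forall x' y', `|x' - x| < e -> `|y' - y| < e -> x' != 0 /\ tracks x' y'.
Proof.
rewrite -normr_gt0 /tracks /window /= lamE => x0 /andP[h1 h2].
pose a := `|y| - `|x| / 10; pose b := `|x| / 10 * 100 - `|y|.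
have a0 : 0 < a by rewrite /a; lra.
have b0 : 0 < b by rewrite /b; lra.
exists (Num.min (`|x| / 2) (Num.min (a / 20) (b / 20))).
  by rewrite !lt_min !divr_gt0.
move=> x' y'; rewrite !lt_min => /and3P[u1 u2 u3] /and3P[v1 v2 v3].
have e3 : `|x| <= `|x'| + `|x' - x| by have := ler_normB x' (x' - x); rewrite subKr.
have e4 : `|y| <= `|y'| + `|y' - y| by have := ler_normB y' (y' - y); rewrite subKr.
have e5 : `|x'| <= `|x| + `|x' - x| by have := ler_normB x (x - x'); rewrite subKr distrC.
have e6 : `|y'| <= `|y| + `|y' - y| by have := ler_normB y (y - y'); rewrite subKr distrC.
rewrite /a /b in u2 u3 v2 v3; clear a b a0 b0.
rewrite -normr_gt0; split; first by lra.
by apply/andP; split; lra.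
Qed.

Lemma near_ball x (e : R) : 0 < e -> \forall z \near x, `|z - x| < e.
Proof.
by move=> e0; apply/nbhs_ballP; exists e => //= z; rewrite mx_norm_ball /ball_ /= distrC.
Qed.

Lemma step_continuous (T : topologicalType) (f : T -> 'rV[R]_3) (g : T -> hopf_pt R) (z : T) :
  {for z, continuous f} -> {for z, continuous g} -> f z != 0 -> linked (pr (f z)) (g z) ->
  {for z, continuous (fun w => step (f w) (g w))}.
Proof.
move=> fc gc f0 /(_ _ f0 erefl) [y ty yg]; have y0 := tracks_neq0 f0 ty.
rewrite /prop_for /continuous_at -yg step_pr // => B nB.
have [e e0 he] := tracks_open f0 ty.
have nG : nbhs (g z) [set q | exists w, [/\ q = pr w, `|w - y| < e & B w]].
  rewrite -yg nbhs_pr //; have nb := near_ball y e0.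
  near=> w; exists w; split=> //; near: w => //.
have nF := near_ball (f z) e0.
apply: (@filterS2 _ (nbhs z) _ _ _ _ _ (fc _ nF) (gc _ nG)) => w /= h1 [v [-> h2 h3]].
by have [w0 tw] := he _ _ h1 h2; rewrite step_pr.
Unshelve. all: by end_near. Qed.

Lemma linked_near p : \forall q \near p & q' \near p, linked q q'.
Proof.
have x0 := rep_neq0 p; have [e e0 he] := tracks_open x0 (tracks_refl x0).
have nG : nbhs p [set q | exists w, q = pr w /\ `|w - rep p| < e].
  by rewrite -[p in nbhs p]pr_rep nbhs_pr //; have := near_ball (rep p) e0;
    apply: filterS => w we; exists w.
exists ([set q | exists w, q = pr w /\ `|w - rep p| < e],
  [set q | exists w, q = pr w /\ `|w - rep p| < e]) => //.
move=> [q q'] /= [[w [-> we]] [w' [-> we']]].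
by have [w0 tw] := he _ _ we we'; apply: linkedI.
Qed.

Lemma linked_uniform (Z : topologicalType) (K : set Z) (p : R -> Z -> hopf_pt R) : compact K ->
  (forall s z, K z -> {for (s, z), continuous (fun x : R * Z => p x.1 x.2)}) ->
  exists2 N, (0 < N)%N & forall i s z, 0 <= s <= 1 -> K z -> (i < N)%N ->
    linked (p (i%:R / N%:R * s) z) (p (i.+1%:R / N%:R * s) z).
Proof.
move=> Kc pc.
pose L (d : R) (x : R * Z) := linked (p x.1 x.2) (p (x.1 + d) x.2).
have KK : compact ((`[0, 1] : set R) `*` K) by apply: compact_setX => //; apply: segment_compact.
have /(_ R (nbhs (0 : R)) L) := (compact_near_coveringP _).1 KK.
case=> [[s z] [_ Kz]|d /= d0 hd].
  have c0 : (fun w : (R * Z) * R => w.1.1 + w.2) @ ((s, z), (0 : R)) --> s.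
    have -> : nbhs s = nbhs (s + 0) by rewrite addr0.
    apply: cvgD; last exact: cvg_snd.
    by apply: (@cvg_comp _ _ _ fst fst _ (nbhs (s, z))); exact: cvg_fst.
  have c1 : (fun w : (R * Z) * R => p w.1.1 w.1.2) @ ((s, z), (0 : R)) --> p s z.
    apply: (@cvg_comp _ _ _ (fun w : (R * Z) * R => w.1) (fun x : R * Z => p x.1 x.2)
       _ (nbhs (s, z))); first exact: cvg_fst.
    exact: (pc s z Kz).
  have c2 : (fun w : (R * Z) * R => p (w.1.1 + w.2) w.1.2) @ ((s, z), (0 : R)) --> p s z.
    apply: (@cvg_comp _ _ _ (fun w : (R * Z) * R => (w.1.1 + w.2, w.1.2)) (fun x : R * Z => p x.1 x.2)
       _ (nbhs (s, z))); last exact: (pc s z Kz).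
    apply: (@cvg_pair _ _ _ _ (nbhs s) (nbhs z) _ _ _ (fun w : (R * Z) * R => w.1.1 + w.2)
       (fun w : (R * Z) * R => w.1.2)).
      exact: c0.
    by apply: (@cvg_comp _ _ _ fst snd _ (nbhs (s, z))); [exact: cvg_fst|exact: cvg_snd].
  have [[A B] /= [nA nB] hAB] := linked_near (p s z).
  apply: (@filterS2 _ (nbhs ((s, z), (0 : R))) _ _ _ _ _ (c1 _ nA) (c2 _ nB)) => -[[s' z'] d] h1 h2.
  exact: (hAB (_, _)).
have [N _ hN] := fine_mesh d0.
have N0 : 0 < N%:R :> R by apply: lt_trans hN; apply: divr_gt0.
exists N; first by rewrite -(ltr_nat R).
move=> i s z /andP[s0 s1] Kz iN.
have iN' : i%:R + 1 <= N%:R :> R by rewrite natr1 ler_nat.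
have i0 : 0 <= i%:R :> R by [].
have -> : i.+1%:R / N%:R * s = i%:R / N%:R * s + s / N%:R.
  by rewrite -natr1; field; rewrite lt0r_neq0.
apply: (hd (s / N%:R) _ (i%:R / N%:R * s, z)); last first.
  split=> //=; rewrite in_itv /= mulr_ge0 ?divr_ge0 ?(ltW N0) //=.
  apply: mulr_ile1 => //; rewrite ?divr_ge0 ?(ltW N0) //.
  by rewrite ler_pdivrMr // mul1r; lra.
rewrite /= sub0r normrN ger0_norm; last by rewrite divr_ge0 // ltW.
rewrite ltr_pdivrMr //; move: hN; rewrite ltr_pdivrMr // mulrC => hN.
exact: le_lt_trans hN.
Qed.

(** The time interval from 0 to [s] is cut into [N] pieces whatever [s] is, so that continuity in
    [(s, z)] follows step by step and no pieces have to be glued. *)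
Fixpoint lift_step (Z : Type) (p : R -> Z -> hopf_pt R) (Y0 : Z -> 'rV[R]_3) N i s z :=
  if i is i'.+1 then step (lift_step p Y0 N i' s z) (p (i'.+1%:R / N%:R * s) z) else Y0 z.

(** The last clause holds because each step commutes with the dilation. It makes the lifted arcs
    periodic up to [lam] around the circle. *)
Lemma homotopy_lifting (Z : topologicalType) (K : set Z) (p : R -> Z -> hopf_pt R)
    (Y0 : Z -> 'rV[R]_3) : compact K ->
  (forall s z, K z -> {for (s, z), continuous (fun x : R * Z => p x.1 x.2)}) ->
  (forall z, K z -> [/\ {for z, continuous Y0}, Y0 z != 0 & pr (Y0 z) = p 0 z]) ->
  exists Y : R -> Z -> 'rV[R]_3,
  [/\ forall s z, 0 <= s <= 1 -> K z -> {for (s, z), continuous (fun x : R * Z => Y x.1 x.2)},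
      forall s z, 0 <= s <= 1 -> K z -> Y s z != 0 /\ pr (Y s z) = p s z,
      forall z, K z -> Y 0 z = Y0 z &
      forall z z', K z -> K z' -> (forall s, p s z' = p s z) -> Y0 z' = lam *: Y0 z ->
        forall s, 0 <= s <= 1 -> Y s z' = lam *: Y s z].
Proof.
move=> Kc pc Yc; have [N N0 hN] := linked_uniform Kc pc.
have base i s z : 0 <= s <= 1 -> K z -> (i <= N)%N -> lift_step p Y0 N i s z != 0 /\
    pr (lift_step p Y0 N i s z) = p (i%:R / N%:R * s) z.
  move=> hs Kz; elim: i => [|i IH] iN /=.
    by rewrite !mul0r; case: (Yc z Kz).
  have [h1 h2] := IH (ltnW iN); have := hN i s z hs Kz iN; rewrite -h2 => l.
  by have [t1 t2] := linked_pr h1 l; split=> //; apply: tracks_neq0 t1.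
have NN : N%:R / N%:R = 1 :> R by rewrite divff // pnatr_eq0 -lt0n.
exists (lift_step p Y0 N N); split.
- move=> s z hs Kz; suff H i : (i <= N)%N -> {for (s, z), continuous
    (fun x : R * Z => lift_step p Y0 N i x.1 x.2)} by apply: H.
  elim: i => [|i IH] iN /=.
    apply: (@cvg_comp _ _ _ (fun x : R * Z => x.2) Y0 _ (nbhs z)); first exact: cvg_snd.
    by case: (Yc z Kz).
  have [h1 h2] := base i s z hs Kz (ltnW iN).
  have c0 : (fun x : R * Z => i.+1%:R / N%:R * x.1) @ (s, z) --> i.+1%:R / N%:R * s.
    by apply: cvgM; [exact: cvg_cst|exact: cvg_fst].
  apply: step_continuous; [exact: IH (ltnW iN)| |exact: h1|by rewrite h2; apply: hN].
  apply: (@cvg_comp _ _ _ (fun x : R * Z => (i.+1%:R / N%:R * x.1, x.2))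
     (fun x : R * Z => p x.1 x.2) _ (nbhs (i.+1%:R / N%:R * s, z))); last exact: (pc _ z Kz).
  apply: (@cvg_pair _ _ _ _ (nbhs (i.+1%:R / N%:R * s)) (nbhs z) _ _ _
    (fun x : R * Z => i.+1%:R / N%:R * x.1) (fun x : R * Z => x.2)); last exact: cvg_snd.
  exact: c0.
- by move=> s z hs Kz; have := base N s z hs Kz (leqnn N); rewrite NN mul1r.
- move=> z Kz; suff H i : (i <= N)%N -> lift_step p Y0 N i 0 z = Y0 z by apply: H.
  elim: i => [|i IH] iN //=.
  have s0 : 0 <= (0 : R) <= 1 by rewrite lexx ler01.
  have [h1 h2] := base i 0 z s0 Kz (ltnW iN).
  rewrite -(IH (ltnW iN)); move: h2; rewrite !mulr0 => <-.
  by rewrite step_pr //; apply: tracks_refl.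
move=> z z' Kz Kz' pp h0 s hs.
suff H i : (i <= N)%N -> lift_step p Y0 N i s z' = lam *: lift_step p Y0 N i s z by apply: H.
elim: i => [|i IH] iN //=.
have [h1 h2] := base i s z hs Kz (ltnW iN).
rewrite (IH (ltnW iN)) pp -[lam]expr1z step_scale //.
by rewrite h2; apply: hN.
Qed.

End Lifting.

(** * The arcs swept by the axis under an isotopy *)

Section Arcs.
Context {R : realType}.
Notation R4 := (R * R * R * R)%type.
Local Notation lam := (@lam R).

(** This retraction turns maps known only on the cylinder, over the unit interval of times, into
    maps continuous at all times. *)
Definition clamp (x : R) : R := Num.max 0 (Num.min x 1).

Lemma clamp01 x : 0 <= clamp x <= 1.
Proof. by rewrite /clamp le_max lexx ge_max ler01 ge_min lexx orbT. Qed.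

Lemma clamp_id x : 0 <= x <= 1 -> clamp x = x.
Proof. by move=> /andP[x0 x1]; rewrite /clamp min_l // max_r. Qed.

Lemma clamp_le0 x : x <= 0 -> clamp x = 0.
Proof. by move=> x0; rewrite /clamp min_l ?max_l // (le_trans x0). Qed.

Lemma clamp_ge1 x : 1 <= x -> clamp x = 1.
Proof. by move=> x1; rewrite /clamp min_r ?max_r. Qed.

Lemma clamp_continuous (T : topologicalType) (f : T -> R) (x : T) :
  {for x, continuous f} -> {for x, continuous (fun y => clamp (f y))}.
Proof.
move=> fc; apply: continuous_max; first exact: cvg_cst.
by apply: continuous_min; [exact: fc|exact: cvg_cst].
Qed.

Definition axis (z : R * R) : R4 := (0, 0, - z.1, z.2).
(** The quotient of 10 by 1/10 is [lam], so the radii run once around the circle covered by the ray;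
    both ends lie off the support. *)
Definition strip : set (R * R)%type := (`[1/10, 10] : set R) `*` (`[0, 1] : set R).

Lemma stripP z : strip z <-> 1/10 <= z.1 <= 10 /\ 0 <= z.2 <= 1.
Proof. by rewrite /strip /setX /= !in_itv. Qed.

Lemma strip_compact : compact strip.
Proof. by apply: compact_setX; apply: segment_compact. Qed.

Lemma mk3_axis_neq0 z : strip z -> mk3 (axis z).1 != 0.
Proof.
move=> /stripP [/andP[h _] _]; apply/eqP => /(congr1 (fun v => q3 v)); rewrite mk3K => /(congr1 snd) /=.
by rewrite mxE => ?; lra.
Qed.

Lemma axis_continuous z : strip z -> {for z, continuous (fun z => pr (mk3 (axis z).1))}.
Proof.
move=> zs; apply: (@continuous_comp _ _ _ (fun z => mk3 (axis z).1) pr); last first.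
  by apply: pr_continuous; apply: mk3_axis_neq0.
apply: mk3_continuous; [exact: cvg_cst|exact: cvg_cst|].
by apply: (@cvgN _ R^o); exact: cvg_fst.
Qed.

Lemma inC_axis z : inC (axis z) -> 0 < z.1 -> 198/100 <= z.1 <= 2.
Proof.
move=> hC z0; have [_ _ hz _] := inC_bounds hC; move: hz; rewrite normrN ler_norml => /andP[_ hz].
rewrite hz andbT; move: hC => [_ /andP[h _] _]; rewrite /= /plane /sq3 /= in h.
rewrite !expr0n /= !addr0 !add0r dip0 in h.
rewrite leNgt; apply/negP => lt; nra.
Qed.

Lemma beta_axis_neq0 z : strip z -> mk3 (beta (axis z)).1 != 0.
Proof.
move=> zs; have [c|nc] := pselect (inC (axis z)).
  by apply: inC_neq0; apply: beta_inC.
by rewrite beta_out //; apply: mk3_axis_neq0.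
Qed.

(** By [inC_axis] the support meets the ray at radii between 198/100 and 2 only, and the proper
    dilates of these radii are outside [[1/10, 10]]. *)
Lemma twist_axis z : strip z -> twist (pr4 (axis z)) = pr4 (beta (axis z)).
Proof.
move=> zs; have z0 := mk3_axis_neq0 zs.
have [c|nc] := pselect (inC (axis z)); first exact: Hm_in.
rewrite beta_out //; apply: Hm_out => -[q [qC qz]].
have [k e] := pr4_inj z0 (inC_neq0 qC) (esym qz).
have {e}e : q = axis (lam ^ k * z.1, z.2).
  by rewrite e /sc /axis /= !mulr0 mulrN.
move: zs => /stripP [/andP[z1 z2] _].
have k0 := lamX_gt0 k (R := R).
have := @inC_axis (lam ^ k * z.1, z.2); rewrite -e => /(_ qC) /=.
have z0' : 0 < z.1 by lra.
rewrite mulr_gt0 // => /(_ isT) /andP[h1 h2].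
have kz : k != 0 by apply/eqP => k00; apply: nc; rewrite e k00 expr0z mul1r -surjective_pairing in qC.
have [kp|kn] := ltP 0 k.
  have : lam ^ 1 <= lam ^ k :> R by rewrite ler_weXz2l // ltW // lam_gt1.
  rewrite expr1z {1}lamE => k1; move: (lam ^ k) k1 h2 => l k1 h2; clear - k1 h2 z1; nra.
have : lam ^ k <= lam ^ (-1) :> R.
  by apply: ler_weXz2l; [exact: ltW lam_gt1|lia].
have l1 : lam ^ (-1) * 100 = 1 :> R by rewrite -lamE exprN1 mulVf // lam_neq0.
move: (lam ^ k) (lam ^ (-1)) l1 h1 => l m l1 h1 k1; clear - k1 l1 h1 z2 z0'; nra.
Qed.

Lemma beta_axis_scale t : beta (axis (10, t)) = sc lam (beta (axis (1/10, t))).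
Proof.
rewrite !beta_out; last 2 first.
- by move=> /inC_axis /=; lra.
- by move=> /inC_axis /=; lra.
rewrite /sc /axis /= lamE; congr (_, _, _, _); lra.
Qed.

(** All that the count retains of an isotopy to the identity: the projections [p] and heights [h] of
    the moving arcs, with injectivity on each single arc. *)
Record arcs (p : R -> R * R -> hopf_pt R) (h : R -> R * R -> R) : Prop := Arcs {
  arcs_p : forall s z, strip z -> {for (s, z), continuous (fun x : R * (R * R) => p x.1 x.2)};
  arcs_h : forall s z, strip z -> {for (s, z), continuous (fun x : R * (R * R) => h x.1 x.2)};
  arcs_start : forall z, strip z -> p 0 z = pr (mk3 (beta (axis z)).1) /\ h 0 z = (beta (axis z)).2;
  arcs_final : forall z, strip z -> h 1 z = z.2;
  arcs_period : forall s t, p s (10, t) = p s (1/10, t) /\ h s (10, t) = h s (1/10, t);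
  arcs_ends : forall s r, h s (r, 0) = 0 /\ h s (r, 1) = 1;
  arcs_range : forall s z, 0 <= h s z <= 1;
  arcs_inj : forall s r t1 t2, 0 <= t1 <= 1 -> 0 <= t2 <= 1 ->
    p s (r, t1) = p s (r, t2) -> h s (r, t1) = h s (r, t2) -> t1 = t2 }.

Lemma trivial_arcs : trivial_concordance (M := hopf R) twist -> exists p h, arcs p h.
Proof.
move=> [Phi [[Pc _] Pd P0 P1 [U [[_ U0] hU]]]].
pose F (s : R) (z : R * R) := Phi ((pr (mk3 (axis z).1) : hopf R, clamp z.2), clamp s).
have Cz (q : hopf R) (t : R) : cylinder (hopf R) (q, clamp t).
  by split=> //; exact: clamp01.
have Fd s : cylinder_diffeo (fun x => Phi (x, clamp s)) by apply: Pd; exact: clamp01.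
have bot s (q : hopf R) : Phi ((q, 0), clamp s) = (q, 0).
  apply: hU => //; last exact: clamp01.
  by split=> //=; rewrite /unit_itv /= lexx ler01.
have Fc s z : strip z -> {for (s, z), continuous (fun x : R * (R * R) => F x.1 x.2)}.
  move=> zs B nB.
  pose E (x : R * (R * R)) := ((pr (mk3 (axis x.2).1) : hopf R, clamp x.2.2), clamp x.1).
  have Ec : {for (s, z), continuous E}.
    apply: (@cvg_pair _ _ _ (nbhs (s, z)) (nbhs (pr (mk3 (axis z).1) : hopf R, clamp z.2))
      (nbhs (clamp s)) _ _ _ (fun x : R * (R * R) => (pr (mk3 (axis x.2).1) : hopf R, clamp x.2.2))
      (fun x => clamp x.1)); last first.
      by apply: (@clamp_continuous _ (fun x : R * (R * R) => x.1) (s, z)); exact: cvg_fst.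
    apply: (@cvg_pair _ _ _ (nbhs (s, z)) (nbhs (pr (mk3 (axis z).1) : hopf R))
      (nbhs (clamp z.2)) _ _ _ (fun x : R * (R * R) => (pr (mk3 (axis x.2).1) : hopf R))
      (fun x => clamp x.2.2)).
      apply: (@cvg_comp _ _ _ (fun x : R * (R * R) => x.2) (fun z => pr (mk3 (axis z).1)) _ (nbhs z)).
        exact: cvg_snd.
      exact: axis_continuous.
    apply: (@clamp_continuous _ (fun x : R * (R * R) => x.2.2) (s, z)).
    apply: (@cvg_comp _ _ _ (fun x : R * (R * R) => x.2) snd _ (nbhs z));
      exact: cvg_snd.
  have CE x : (cylinder (hopf R) `*` unit_itv R) (E x) by split; [exact: Cz|exact: clamp01].
  apply: (@filterS _ (nbhs (s, z)) _ _ _ _ (Ec _ (within_near Pc (CE (s, z)) nB))) => x.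
  exact: (fun h => h (CE x)).
have c0 : clamp 0 = 0 by rewrite clamp_id // lexx ler01.
have c1 : clamp 1 = 1 by rewrite clamp_id // lexx ler01.
have F0 z : strip z -> F 0 z = twist (pr4 (axis z)).
  move=> zs; have [_ z2] := (stripP z).1 zs.
  by rewrite /F c0 P0 (clamp_id z2) // -(clamp_id z2); exact: Cz.
have F1 z : strip z -> F 1 z = pr4 (axis z).
  move=> zs; have [_ z2] := (stripP z).1 zs.
  by rewrite /F c1 P1 (clamp_id z2) // -(clamp_id z2); exact: Cz.
exists (fun s z => (F s z).1), (fun s z => (F s z).2); split.
- move=> s z zs; apply: (@cvg_comp _ _ _ (fun x : R * (R * R) => F x.1 x.2) fst _ (nbhs (F s z))).
    exact: (Fc s z zs).
  by rewrite [F s z]surjective_pairing; exact: cvg_fst.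
- move=> s z zs; apply: (@cvg_comp _ _ _ (fun x : R * (R * R) => F x.1 x.2) snd _ (nbhs (F s z))).
    exact: (Fc s z zs).
  by rewrite [F s z]surjective_pairing; exact: cvg_snd.
- by move=> z zs; rewrite F0 // twist_axis.
- by move=> z zs; rewrite F1.
- move=> s t; rewrite /F.
  suff -> : pr (mk3 (axis (10, t)).1) = pr (mk3 (axis (1/10, t)).1) :> hopf_pt R by [].
  have -> : mk3 (axis (10, t)).1 = lam ^ 1 *: mk3 (axis (1/10, t)).1.
    by rewrite -mk3_sc /sc /axis /= expr1z lamE !mulr0; congr (mk3 (_, _, _)); lra.
  by apply: pr_scale; apply: (@mk3_axis_neq0 (1/10, 0)); apply/stripP => /=; split; lra.
- move=> s r; rewrite /F /= c0 c1 bot; split=> //.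
  by apply: (cylinder_top _ (Fd s)) => q; apply: bot.
- move=> s z; have [K [_ _ FC _ _]] := Fd s.
  by have [] := FC _ (Cz (pr (mk3 (axis z).1)) z.2).
move=> s r t1 t2 h1 h2 e1 e2; have [K [_ _ _ _ FK]] := Fd s.
have e : F s (r, t1) = F s (r, t2).
  by rewrite [LHS]surjective_pairing [RHS]surjective_pairing e1 e2.
have := (FK _ (Cz (pr (mk3 (axis (r, t1)).1)) t1)).1.
have := (FK _ (Cz (pr (mk3 (axis (r, t2)).1)) t2)).1.
move: e; rewrite /F /= => -> -> /(congr1 snd) /=.
by rewrite !clamp_id.
Qed.

End Arcs.

(** * The twist is not isotopic to the identity *)

Section Nontrivial.
Context {R : realType}.
Notation T4 := (R * R * R * R)%type.
Local Notation lam := (@lam R).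

(** Takes the values [a], [b], [c], [d] at 0, 1, 2, 3. An edge of the box becomes the middle third
    of [[0, 3]], hence the middle block of a uniform grid. *)
Definition plin (a b c d u : R) :=
  a + (b - a) * clamp u + (c - b) * clamp (u - 1) + (d - c) * clamp (u - 2).

Lemma plin_continuous a b c d u : {for u, continuous (plin a b c d)}.
Proof.
have idc (e : R) : {for u, continuous (fun x : R => clamp (x - e))}.
  by apply: (@clamp_continuous R R (fun x => x - e) u); apply: cvgB; [exact: cvg_id|exact: cvg_cst].
have id0 : {for u, continuous (fun x : R => clamp x)}.
  by apply: (@clamp_continuous R R id u); exact: cvg_id.
apply: cvgD; last by apply: cvgM; [exact: cvg_cst|exact: idc].
apply: cvgD; last by apply: cvgM; [exact: cvg_cst|exact: idc].
by apply: cvgD; [exact: cvg_cst|apply: cvgM; [exact: cvg_cst|exact: id0]].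
Qed.

Lemma plinP a b c d u : a <= b -> b < c -> c <= d ->
  [/\ a <= plin a b c d u <= d, b < plin a b c d u < c -> 1 < u < 2 &
      1 <= u <= 2 -> plin a b c d u = b + (c - b) * (u - 1)].
Proof.
move=> ab bc cd; rewrite /plin; split.
- have /andP[h1 h2] := clamp01 u; have /andP[h3 h4] := clamp01 (u - 1).
  have /andP[h5 h6] := clamp01 (u - 2).
  move: (clamp _) (clamp _) (clamp _) h1 h2 h3 h4 h5 h6 => x y z *; apply/andP; split; nra.
- move=> /andP[h1 h2]; apply/andP; split; rewrite ltNge; apply/negP => h.
    move: h1; rewrite [clamp (u - 1)]clamp_le0 ?[clamp (u - 2)]clamp_le0; try lra.
    have /andP[h3 h4] := clamp01 u; move: (clamp u) h3 h4 => x *; nra.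
  move: h2; rewrite [clamp u]clamp_ge1 ?[clamp (u - 1)]clamp_ge1; try lra.
  have /andP[h3 h4] := clamp01 (u - 2); move: (clamp (u - 2)) h3 h4 => x *; nra.
move=> /andP[h1 h2]; rewrite [clamp u]clamp_ge1 // [clamp (u - 1)]clamp_id; last lra.
by rewrite [clamp (u - 2)]clamp_le0; lra.
Qed.

Lemma plin_ends a b c d : [/\ plin a b c d 0 = a, plin a b c d 1 = b, plin a b c d 2 = c &
  plin a b c d 3 = d].
Proof.
rewrite /plin; split; rewrite ?(clamp_le0 (x := 0)) //.
- by rewrite !clamp_le0; lra.
- by rewrite (clamp_ge1 (x := 1)) // !clamp_le0; lra.
- by rewrite (clamp_ge1 (x := 2)) ?(clamp_ge1 (x := 2 - 1)) ?(clamp_le0 (x := 2 - 2)); lra.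
by rewrite !clamp_ge1; lra.
Qed.

Lemma sign_near (T : topologicalType) (g : T -> R) (x : T) : {for x, continuous g} -> g x != 0 ->
  \forall y \near x, (0 < g y) = (0 < g x).
Proof.
move=> gc; rewrite neq_lt => /orP[g0|g0].
  apply: (@filterS _ (nbhs x) _ _ _ _ (gc _ (lt_nbhsl g0))) => y /= y0.
  by rewrite ltNge ltW // ltNge ltW.
by apply: (@filterS _ (nbhs x) _ _ _ _ (gc _ (lt_nbhsr g0))) => y /= y0; rewrite y0 g0.
Qed.

Lemma beta_axisE (r t : R) : 1/10 <= r -> beta (axis (r, t)) = arc (r - 99/100) t.
Proof. exact: beta_axis. Qed.

Lemma coord4_continuous (x : T4) : [/\ {for x, continuous (fun y : T4 => y.1.1.2)},
  {for x, continuous (fun y : T4 => y.1.2)} & {for x, continuous (fun y : T4 => y.2)}].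
Proof.
split.
- apply: (@cvg_comp _ _ _ (fun y : T4 => y.1) (fun y => y.1.2) _ (nbhs x.1)); first exact: cvg_fst.
  apply: (@cvg_comp _ _ _ (fun y : R * R * R => y.1) snd _ (nbhs x.1.1)); first exact: cvg_fst.
  exact: cvg_snd.
- apply: (@cvg_comp _ _ _ (fun y : T4 => y.1) snd _ (nbhs x.1)); first exact: cvg_fst.
  exact: cvg_snd.
exact: cvg_snd.
Qed.

Section Degree.
Variables (p : R -> R * R -> hopf_pt R) (h : R -> R * R -> R) (Y : R -> R * R -> 'rV[R]_3).
Hypothesis ph : arcs p h.
Hypothesis Yc : forall s z, 0 <= s <= 1 -> strip z ->
  {for (s, z), continuous (fun x : R * (R * R) => Y x.1 x.2)}.
Hypothesis Yp : forall s z, 0 <= s <= 1 -> strip z -> Y s z != 0 /\ pr (Y s z) = p s z.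
Hypothesis Y0 : forall z, strip z -> Y 0 z = mk3 (beta (axis z)).1.
Hypothesis Yper : forall s t, 0 <= s <= 1 -> 0 <= t <= 1 -> Y s (10, t) = lam *: Y s (1/10, t).
Variables (ul ur t1l t1r t2l t2r : R).
Hypothesis bx : box ul ur t1l t1r t2l t2r.

(** * The four functions of the degree count *)

Definition radius (x : T4) := plin (1/10) (ul + 99/100) (ur + 99/100) 10 x.1.1.2.
Definition tau1 (x : T4) := plin 0 t1l t1r 1 x.1.2.
Definition tau2 (x : T4) := plin 0 t2l t2r 1 x.2.
(** Using the minimum in place of [tau1] extends the map from the triangle [tau1 <= tau2] to the
    square on which the grid lives. *)
Definition taum (x : T4) := Num.min (tau1 x) (tau2 x).
Definition lead (x : T4) := lam *: Y x.1.1.1 (radius x, taum x) - Y x.1.1.1 (radius x, tau2 x).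
(* For [tau1 x <= tau2 x] this is the height difference of the two points; the
   last term makes it negative when [tau1 x > tau2 x]. *)
Definition drop (x : T4) :=
  h x.1.1.1 (radius x, taum x) - h x.1.1.1 (radius x, tau2 x) + (taum x - tau1 x).

Lemma box_order : [/\ 995/1000 < ul, ul < ur, ur < 997/1000 & 0 <= t1l] /\
  [/\ t1l < t1r, t1r < t2l, t2l < t2r & t2r <= 1/2].
Proof.
case: bx => [[? [_ _]] [? [_ _]] ? /andP[? ?] ? /andP[? ?] _ _].
by split; split=> //; lra.
Qed.

Lemma radiusP x : [/\ 1/10 <= radius x <= 10, ul < radius x - 99/100 < ur -> 1 < x.1.1.2 < 2 &
  1 <= x.1.1.2 <= 2 -> radius x = ul + 99/100 + (ur - ul) * (x.1.1.2 - 1)].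
Proof.
have [[h1 h2 h3 _] _] := box_order.
have [||| k1 k2 k3] := @plinP (1/10) (ul + 99/100) (ur + 99/100) 10 x.1.1.2; try lra.
rewrite -/(radius x) in k1 k2 k3; split=> // [hh|/k3 ->]; first by apply: k2; lra.
by congr (_ + _ * _); lra.
Qed.

Lemma tau1P x : [/\ 0 <= tau1 x <= 1, t1l < tau1 x < t1r -> 1 < x.1.2 < 2 &
  1 <= x.1.2 <= 2 -> tau1 x = t1l + (t1r - t1l) * (x.1.2 - 1)].
Proof. by have [[_ _ _ ?] [? ? ? ?]] := box_order; apply: plinP; lra. Qed.

Lemma tau2P x : [/\ 0 <= tau2 x <= 1, t2l < tau2 x < t2r -> 1 < x.2 < 2 &
  1 <= x.2 <= 2 -> tau2 x = t2l + (t2r - t2l) * (x.2 - 1)].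
Proof. by have [[_ _ _ ?] [? ? ? ?]] := box_order; apply: plinP; lra. Qed.

Lemma taum01 x : 0 <= taum x <= 1.
Proof.
have [/andP[? ?] _ _] := tau1P x; have [/andP[? ?] _ _] := tau2P x.
by rewrite /taum; case: (leP (tau1 x) (tau2 x)) => _; apply/andP.
Qed.

Lemma strip_m x : strip (radius x, taum x).
Proof. by apply/stripP; have [? _ _] := radiusP x; split=> //; exact: taum01. Qed.

Lemma strip_2 x : strip (radius x, tau2 x).
Proof. by apply/stripP; have [? _ _] := radiusP x; have [? _ _] := tau2P x. Qed.

Lemma params_continuous x : [/\ {for x, continuous radius}, {for x, continuous tau1},
  {for x, continuous tau2} & {for x, continuous taum}].
Proof.
have [c1 c2 c3] := coord4_continuous x.
have k2 : {for x, continuous tau1}.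
  by apply: (@continuous_comp _ _ _ (fun y : T4 => y.1.2) (plin 0 t1l t1r 1)) => //; apply: plin_continuous.
have k3 : {for x, continuous tau2}.
  by apply: (@continuous_comp _ _ _ (fun y : T4 => y.2) (plin 0 t2l t2r 1)) => //; apply: plin_continuous.
split=> //.
  apply: (@continuous_comp _ _ _ (fun y : T4 => y.1.1.2) (plin (1/10) (ul + 99/100) (ur + 99/100) 10)) => //.
  exact: plin_continuous.
exact: (continuous_min k2 k3).
Qed.

Lemma curve_continuous (V : topologicalType) (G : R -> R * R -> V) (t : T4 -> R) x :
  {for x, continuous t} ->
  {for (x.1.1.1, (radius x, t x)), continuous (fun y : R * (R * R) => G y.1 y.2)} ->
  {for x, continuous (fun x => G x.1.1.1 (radius x, t x))}.
Proof.
move=> tc Gc; have [rc _ _ _] := params_continuous x.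
apply: (@cvg_comp _ _ _ (fun x : T4 => (x.1.1.1, (radius x, t x)))
  (fun y : R * (R * R) => G y.1 y.2) _ (nbhs (x.1.1.1, (radius x, t x)))); last exact: Gc.
apply: (@cvg_pair _ _ _ (nbhs x) (nbhs x.1.1.1) (nbhs (radius x, t x)) _ _ _
  (fun x : T4 => x.1.1.1) (fun x : T4 => (radius x, t x))).
  apply: (@cvg_comp _ _ _ (fun y : T4 => y.1) (fun y => y.1.1) _ (nbhs x.1)); first exact: cvg_fst.
  apply: (@cvg_comp _ _ _ (fun y : R * R * R => y.1) fst _ (nbhs x.1.1)); exact: cvg_fst.
exact: (@cvg_pair _ _ _ (nbhs x) (nbhs (radius x)) (nbhs (t x)) _ _ _ radius t).
Qed.

Lemma lead_continuous x i : 0 <= x.1.1.1 <= 1 -> {for x, continuous (fun x => lead x 0 i)}.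
Proof.
move=> s01; have [rc _ c2 cm] := params_continuous x.
apply: (@continuous_comp _ _ _ lead (fun v : 'rV[R]_3 => v 0 i)); last exact: coord_continuous.
have ym : {for x, continuous (fun x => Y x.1.1.1 (radius x, taum x))}.
  by apply: (curve_continuous (G := Y) cm); apply: Yc => //; exact: strip_m.
have y2 : {for x, continuous (fun x => Y x.1.1.1 (radius x, tau2 x))}.
  by apply: (curve_continuous (G := Y) c2); apply: Yc => //; exact: strip_2.
by apply: cvgB; [apply: cvgZ; [exact: cvg_cst|exact: ym]|exact: y2].
Qed.

Lemma drop_continuous x : {for x, continuous drop}.
Proof.
have [rc c1 c2 cm] := params_continuous x.
apply: cvgD; last by apply: cvgB; [exact: cm|exact: c1].
apply: cvgB.
  by apply: (curve_continuous (G := h) cm); apply: (arcs_h ph); exact: strip_m.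
by apply: (curve_continuous (G := h) c2); apply: (arcs_h ph); exact: strip_2.
Qed.

Lemma drop_lt x : tau2 x < tau1 x -> drop x < 0.
Proof. by move=> lt; rewrite /drop /taum min_r ?(ltW lt) // subrr add0r subr_lt0. Qed.

(** A common zero gives two points of one arc with the same projection and height, so the parameters
    agree by injectivity; then [lead] is [(lam - 1) Y], which is not 0. *)
Lemma lead_drop x : 0 <= x.1.1.1 <= 1 -> lead x = 0 -> drop x != 0.
Proof.
move=> s01 L0; apply/eqP => D0.
have [t10 _ _] := tau1P x; have [t20 _ _] := tau2P x.
have le : tau1 x <= tau2 x.
  by rewrite leNgt; apply/negP => /drop_lt; rewrite D0 ltxx.
have m1 : taum x = tau1 x by rewrite /taum min_l.
have [n1 e1] := Yp s01 (strip_m x); have [n2 e2] := Yp s01 (strip_2 x).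
move: L0 D0; rewrite /lead /drop m1 subrr addr0 in n1 e1 * => /eqP; rewrite subr_eq0 => /eqP L0 /eqP.
rewrite subr_eq0 => /eqP D0.
have pp : p x.1.1.1 (radius x, tau1 x) = p x.1.1.1 (radius x, tau2 x).
  by rewrite -e1 -e2 -L0 -[lam]expr1z pr_scale.
have tt := arcs_inj ph t10 t20 pp D0.
move: L0; rewrite tt => /eqP; rewrite -subr_eq0 -[X in _ - X]scale1r -scalerBl scaler_eq0 (negbTE n2) orbF.
by rewrite lamE => /eqP ?; lra.
Qed.

Lemma some_sign x : 0 <= x.1.1.1 <= 1 ->
  [\/ lead x 0 0 != 0, lead x 0 1 != 0, lead x 0 2 != 0 | drop x != 0].
Proof.
move=> s01; have [|n0] := eqVneq (lead x 0 0) 0; last by constructor 1.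
have [|n1] := eqVneq (lead x 0 1) 0; last by constructor 2.
have [|n2] := eqVneq (lead x 0 2) 0; last by constructor 3.
move=> e2 e1 e0; constructor 4; apply: lead_drop => //.
by apply/rowP => i; rewrite -[lead x]q3K mxE /q3 e0 e1 e2 mxE; case: i => -[|[|[|]]].
Qed.

Lemma start_lead x : x.1.1.1 = 0 -> tau1 x <= tau2 x ->
  let u := radius x - 99/100 in
  [/\ lead x 0 0 = 100 * (arc u (tau1 x)).1.1.1 - (arc u (tau2 x)).1.1.1,
      lead x 0 1 = 100 * (arc u (tau1 x)).1.1.2 - (arc u (tau2 x)).1.1.2,
      lead x 0 2 = 100 * (arc u (tau1 x)).1.2 - (arc u (tau2 x)).1.2 &
      drop x = (arc u (tau1 x)).2 - (arc u (tau2 x)).2].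
Proof.
move=> s0 le u; have m1 : taum x = tau1 x by rewrite /taum min_l.
have [/andP[r0 _] _ _] := radiusP x.
have sm := strip_m x; have s2 := strip_2 x.
rewrite m1 in sm.
have a1 := beta_axisE (tau1 x) r0; have a2 := beta_axisE (tau2 x) r0.
rewrite -/u in a1 a2.
have L : lead x = lam *: mk3 (arc u (tau1 x)).1 - mk3 (arc u (tau2 x)).1.
  by rewrite /lead s0 m1 !Y0 // a1 a2.
rewrite L /drop s0 m1 subrr addr0 (arcs_start ph sm).2 (arcs_start ph s2).2 a1 a2.
by rewrite !mxE /= lamE.
Qed.

Definition in_box (x : T4) := [/\ 1 < x.1.1.2 < 2, 1 < x.1.2 < 2 & 1 < x.2 < 2].

Lemma start_sign x : x.1.1.1 = 0 -> ~ in_box x ->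
  [\/ lead x 0 0 != 0, lead x 0 1 != 0, lead x 0 2 != 0 | drop x < 0].
Proof.
move=> s0 nb; have [|n0] := eqVneq (lead x 0 0) 0; last by constructor 1.
have [|n1] := eqVneq (lead x 0 1) 0; last by constructor 2.
have [|n2] := eqVneq (lead x 0 2) 0; last by constructor 3.
move=> e2 e1 e0; constructor 4; rewrite ltNge; apply/negP => D0; apply: nb.
have le : tau1 x <= tau2 x.
  by rewrite leNgt; apply/negP => /drop_lt; rewrite ltNge D0.
have [/andP[r0 _] ru _] := radiusP x; have [_ u1 _] := tau1P x; have [_ u2 _] := tau2P x.
have r1 : -(89/100) <= radius x - 99/100 by lra.
have [f0 f1 f2 f3] := start_lead s0 le.
have [||||k1 k2 k3] := coincidence_box bx r1 le.
- by apply/eqP; rewrite -subr_eq0 -f0 e0.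
- by apply/eqP; rewrite -subr_eq0 -f1 e1.
- by apply/eqP; rewrite -subr_eq0 -f2 e2.
- by rewrite -subr_ge0 -f3.
by split; [exact: ru|exact: u1|exact: u2].
Qed.

Lemma drop_end x : 0 <= x.1.1.1 <= 1 ->
  [\/ x.1.1.1 = 1, tau1 x = 0 \/ tau1 x = 1 | tau2 x = 0 \/ tau2 x = 1] -> drop x <= 0.
Proof.
move=> s01; have [/andP[t10 t11] _ _] := tau1P x; have [/andP[t20 t21] _ _] := tau2P x.
have /andP[hm0 hm1] := arcs_range ph x.1.1.1 (radius x, taum x).
have /andP[h20 h21] := arcs_range ph x.1.1.1 (radius x, tau2 x).
have [b0 b1] := arcs_ends ph x.1.1.1 (radius x).
have [mle1 mle2] : taum x <= tau1 x /\ taum x <= tau2 x by rewrite /taum !ge_min !lexx orbT.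
have /andP[m0 m1] := taum01 x.
rewrite /drop; case=> [s1|[e|e]|[e|e]].
- have e1 := arcs_final ph (strip_m x); have e2 := arcs_final ph (strip_2 x).
  by rewrite s1 e1 e2 [(_, taum x).2]/= [(_, tau2 x).2]/=; lra.
- have -> : taum x = 0 by lra.
  by rewrite b0 e; lra.
- have -> : taum x = tau2 x by rewrite /taum min_r // e.
  by rewrite e; lra.
- have -> : taum x = 0 by lra.
  by rewrite e b0; lra.
by rewrite e b1 in h20 h21 *; lra.
Qed.

Lemma start_box x : x.1.1.1 = 0 -> 1 <= x.1.1.2 <= 2 -> 1 <= x.1.2 <= 2 -> 1 <= x.2 <= 2 ->
  [/\ (x.1.1.2 = 1 -> 0 < lead x 0 0) /\ (x.1.1.2 = 2 -> lead x 0 0 < 0),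
      (x.1.2 = 1 -> 0 < lead x 0 1) /\ (x.1.2 = 2 -> lead x 0 1 < 0),
      (x.2 = 1 -> lead x 0 2 < 0) /\ (x.2 = 2 -> 0 < lead x 0 2) & 0 < drop x].
Proof.
move=> s0 h1 h2 h3; have [_ _ /(_ h1) e1] := radiusP x.
have [_ _ /(_ h2) e2] := tau1P x; have [_ _ /(_ h3) e3] := tau2P x.
have [[_ q1 _ _] [q2 q3 q4 _]] := box_order.
have b1 : ul <= radius x - 99/100 <= ur by rewrite e1; apply/andP; split; nra.
have b2 : t1l <= tau1 x <= t1r by rewrite e2; apply/andP; split; nra.
have b3 : t2l <= tau2 x <= t2r by rewrite e3; apply/andP; split; nra.
have le : tau1 x <= tau2 x by lra.
have [f0 f1 f2 f3] := start_lead s0 le.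
have [g1 g2 g3 g4] := box_signs bx b1 b2 b3; rewrite -f0 -f1 -f2 -f3 in g1 g2 g3 g4.
clear f0 f1 f2 f3.
split=> //; split=> e; [apply: g1.1|apply: g1.2|apply: g2.1|apply: g2.2|apply: g3.1|apply: g3.2];
  by rewrite ?e1 ?e2 ?e3 e; ring.
Qed.

(** Going around the circle multiplies [lead] by [lam], which preserves signs. *)
Lemma period x x' : 0 <= x.1.1.1 <= 1 -> x'.1.1.1 = x.1.1.1 -> tau1 x' = tau1 x ->
  tau2 x' = tau2 x -> radius x = 1/10 -> radius x' = 10 ->
  lead x' = lam *: lead x /\ drop x' = drop x.
Proof.
move=> s01 es e1 e2 r r'; have em : taum x' = taum x by rewrite /taum e1 e2.
have [t2 _ _] := tau2P x; have tm := taum01 x.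
rewrite /lead /drop es e1 e2 em r r' !Yper // scalerBr; split=> //.
by rewrite !(arcs_period ph _ _).2.
Qed.

(** Two Lebesgue numbers give a mesh for which the sign hypotheses of [no_degree] hold cell by cell.
    Only the predicates [0 < _] are used, so that [drop <= 0] is enough on the faces. *)
Lemma degree_absurd : False.
Proof.
pose F1 (x : T4) := 0 < lead x 0 0; pose F2 (x : T4) := 0 < lead x 0 1.
pose F3 (x : T4) := 0 < lead x 0 2; pose F4 (x : T4) := 0 < drop x.
pose cst (F : T4 -> bool) (A : set T4) := exists v, forall y, A y -> F y = v.
have cst_sub F A B : A `<=` B -> cst F B -> cst F A.
  by move=> AB [v hv]; exists v => y /AB; apply: hv.
pose Q (l : R) : set T4 := ((`[0, l] : set R) `*` (`[0, 3] : set R)) `*` (`[0, 3] : set R) `*` (`[0, 3] : set R).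
have Qc l : compact (Q l) by do 3 (apply: compact_setX; last exact: segment_compact); apply: segment_compact.
have near_cst (g : T4 -> R) (x : T4) : {for x, continuous g} -> g x != 0 ->
    exists2 B, nbhs x B & cst (fun y => 0 < g y) B.
  move=> gc g0; exists [set y | (0 < g y) = (0 < g x)]; first exact: (sign_near gc g0).
  by exists (0 < g x).
have s0P (x : T4) : Q 1 x -> 0 <= x.1.1.1 <= 1 by case=> [[[]]]; rewrite /= in_itv.
have [||d1 d10 hd1] := lebesgue_number (Qc 1) (D := fun A => [\/ cst F1 A, cst F2 A, cst F3 A | cst F4 A]).
- by move=> A B AB [] c; [constructor 1|constructor 2|constructor 3|constructor 4]; apply: cst_sub AB c.
- move=> x /s0P s01; case: (some_sign s01) => n0.
  + by have [B nB cB] := near_cst _ _ (lead_continuous (i := 0) s01) n0; exists B => //; constructor 1.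
  + by have [B nB cB] := near_cst _ _ (lead_continuous (i := 1) s01) n0; exists B => //; constructor 2.
  + by have [B nB cB] := near_cst _ _ (lead_continuous (i := 2) s01) n0; exists B => //; constructor 3.
  + by have [B nB cB] := near_cst _ _ (@drop_continuous _) n0; exists B => //; constructor 4.
pose neg (A : set T4) := forall y, A y -> F4 y = false.
(* The starting slice has its own cover: off the box a constant sign of [drop] is not enough, it
   must be negative for [df1 df2 df3 f4] to vanish. *)
have [||d2 d20 hd2] := lebesgue_number (Qc 0) (D := fun A => (forall y, A y -> in_box y) \/
  [\/ cst F1 A, cst F2 A, cst F3 A | neg A]).
- move=> A B AB [c|[] c]; first by left=> y /AB /c.
  + by right; constructor 1; apply: cst_sub AB c.
  + by right; constructor 2; apply: cst_sub AB c.
  + by right; constructor 3; apply: cst_sub AB c.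
  + by right; constructor 4 => y /AB /c.
- move=> x [[[/= sx _] _] _]; have s0 : x.1.1.1 = 0.
    by move: sx; rewrite /= in_itv /= => /andP[a b]; apply/eqP; rewrite eq_le a b.
  have s01 : 0 <= x.1.1.1 <= 1 by rewrite s0 lexx ler01.
  have [bxx|nb] := pselect (in_box x).
    exists [set y | in_box y]; last by left.
    have op (g : T4 -> R) : {for x, continuous g} -> 1 < g x < 2 -> \forall y \near x, 1 < g y < 2.
      move=> gc /andP[g1 g2].
      apply: (@filterS2 _ (nbhs x) _ _ _ _ _ (gc _ (lt_nbhsr g1)) (gc _ (lt_nbhsl g2))) => y /= -> ->; exact.
    have [k1 k2 k3] := coord4_continuous x; have [b1 b2 b3] := bxx.
    exact: (@filterS3 _ (nbhs x) _ _ _ _ _ _ (op _ k1 b1) (op _ k2 b2) (op _ k3 b3)).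
  case: (start_sign s0 nb) => n0.
  + by have [B nB cB] := near_cst _ _ (lead_continuous (i := 0) s01) n0; exists B => //; right; constructor 1.
  + by have [B nB cB] := near_cst _ _ (lead_continuous (i := 1) s01) n0; exists B => //; right; constructor 2.
  + by have [B nB cB] := near_cst _ _ (lead_continuous (i := 2) s01) n0; exists B => //; right; constructor 3.
  + have [B nB [v cB]] := near_cst _ _ (@drop_continuous _) (ltr0_neq0 n0).
    exists B => //; right; constructor 4 => y By; rewrite /F4 (cB _ By) -(cB x (nbhs_singleton nB)).
    by apply/negbTE; rewrite -leNgt ltW.
have d0 : 0 < Num.min d1 d2 by rewrite lt_min d10 d20.
have [N N0 hN] := fine_mesh d0.
have NR : 0 < N%:R :> R by rewrite ltr0n.
pose e (a : nat) : R := a%:R / N%:R.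
pose pt (g : grid) : T4 := (e g.1.1.1, e g.1.1.2, e g.1.2, e g.2).
have eM k : e (k * N)%N = k%:R by rewrite /e natrM mulfK // lt0r_neq0.
have e1 : e N = 1 by rewrite -[N in e N]mul1n eM.
have e0 : e 0%N = 0 by rewrite /e mul0r.
have e_le a b : (a <= b)%N -> e a <= e b by move=> ab; rewrite ler_pM2r ?invr_gt0 // ler_nat.
have e_in a l : (a <= l * N)%N -> 0 <= e a <= l%:R.
  by move=> al; rewrite -e0 -eM !e_le.
have mesh a a' d : Num.min d1 d2 <= d -> (a <= a' <= a.+1)%N -> ball (e a) d (e a').
  move=> dd /andP[h1 h2]; rewrite /ball /= distrC ger0_norm ?subr_ge0 ?e_le //.
  apply: lt_le_trans dd; apply: le_lt_trans (_ : N%:R^-1 < _).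
    rewrite -mulrBl -[leRHS]mul1r ler_pM2r ?invr_gt0 // lerBlDr.
    by rewrite addrC natr1 ler_nat.
  by rewrite invf_plt ?posrE // -div1r.
have QN l a b c d : (a <= l * N)%N -> (b <= 3 * N)%N -> (c <= 3 * N)%N -> (d <= 3 * N)%N ->
    Q l%:R (pt (a, b, c, d)).
  by move=> *; rewrite /Q /=; do 3 (split => /=; last by rewrite in_itv /= e_in);
    rewrite in_itv /= e_in.
have s01 a b c d : (a <= N)%N -> 0 <= (pt (a, b, c, d)).1.1.1 <= 1.
  by move=> aN; apply: (e_in a 1%N); rewrite mul1n.
have neg4 x : drop x <= 0 -> F4 x = false by rewrite /F4 leNgt => /negbTE.
have p1 := plin_ends 0 t1l t1r 1; have p2 := plin_ends 0 t2l t2r 1.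
have p3 := plin_ends (1/10) (ul + 99/100) (ur + 99/100) 10.
have mid b : inB' N b -> 1 <= e b <= 2.
  by move=> /andP[h1 h2]; rewrite -{1}e1 -(eM 2%N) !e_le.
have B b c d : inB' N b -> inB' N c -> inB' N d -> _ :=
  fun hb hc hd => @start_box (pt (0%N, b, c, d)) e0 (mid b hb) (mid c hc) (mid d hd).
have iN : inB' N N by rewrite /inB' leqnn leq_pmull.
have i2N : inB' N (2 * N)%N by rewrite /inB' leqnn leq_pmull.
have neg0 (x : R) : x < 0 -> (0 < x) = false by move=> ?; apply/negbTE; rewrite -leNgt ltW.
(* The three booleans are the signs on the lower walls in [start_box]: positive, positive,
   negative. *)
apply: (@no_degree N N (F1 \o pt) (F2 \o pt) (F3 \o pt) (F4 \o pt) _ _ _ _ _ _ true true false N0).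
- move=> a b c d ha hb hc hd.
  have Qx : Q 1 (pt (a, b, c, d)) by apply: (QN 1%N); rewrite ?mul1n ltnW.
  have sub a' b' c' d' : (a <= a' <= a.+1)%N -> (b <= b' <= b.+1)%N -> (c <= c' <= c.+1)%N ->
     (d <= d' <= d.+1)%N -> ball (pt (a, b, c, d)) d1 (pt (a', b', c', d')).
    by move=> *; do 3 (split; last by apply: mesh => //; rewrite ge_min lexx);
      apply: mesh => //; rewrite ge_min lexx.
  by case: (hd1 _ Qx) => -[v hv]; [constructor 1|constructor 2|constructor 3|constructor 4];
    exists v => *; apply: hv; apply: sub.
- move=> b c d hb hc hd; apply: neg4; apply: drop_end; first exact: s01.
  by constructor 1; rewrite /= e1.
- move=> a b d ha hb hd; split; apply: neg4; apply: drop_end; try exact: s01.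
    by constructor 2; left; rewrite /tau1 /= e0; case: p1.
  by constructor 2; right; rewrite /tau1 /= eM; case: p1.
- move=> a b c ha hb hc; split; apply: neg4; apply: drop_end; try exact: s01.
    by constructor 3; left; rewrite /tau2 /= e0; case: p2.
  by constructor 3; right; rewrite /tau2 /= eM; case: p2.
- move=> a c d ha hc hd.
  have [||||||L D] := @period (pt (a, 0%N, c, d)) (pt (a, 3 * N, c, d)%N) => //.
  + exact: s01.
  + by rewrite /radius /= e0; case: p3.
  + by rewrite /radius /= eM; case: p3.
  by rewrite /F1 /F2 /F3 /F4 /= L D; split=> //; rewrite mxE pmulr_rgt0 ?lam_gt0.
- move=> b c d hb hc hd out.
  have Qx : Q 0 (pt (0%N, b, c, d)) by apply: (QN 0%N); rewrite ?mul0n // ltnW.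
  have sub b' c' d' : (b <= b' <= b.+1)%N -> (c <= c' <= c.+1)%N ->
     (d <= d' <= d.+1)%N -> ball (pt (0%N, b, c, d)) d2 (pt (0%N, b', c', d')).
    by move=> *; do 3 (split; last by apply: mesh => //; rewrite ge_min lexx orbT);
      apply: mesh => //; rewrite ge_min lexx orbT.
  case: (hd2 _ Qx) => [ib|[[v hv]|[v hv]|[v hv]|hv]].
  + have [] := ib _ (ballxx (pt (0%N, b, c, d)) d20).
    have inN a : 1 < e a < 2 -> inB N a.
      move=> /andP[h1 h2]; apply/andP; split.
        by rewrite leqNgt; apply/negP => /ltnW/e_le; rewrite e1 leNgt h1.
      by rewrite ltnNge; apply/negP => /e_le; rewrite eM leNgt h2.
    by move=> /inN b1 /inN c1 /inN dd1; move: out; rewrite b1 c1 dd1.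
  + by constructor 1; exists v => b' c' d' *; apply: hv; apply: sub.
  + by constructor 2; exists v => b' c' d' *; apply: hv; apply: sub.
  + by constructor 3; exists v => b' c' d' *; apply: hv; apply: sub.
  by constructor 4 => b' c' d' *; apply: hv; apply: sub.
- move=> c d hc hd; have [[b1 _] _ _ _] := B N c d iN hc hd.
  have [[_ b2] _ _ _] := B (2 * N)%N c d i2N hc hd.
  by split; rewrite /F1 /=; [apply: b1|apply: neg0; apply: b2; rewrite /= eM].
- move=> b d hb hd; have [_ [b1 _] _ _] := B b N d hb iN hd.
  have [_ [_ b2] _ _] := B b (2 * N)%N d hb i2N hd.
  by split; rewrite /F2 /=; [apply: b1|apply: neg0; apply: b2; rewrite /= eM].
- move=> b c hb hc; have [_ _ [b1 _] _] := B b c N hb hc iN.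
  have [_ _ [_ b2] _] := B b c (2 * N)%N hb hc i2N.
  by split; rewrite /F3 /=; [apply: neg0; apply: b1|apply: b2; rewrite /= eM].
by move=> b c d hb hc hd; have [_ _ _ ?] := B b c d hb hc hd.
Qed.

End Degree.

Theorem twist_nontrivial : ~ trivial_concordance (M := hopf R) twist.
Proof.
move=> /trivial_arcs [p [h ph]].
have [Y [Yc Yp Y0 Yper]] : exists Y : R -> R * R -> 'rV[R]_3,
  [/\ forall s z, 0 <= s <= 1 -> strip z ->
        {for (s, z), continuous (fun x : R * (R * R) => Y x.1 x.2)},
      forall s z, 0 <= s <= 1 -> strip z -> Y s z != 0 /\ pr (Y s z) = p s z,
      forall z, strip z -> Y 0 z = mk3 (beta (axis z)).1 &
      forall z z', strip z -> strip z' -> (forall s, p s z' = p s z) ->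
        mk3 (beta (axis z')).1 = lam *: mk3 (beta (axis z)).1 ->
        forall s, 0 <= s <= 1 -> Y s z' = lam *: Y s z].
  apply: homotopy_lifting; first exact: strip_compact.
    exact: arcs_p ph.
  move=> z zs; split; [|exact: beta_axis_neq0|by rewrite (arcs_start ph zs).1].
  pose F (v : 'rV[R]_(3 + 1)) := mk3 (beta (q4 v)).1.
  have Fc v : {for v, continuous F}.
    have [h1 h2 h3 _] := (sm_beta (sm_q4 v)).1.
    by apply: mk3_continuous; apply: sm_continuous.
  have -> : (fun z => mk3 (beta (axis z)).1) = F \o (fun z => mk4 (axis z)).
    by apply/funext => w; rewrite /F /comp mk4K.
  apply: continuous_comp; last exact: Fc.
  apply: rV_continuous => j; rewrite /mk4.
  case: (split_ordP j) => k ->.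
    have -> : (fun y : R * R => row_mx (mk3 (axis y).1) (const_mx (axis y).2) 0 (lshift 1 k)) =
       (fun y => mk3 (axis y).1 0 k) by apply/funext => y; rewrite row_mxEl.
    apply: (@continuous_comp _ _ _ (fun y => mk3 (axis y).1) (fun v : 'rV[R]_3 => v 0 k)).
      apply: mk3_continuous; [exact: cvg_cst|exact: cvg_cst|].
      by apply: (@cvgN _ R^o); exact: cvg_fst.
    exact: coord_continuous.
  have -> : (fun y : R * R => row_mx (mk3 (axis y).1) (const_mx (axis y).2) 0 (rshift 3 k)) = snd.
    by apply/funext => y; rewrite row_mxEr mxE.
  exact: cvg_snd.
have [ul [ur [t1l [t1r [t2l [t2r bx]]]]]] := @box_exists R.
apply: (degree_absurd ph Yc Yp Y0 _ bx) => s t s01 t01.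
apply: Yper => //; try by apply/stripP => /=; split=> //; lra.
  by move=> s'; case: (arcs_period ph s' t).
by rewrite beta_axis_scale mk3_sc.
Qed.

End Nontrivial.

(** * The product metric of the Hopf manifold *)

Section Metric.
Context {R : realType}.
Local Notation lam := (@lam R).
Implicit Types (v w : 'rV[R]_3) (i j k m : 'I_3).

Definition sqn v : R := v 0 0 ^+ 2 + v 0 1 ^+ 2 + v 0 2 ^+ 2.

Lemma sqn_gt0 v : v != 0 -> 0 < sqn v.
Proof.
rewrite /sqn => v0; rewrite lt_neqAle !addr_ge0 ?sqr_ge0 // andbT eq_sym.
apply: contra_neq v0 => /eqP; rewrite !paddr_eq0 ?addr_ge0 ?sqr_ge0 // !sqrf_eq0.
move=> /andP[/andP[/eqP e0 /eqP e1] /eqP e2].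
by rewrite -[v]q3K /q3 e0 e1 e2; apply/rowP => i; rewrite !mxE; case: i => -[|[|[|]]].
Qed.

Lemma sqn_neq0 v : v != 0 -> sqn v != 0.
Proof. by move=> /sqn_gt0 /lt0r_neq0. Qed.

Lemma sqnZ (a : R) v : sqn (a *: v) = a ^+ 2 * sqn v.
Proof. by rewrite /sqn !mxE; ring. Qed.

Lemma sum3 (V : nmodType) (F : 'I_3 -> V) : \sum_i F i = F 0 + F 1 + F 2.
Proof.
rewrite !big_ord_recl big_ord0 addr0 addrA.
by congr (_ + F _ + F _); apply: val_inj.
Qed.

Lemma ord3P i : [\/ i = 0, i = 1 | i = 2].
Proof.
by case: i => -[|[|[|//]]] hi; [constructor 1|constructor 2|constructor 3]; apply: val_inj.
Qed.

Lemma is_derive_ext (f g : 'rV[R]_3 -> R) v u (a b : R) : (forall w, f w = g w) -> a = b ->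
  is_derive v u f a -> is_derive v u g b.
Proof. by move=> /funext -> ->. Qed.

Lemma sqn_derive i v : is_derive v (delta_mx 0 i) sqn (2 * v 0 i).
Proof.
apply: (is_derive_ext _ _ (is_deriveD (is_deriveD (is_deriveX 2 (coord_derive 0 i v))
  (is_deriveX 2 (coord_derive 1 i v))) (is_deriveX 2 (coord_derive 2 i v)))) => //.
rewrite /= /GRing.scale /= !expr1.
by case: (ord3P i) => ->; rewrite /= !mulr1 !mulr0 ?addr0 ?add0r.
Qed.

Lemma inv_sqn_derive i v : v != 0 ->
  is_derive v (delta_mx 0 i) (fun w => (sqn w)^-1) (- (2 * v 0 i) / sqn v ^+ 2).
Proof.
move=> /sqn_neq0 v0; have [d e] := sqn_derive i v.
have := is_derive_comp1 d (inv_derive v0); rewrite e; apply: is_derive_ext => //.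
by field.
Qed.

Lemma ratio_derive i m v : v != 0 -> is_derive v (delta_mx 0 m) (fun w => w 0 i / sqn w)
  ((i == m)%:R / sqn v - 2 * (v 0 i / sqn v) * (v 0 m / sqn v)).
Proof.
move=> v0; apply: (is_derive_ext _ _ (is_deriveM (coord_derive i m v) (inv_sqn_derive m v0))) => //.
by rewrite /GRing.scale /=; field; rewrite sqn_neq0.
Qed.

Definition conf v : 'M[R]_3 := ((sqn v)^-1)%:M.

Lemma partial_conf i j l v : v != 0 ->
  partial i (fun w => conf w j l) v = (j == l)%:R * (- (2 * v 0 i) / sqn v ^+ 2).
Proof.
move=> v0; have := is_deriveZ (j == l)%:R (inv_sqn_derive i v0).
move=> /(is_derive_ext (g := fun w => conf w j l) _ (erefl _)) [] //.
by move=> w; rewrite /conf mxE /= /GRing.scale /= mulrC mulr_natr.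
Qed.

(** The usual formula for a metric [exp (2 phi) dx^2] with [phi = - log |x|], whose gradient is
    [- x / |x|^2]. *)
Lemma christoffel_conf k i j v : v != 0 -> christoffel conf k i j v =
  - ((j == k)%:R * (v 0 i / sqn v) + (i == k)%:R * (v 0 j / sqn v)
     - (i == j)%:R * (v 0 k / sqn v)).
Proof.
move=> v0; rewrite /christoffel (bigD1 k) //= big1 => [|l lk]; last first.
  by rewrite /conf invmx_scalar mxE eq_sym (negbTE lk) mul0r.
rewrite addr0 !partial_conf // /conf invmx_scalar mxE eqxx invrK mulr1n.
by field; rewrite sqn_neq0.
Qed.

Lemma partial_christoffel m k i j v : v != 0 -> partial m (christoffel conf k i j) v =
  - ((j == k)%:R * ((i == m)%:R / sqn v - 2 * (v 0 i / sqn v) * (v 0 m / sqn v))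
     + (i == k)%:R * ((j == m)%:R / sqn v - 2 * (v 0 j / sqn v) * (v 0 m / sqn v))
     - (i == j)%:R * ((k == m)%:R / sqn v - 2 * (v 0 k / sqn v) * (v 0 m / sqn v))).
Proof.
move=> v0; have D := is_deriveN (is_deriveB (is_deriveD
  (is_deriveZ (j == k)%:R (ratio_derive i m v0)) (is_deriveZ (i == k)%:R (ratio_derive j m v0)))
  (is_deriveZ (i == j)%:R (ratio_derive k m v0))).
have N := near_neq0 v0.
rewrite /partial; have [_ <-] := D; apply: near_eq_derive.
by apply: (@filterS _ (nbhs v) _ _ _ _ N) => w w0; rewrite christoffel_conf.
Qed.

Lemma ord3E : (((0 == 0 :> 'I_3)%:R = 1 :> R) * ((0 == 1 :> 'I_3)%:R = 0 :> R) * ((0 == 2 :> 'I_3)%:R = 0 :> R) *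
  ((1 == 0 :> 'I_3)%:R = 0 :> R) * ((1 == 1 :> 'I_3)%:R = 1 :> R) * ((1 == 2 :> 'I_3)%:R = 0 :> R) *
  ((2 == 0 :> 'I_3)%:R = 0 :> R) * ((2 == 1 :> 'I_3)%:R = 0 :> R) * ((2 == 2 :> 'I_3)%:R = 1 :> R))%type.
Proof. by []. Qed.

(** The diagonal is enough for the scalar curvature, the inverse metric being a scalar matrix. *)
Lemma ricci_conf i v : v != 0 -> ricci conf i i v = (sqn v)^-1 - (v 0 i / sqn v) ^+ 2.
Proof.
move=> v0; have s0 := sqn_neq0 v0; rewrite /ricci !sum3.
have : (sqn v)^-1 = (v 0 0 / sqn v) ^+ 2 + (v 0 1 / sqn v) ^+ 2 + (v 0 2 / sqn v) ^+ 2.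
  by rewrite !expr_div_n -!mulrDl -/(sqn v); field.
rewrite !partial_christoffel // !christoffel_conf //.
case: (ord3P i) => ->; rewrite !ord3E;
  move: (v 0 0 / sqn v) (v 0 1 / sqn v) (v 0 2 / sqn v) => x y z;
  move: (sqn v)^-1 => c ->; ring.
Qed.

Lemma scalar_curvature_conf v : v != 0 -> scalar_curvature conf v = 2.
Proof.
move=> v0; have s0 := sqn_neq0 v0.
transitivity (\sum_(i < 3) (1 - v 0 i ^+ 2 / sqn v)).
  apply: eq_bigr => i _; rewrite (bigD1 i) //= big1 => [|j ji].
    rewrite addr0 ricci_conf // /conf invmx_scalar invrK mxE eqxx mulr1n.
    by move: (v 0 i) (sqn v) s0 => a b b0; field.
  by rewrite /conf invmx_scalar mxE eq_sym (negbTE ji) mul0r.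
rewrite sum3; have : sqn v = v 0 0 ^+ 2 + v 0 1 ^+ 2 + v 0 2 ^+ 2 by [].
move: (v 0 0) (v 0 1) (v 0 2) (sqn v) s0 => x y z c c0 e.
have -> : 1 - x ^+ 2 / c + (1 - y ^+ 2 / c) + (1 - z ^+ 2 / c) =
    3 - (x ^+ 2 + y ^+ 2 + z ^+ 2) / c by field.
by rewrite -e mulfV //; ring.
Qed.

Definition hopf_metric : tensor_field (hopf R) := fun _ => conf.

Lemma jacobian_near (f : 'rV[R]_3 -> 'rV[R]_3) v (a : R) :
  (\forall w \near v, f w = a *: w) -> jacobian f v = a%:M.
Proof.
move=> N; pose L : {linear 'rV[R]_3 -> 'rV[R]_3} := a \*: idfun.
have -> : jacobian f v = lin1_mx L.
  rewrite /jacobian; congr lin1_mx; apply: (@diff_unique R _ _ f L v).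
    move=> w; apply: rV_continuous => j.
    have -> : (fun y => L y 0 j) = (fun y => a * y 0 j) by apply/funext => y; rewrite mxE.
    exact: (sm_continuous (smM (sm_cst a w) (sm_coord j w))).
  have N0 : \forall w \near (0 : 'rV[R]_3), f (w + v) = a *: (w + v).
    have [r r0 hr] := near_norm N.
    apply: (@filterS _ (nbhs (0 : 'rV[R]_3)) _ _ _ _ (near_ball 0 r0)) => w.
    by rewrite subr0 => wr; apply: hr; rewrite addrK.
  apply/eqaddoP => eps eps0; near=> w.
  have -> : (f \o shift v - (cst (f v) + L)) w = f (w + v) - (f v + a *: w) by [].
  rewrite (nbhs_singleton N) -scalerDr [v + w]addrC.
  have -> : f (w + v) = a *: (w + v) by near: w; exact: N0.
  by rewrite subrr normr0 mulr_ge0 // ltW.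
by apply/matrixP => i j; rewrite /= !mxE eqxx /= eq_sym mulr_natr.
Unshelve. all: by end_near. Qed.

(* Covers both the coordinate changes ([f = id]) and the pullback by a map that
   is the identity. *)
Lemma pullback_in_id c d p : hatlas c -> hatlas d -> chart_dom c p -> chart_dom d p ->
  hopf_metric c (chart_map c p) = pullback_in (M := hopf R) c d id hopf_metric (chart_map c p).
Proof.
move=> [a a0 <-] [b b0 <-] [v va <-] db; rewrite /= wrep_pr //.
have v0 := window_neq0 a0 va; have [k N] := transition b0 v0 db.
rewrite /pullback_in (@jacobian_near _ v (lam ^ k)) //.
have -> : local_rep (hchart a) (hchart b) id v = lam ^ k *: v by apply: (nbhs_singleton N).
rewrite /hopf_metric /conf sqnZ tr_scalar_mx -!scalar_mxM; congr (_%:M).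
by field; rewrite sqn_neq0 // lamX_neq0.
Qed.

Lemma hopf_metric_riemannian : riemannian_metric hopf_metric.
Proof.
split.
- by move=> c d p; apply: pullback_in_id.
- move=> c i j [a a0 <-]; rewrite hchart_img //.
  apply: sm_smooth_open => v /(window_neq0 a0) /sqn_neq0 v0.
  apply: (sm_ext (f := fun w => (i == j)%:R * (sqn w)^-1)).
    by move=> w; rewrite /hopf_metric /conf mxE mulr_natl.
  apply: smM; first exact: sm_cst.
  apply: smV => //; apply: smD; first apply: smD; apply: smX; exact: sm_coord.
- by move=> c v _ _; rewrite /hopf_metric /conf tr_scalar_mx.
move=> c v [a a0 <-]; rewrite hchart_img // => /(window_neq0 a0) /sqn_gt0 v0 u u0.
rewrite /hopf_metric /conf mul_mx_scalar -scalemxAl mxE mulr_gt0 ?invr_gt0 //.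
rewrite mxE sum3 !mxE -!expr2; exact: sqn_gt0.
Qed.

Lemma hopf_metric_psc : psc_metric hopf_metric.
Proof.
split; first exact: hopf_metric_riemannian.
move=> c v [a a0 <-]; rewrite hchart_img // => /(window_neq0 a0) v0.
by rewrite scalar_curvature_conf.
Qed.

End Metric.

Lemma psc_isotopic_refl (R : realType) (M : closed_manifold R) (g h : tensor_field M) :
  psc_metric g -> tensor_eq g h -> psc_isotopic g h.
Proof.
move=> gp gh; exists (fun=> g); split=> //.
by move=> c K s i j _ _ _ t e _ e0; apply: (@filterS _ (nbhs t) _ setT) => [u _ _ v _|]; [rewrite subrr normr0|exact: filterT].
Qed.

(** [pullback] reads the image point in [chart_at], in general a chart other than [c], so even for
    the identity the transformation law of the metric has to be used. *)
Lemma twist_end_isotopic (R : realType) :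
  psc_isotopic (@hopf_metric R) (pullback (concordance_end (M := hopf R) twist) (@hopf_metric R)).
Proof.
apply: psc_isotopic_refl; first exact: hopf_metric_psc.
move=> c v ca vc; rewrite twist_end /pullback /=.
have [cd cm] := chart_imgE ca vc; rewrite -[v in LHS]cm.
have [da dd] := svalP (cid (@atlas_cover R (hopf R) (chart_inv c v))).
have := pullback_in_id ca da cd dd; rewrite cm; exact.
Qed.

Theorem corollary1p4 (R : realType) :
  (exists (M : closed_manifold R) (g : tensor_field M) (H : M * R -> M * R),
      psc_metric g /\ concordance H /\ ~ trivial_concordance H /\
      psc_isotopic g (pullback (concordance_end H) g)) /\
  ~ topological_conjecture R.
Proof.
have iso := twist_end_isotopic R; have psc := @hopf_metric_psc R.
have con := @twist_concordance R; have nt := @twist_nontrivial R.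
split; first by exists (hopf R), (@hopf_metric R), (@twist R).
by move=> /(_ _ _ _ psc con nt).
Qed.
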